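(* Let $\alpha:\mathbb{R}\to(0,1)$ with $\alpha^*=\min_{x\in\mathbb{R}}\alpha(x)>0$, $\max_{x\in\mathbb{R}}\alpha(x)<1$, and suppose the following limits exist with $$1>\lim_{x\to\infty}\alpha(x)=\alpha_I>\alpha^*,\qquad 1>\lim_{x\to-\infty}\alpha(x)=\alpha_J>\alpha^*.$$ Suppose there exists $\beta_0>0$ small enough such that for all $0<\beta\le\beta_0$ the set $A_\beta=\{x\in\mathbb{R}:\alpha(x)<\alpha^*+\beta<1\}$ is bounded and satisfies $0<\ell(A_\beta)<\infty$ and $\ell(\partial A_\beta)=0$. Let $X$ be the process of the context. Then: (1) if $2\alpha^*<\min\{\alpha_I,\alpha_J\}$, then for any $0<\beta\le\beta_0$, $$\lim_{t\to\infty}\frac{1}{t}\int_0^t 1_{\{X(s)\in A_\beta\}}\,ds=1\quad\text{a.s.};$$ (2) if $2\alpha^*>\min\{\alpha_I,\alpha_J\}$, then for any $0<\beta\le\beta_0$ and any $K>0$, $$\lim_{t\to\infty}\frac{1}{t}\int_0^t 1_{\{X(s)\in A_\beta^c\cap[-K,K]^c\}}\,ds=1\quad\text{a.s.}$$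
   Context: $\ell$ is Lebesgue measure on $\mathbb{R}$; $\alpha$ is Borel measurable. $B$ is a standard one-dimensional Brownian motion started at $0$. $\sigma$ is a right-continuous strictly increasing pure-jump process with $\sigma(0)=0$ which, conditionally on the path of $B$, has independent increments with $$\mathbb{E}\big[e^{-\lambda\sigma(y)}\mid B(w),w\le y\big]=e^{-\int_0^y\lambda^{\alpha(B_w)}dw},$$ i.e. its jump intensity at time $w$ is $\nu(ds,B_w)\,dw$ with $\nu(ds,x)=\frac{\alpha(x)s^{-\alpha(x)-1}}{\Gamma(1-\alpha(x))}ds$. $L(t)=\inf\{s\ge0:\sigma(s)>t\}$ and $X(t)=B(L(t))$. *)

(* Defs.v *)
From HB Require Import structures.
From mathcomp Require Export all_boot all_order all_algebra.
From mathcomp Require Export all_classical all_reals all_analysis.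
From mathcomp Require Export measurable_realfun.
Export Order.TTheory GRing.Theory Num.Theory.
Export numFieldNormedType.Exports.

Set Implicit Arguments.
Unset Strict Implicit.
Unset Printing Implicit Defensive.

Local Open Scope classical_set_scope.
Local Open Scope ring_scope.

(* [Y] is a version of the conditional expectation of [X] given the
   sub-sigma-algebra [G], for nonnegative, possibly infinite, [X]: no
   integrability is required, since both sides of the defining identity make
   sense in [0, +oo] and still determine [Y] almost surely. *)
Definition is_cond_exp (d : measure_display) (T : measurableType d)
    (R : realType) (P : probability T R) (G : set_system T)
    (X Y : T -> \bar R) : Prop :=
  [/\ measurable_fun [set: T] X,
      forall om, (0 <= X om)%E,
      forall om, (0 <= Y om)%E,
      forall C, measurable C -> G (Y @^-1` C) &
      forall A, G A -> (\int[P]_(om in A) X om = \int[P]_(om in A) Y om)%E].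

(* Processes are indexed by all of [R]; only times [t >= 0] are meaningful. *)

Definition path_sigma_algebra (d : measure_display) (T : measurableType d)
    (R : realType) (P : probability T R) (Z : R -> {RV P >-> R})
    (J : set R) : set_system T :=
  <<s [set A | exists2 w, J w &
         exists2 C : set R, measurable C & A = Z w @^-1` C] >>.

Definition incr_in (d : measure_display) (T : measurableType d)
    (R : realType) (P : probability T R) (Z : R -> {RV P >-> R})
    (s t : R) (C : set R) : set T :=
  [set om | C (Z t om - Z s om)].

Definition subdivision (R : realType) (n : nat) (t : nat -> R) : Prop :=
  0 <= t 0%N /\ forall i, (i < n)%N -> t i <= t i.+1.

Record brownian_motion (d : measure_display) (T : measurableType d)
    (R : realType) (P : probability T R) (B : R -> {RV P >-> R}) : Prop := {
  bm_start : forall om, B 0 om = 0 ;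
  bm_continuous : forall om,
    {within `[0, +oo[, continuous (fun t => B t om)} ;
  bm_indep : forall (n : nat) (t : nat -> R) (C : nat -> set R),
    subdivision n t -> (forall i, measurable (C i)) ->
    P (\bigcap_(i in `I_n) incr_in B (t i) (t i.+1) (C i)) =
      (\prod_(i < n) P (incr_in B (t i) (t i.+1) (C i)))%E ;
  bm_gaussian : forall (s t : R) (C : set R), 0 <= s -> s < t ->
    measurable C ->
    P (incr_in B s t C) = normal_prob 0 (Num.sqrt (t - s)) C }.

Definition Gamma (R : realType) (a : R) : R :=
  \int[lebesgue_measure]_(s in `]0, +oo[) (s `^ (a - 1) * expR (- s)).

(* The measure s |-> a s^(-a-1) / Gamma(1-a) ds of the a-stable subordinator. *)
Definition stable_levy (R : realType) (a : R) (C : set R) : \bar R :=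
  (\int[lebesgue_measure]_(s in C)
     (a * s `^ (- a - 1) / Gamma (1 - a))%:E)%E.

(* [f (w-)] exists for the nondecreasing functions this is applied to. *)
Definition jump (R : realType) (f : R -> R) (w : R) : R :=
  f w - lim (f s @[s --> w^'-]).

Definition pure_jump (R : realType) (f : R -> R) : Prop :=
  forall y, 0 <= y ->
    ((f y - f 0)%:E = \esum_(w in [set w | (0 < w <= y)%R]) (jump f w)%:E)%E.

(* Number of jumps of [f] on the time interval (u, v] with size in [C]. *)
Definition jump_count (R : realType) (f : R -> R) (u v : R) (C : set R) :
    \bar R :=
  counting [set w | u < w <= v /\ C (jump f w)].

(* Conditionally on the whole path of [B]: the conditional law of finitely
   many increments factorizes. *)
Definition cond_indep_increments (d : measure_display) (T : measurableType d)
    (R : realType) (P : probability T R) (B sigma : R -> {RV P >-> R}) : Prop :=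
  forall (n : nat) (t : nat -> R) (C : nat -> set R),
    subdivision n t -> (forall i, measurable (C i)) ->
    exists Q : nat -> T -> \bar R,
      (forall i, (i < n)%N ->
         is_cond_exp P (path_sigma_algebra B `[0, +oo[)
           (fun om => (\1_(incr_in sigma (t i) (t i.+1) (C i)) om)%:E) (Q i)) /\
      is_cond_exp P (path_sigma_algebra B `[0, +oo[)
        (fun om => (\1_(\bigcap_(i in `I_n)
                          incr_in sigma (t i) (t i.+1) (C i)) om)%:E)
        (fun om => (\prod_(i < n) Q i om)%E).

Record multistable_subordinator (d : measure_display) (T : measurableType d)
    (R : realType) (P : probability T R) (alpha : R -> R)
    (B sigma : R -> {RV P >-> R}) : Prop := {
  ms_start : forall om, sigma 0 om = 0 ;
  ms_increasing : forall om (s t : R), 0 <= s -> s < t ->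
    sigma s om < sigma t om ;
  ms_right_continuous : forall om (t : R), 0 <= t ->
    sigma s om @[s --> t^'+] --> sigma t om ;
  ms_pure_jump : forall om, pure_jump (fun s => sigma s om) ;
  ms_cond_indep : cond_indep_increments B sigma ;
  ms_laplace : forall y lam : R, 0 <= y -> 0 < lam ->
    is_cond_exp P (path_sigma_algebra B `[0, y])
      (fun om => (expR (- (lam * sigma y om)))%:E)
      (fun om => (expR (- \int[lebesgue_measure]_(w in `[0, y])
                            (lam `^ alpha (B w om))))%:E) ;
  ms_jump_intensity : forall (u v : R) (C : set R), 0 <= u -> u <= v ->
    measurable C -> C `<=` `]0, +oo[ ->
    is_cond_exp P (path_sigma_algebra B `[0, +oo[)
      (fun om => jump_count (fun s => sigma s om) u v C)
      (fun om => (\int[lebesgue_measure]_(w in `]u, v])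
                    stable_levy (alpha (B w om)) C)%E) }.

Definition right_inverse (R : realType) (f : R -> R) (t : R) : R :=
  inf [set s | 0 <= s /\ t < f s].

Definition time_changed (d : measure_display) (T : measurableType d)
    (R : realType) (P : probability T R) (B sigma : R -> {RV P >-> R})
    (t : R) (om : T) : R :=
  B (right_inverse (fun s => sigma s om) t) om.

Definition occupation_fraction (R : realType) (x : R -> R) (A : set R) (t : R)
    : R :=
  t^-1 * \int[lebesgue_measure]_(s in `[0, t]) \1_A (x s).

Definition low_set (R : realType) (alpha : R -> R) (astar beta : R) : set R :=
  [set x | alpha x < astar + beta < 1].

(* Main.v *)
(* Let D be the complement of the target set and split sigma(y) according to the
   position of B at the jumps.  X stays at B(w) during [sigma(w-), sigma(w)[, so
   the time that X spends in D up to sigma(y) is the total size of the jumps of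
   sigma made before y while B is in D.  Hence it suffices to find g < g' such
   that, along Y_j = 2^(N j^2), almost surely for all large j, these jumps add up
   to O(Y_j^g) while sigma(Y_j) >= Y_j^g'.
   Upper bound: min(s, 1) is dominated by a dyadic series of indicators of
   ]2^-(k+1), oo[, so first moments of jump counts give
   P(mass > H) <= C H^-a E[occupation of D by B before y] if alpha >= a on D; the
   expected occupation is O(sqrt y) for bounded D and at most y in general.
   Lower bound: by the Laplace transform, sigma(Y) is small only if B spends
   little time where alpha is low.  After any time s, given |B_s| = O(sqrt s), a
   second moment argument shows that B spends, with probability at least 1/128, a
   time of order |A| sqrt s in A during a window of length O(s); iterating over j
   windows makes the failure probability geometric in j.
   With m = min(aI, aJ), the first case leaves room for
   max(1 / m, 1 / (2 (astar + beta))) < g < g' < 1 / (2 astar), testing the lower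
   bound on A = low_set eps; the second one for 1 / (2 astar) < g < g' < 1 / m,
   testing it on moving intervals A of length sqrt(Y) / 4 where alpha is near m. *)
From mathcomp Require Import finmap.
Require Import Defs.
From mathcomp Require Import ring lra.

Set Implicit Arguments.
Unset Strict Implicit.
Unset Printing Implicit Defensive.

Local Open Scope classical_set_scope.
Local Open Scope ring_scope.

(** The exponents come from a scaling heuristic: a stable subordinator of index a run for a time r
    reaches order r^(1/a). Up to time y, B spends a time of order sqrt y in a bounded set, but can
    spend a time of order y far out. The places where alpha is low thus contribute about y^(1 / (2
    astar)) and the far region about y^(1 / m), and the two cases of the theorem tell which power
    wins. Since distinct powers are compared, all constants may be crude. The upper bound cannot
    start from the mean of the jump mass: all indices lie below 1, so large jumps have infinite
    mean. Sizes are therefore measured in units of the level H and cut off at 1, which keeps the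
    first moment finite and loses nothing on the event that the mass exceeds H. The lower bound has
    to hold at every large scale, while a second moment alone only yields a probability bounded
    below. The windows start at deterministic times, so the Markov property at fixed times is enough
    to multiply the failures. *)

(** * Joint measurability of processes and integrals of inverse square roots *)

Lemma continuous_process_measurable d (T : measurableType d) (R : realType)
    (Z : R -> T -> R) :
  (forall w, measurable_fun [set: T] (Z w)) ->
  (forall om, continuous (Z ^~ om)) ->
  measurable_fun [set: R * T] (fun p => Z p.1 p.2).
Proof.
move=> mZ cZ.
(* Left end of the cell of mesh 1/(n+1) containing w. The process frozen there only involves
   countably many random variables, and path continuity gives the pointwise limit. *)
pose x_ (n : nat) (w : R) : R := (Num.floor (w * n.+1%:R))%:~R / n.+1%:R.
apply: (@measurable_fun_cvg _ _ _ _ (fun n p => Z (x_ n p.1) p.2)).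
- move=> n _ C mC; rewrite setTI.
  rewrite (_ : _ @^-1` C = \bigcup_(k in [set: int])
     ([set w | Num.floor (w * n.+1%:R) = k] `*` (Z (k%:~R / n.+1%:R) @^-1` C))).
    apply: countable_bigcupT_measurable; first exact: countableP.
    move=> k; apply: measurableX.
      rewrite (_ : mkset _ = `[k%:~R / n.+1%:R, (k + 1)%:~R / n.+1%:R[%classic).
        exact: measurable_itv.
      apply/seteqP; split => w /=.
        move=> <-; rewrite in_itv/= ler_pdivrMr// ltr_pdivlMr//.
        exact: floor_itv.
      rewrite in_itv/= ler_pdivrMr// ltr_pdivlMr// => H.
      exact: floor_def.
    by rewrite -[X in measurable X]setTI; exact: mZ.
  apply/seteqP; split => -[w om] /=.
    by move=> H; exists (Num.floor (w * n.+1%:R)).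
  by move=> [k _ [/= <-]].
- move=> [w om] _ /=.
  apply: (cvg_comp (fun n => x_ n w) (Z ^~ om)); last exact: cZ.
  have h : (w - n.+1%:R^-1) @[n --> \oo] --> w.
    rewrite -[X in _ --> X]subr0; apply: cvgB; first exact: cvg_cst.
    exact: cvg_harmonic.
  apply: (squeeze_cvgr _ h (cvg_cst w)); apply: nearW => n.
  have /andP[h1 h2] := floor_itv (w * n.+1%:R).
  rewrite /x_ ler_pdivlMr// ler_pdivrMr// h1 andbT.
  rewrite mulrBl mulVf ?pnatr_eq0// lerBlDr.
  by rewrite (le_trans (ltW h2))// intrD.
Qed.

(** The integrand may blow up at both ends, so the fundamental theorem of calculus is applied on
    compact subintervals, followed by monotone convergence. *)
Lemma integral_oo_le_increment (R : realType) (f F : R -> R) (p q M : R) :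
  p < q ->
  (forall x, p < x < q -> 0 <= f x) ->
  (forall x, p < x < q -> {for x, continuous f}) ->
  (forall x, p < x < q -> is_derive x 1 F (f x)) ->
  (forall x y, p < x -> x < y -> y < q -> F y - F x <= M) ->
  (\int[lebesgue_measure]_(x in `]p, q[) (f x)%:E <= M%:E)%E.
Proof.
move=> pq f0 cf dF FM.
(* The shift by 3 keeps [e n] at most a third of the length, so that the compact intervals are
   nondegenerate from n = 0 on. *)
pose e n : R := (q - p) / n.+3%:R.
have e0 n : 0 < e n by rewrite divr_gt0// subr_gt0.
have e3 n : e n <= (q - p) / 3.
  rewrite /e ler_pM2l ?subr_gt0// lef_pV2 ?posrE// ler_nat.
  by rewrite ltnS.
have enm n m : (n <= m)%N -> e m <= e n.
  by move=> nm; rewrite /e ler_pM2l ?subr_gt0// lef_pV2 ?posrE// ler_nat.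
pose S n : set R := `[p + e n, q - e n]%classic.
have SE : `]p, q[%classic = \bigcup_n S n.
  apply/seteqP; split => x /=; last first.
    move=> [n _]; rewrite /S /= !in_itv/= => /andP[h1 h2].
    by apply/andP; split; have := e0 n; lra.
  rewrite in_itv/= => /andP[px xq].
  have h : e n @[n --> \oo] --> 0.
    have -> : 0 = (q - p) * 0 :> R by rewrite mulr0.
    apply: cvgMr => /=.
    have := @cvg_harmonic R.
    by rewrite -(cvg_shiftn 2); under eq_fun do rewrite addn2.
  have [N _ HN] : \forall n \near \oo, e n < Num.min (x - p) (q - x).
    by move/cvgrPdist_lt : h => /(_ (Num.min (x - p) (q - x))) [|N _ HN];
      [rewrite lt_min !subr_gt0 px|exists N => // n /HN;
      rewrite sub0r normrN gtr0_norm].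
  exists N => //; rewrite /S/= in_itv/=.
  have := HN N (leqnn _); rewrite lt_min => /andP[h1 h2].
  by apply/andP; split; lra.
have Spq n x : S n x -> p < x < q.
  move=> Sx; have : `]p, q[%classic x by rewrite SE; exists n.
  by rewrite /= in_itv.
have cvgS : (\int[lebesgue_measure]_(x in S n) (f x)%:E)%E @[n --> \oo] -->
    (\int[lebesgue_measure]_(x in \bigcup_n S n) (f x)%:E)%E.
  apply: ge0_nondecreasing_set_cvg_integral.
  - move=> n m nm; rewrite subsetEset; apply: subset_itvScc; rewrite bnd_simp;
      have := enm _ _ nm; lra.
  - by move=> i; exact: measurable_itv.
  - move=> n; apply/measurable_EFinP; apply: subspace_continuous_measurable_fun; first exact: measurable_itv.
    by apply: continuous_in_subspaceT => x; rewrite inE => /Spq; exact: cf.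
  - by move=> n x /Spq h; rewrite lee_fin f0.
rewrite SE -(cvg_lim _ cvgS)//; apply: lime_le; first by apply/cvg_ex; eexists; exact: cvgS.
apply: nearW => n.
have n3 : e n <= (q - p) / 3 by [].
have ab : p + e n < q - e n by lra.
rewrite (@continuous_FTC2 _ f F)//.
- by rewrite -EFinB lee_fin FM//; have := e0 n; lra.
- by apply: continuous_in_subspaceT => x; rewrite inE => /Spq; exact: cf.
- have cF x : S n x -> {for x, continuous F}.
    move=> /Spq h; apply: differentiable_continuous.
    by apply/derivable1_diffP; have [] := dF x h.
  split.
  + move=> x; rewrite in_itv/= => /andP[h1 h2].
    have h : p < x < q by have := e0 n; lra.
    by have [] := dF x h.
  + by apply: cvg_at_right_filter; apply: cF; rewrite /S/= in_itv/=; lra.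
  + by apply: cvg_at_left_filter; apply: cF; rewrite /S/= in_itv/=; lra.
- move=> x; rewrite in_itv/= => /andP[h1 h2]; rewrite derive1E.
  have h : p < x < q by have := e0 n; lra.
  by have [_ ->] := dF x h.
Qed.

Lemma integral_inv_sqrt_right (R : realType) (w b : R) : w < b ->
  (\int[lebesgue_measure]_(x in `]w, b[) ((Num.sqrt (x - w))^-1)%:E
    <= (2 * Num.sqrt (b - w))%:E)%E.
Proof.
move=> wb; apply: (@integral_oo_le_increment _ (fun x => (Num.sqrt (x - w))^-1) (fun x => 2 * Num.sqrt (x - w))) => //.
- move=> x /andP[wx xb]; apply: cvgV.
    by rewrite gt_eqF// sqrtr_gt0 subr_gt0.
  apply: (continuous_comp (f := fun x => x - w) (g := Num.sqrt)).
    by apply: cvgB; [exact: cvg_id|exact: cvg_cst].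
  exact: sqrt_continuous.
- move=> x /andP[wx xb].
  have xw : 0 < x - w by rewrite subr_gt0.
  have h : is_derive x 1 (fun x => x - w) 1.
    exact: (is_derive_eq (is_deriveB (is_derive_id x (1 : R)) (is_derive_cst w x 1)) (subr0 1)).
  have h2 := is_derive1_sqrt xw.
  have h3 : is_derive x 1 (Num.sqrt \o (fun x => x - w)) ((2 * Num.sqrt (x - w))^-1 * 1).
    exact: is_derive1_comp.
  apply: (is_derive_eq (is_deriveZ 2 h3)).
  have s0 : Num.sqrt (x - w) != 0 by rewrite gt_eqF// sqrtr_gt0.
  by rewrite /GRing.scale/=; field.
- move=> x y wx xy yb; rewrite -[leRHS]subr0; apply: lerB.
    by rewrite ler_pM2l// ler_wsqrtr// lerB// ltW.
  by rewrite mulr_ge0// sqrtr_ge0.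
Qed.

Lemma integral_inv_sqrt_left (R : realType) (a w : R) : a < w ->
  (\int[lebesgue_measure]_(x in `]a, w[) ((Num.sqrt (w - x))^-1)%:E
    <= (2 * Num.sqrt (w - a))%:E)%E.
Proof.
move=> aw; apply: (@integral_oo_le_increment _ (fun x => (Num.sqrt (w - x))^-1) (fun x => (- 2) * Num.sqrt (w - x))) => //.
- move=> x /andP[wx xb]; apply: cvgV.
    by rewrite gt_eqF// sqrtr_gt0 subr_gt0.
  apply: (continuous_comp (f := fun x => w - x) (g := Num.sqrt)).
    by apply: cvgB; [exact: cvg_cst|exact: cvg_id].
  exact: sqrt_continuous.
- move=> x /andP[wx xb].
  have xw : 0 < w - x by rewrite subr_gt0.
  have h : is_derive x 1 (fun x => w - x) (-1).
    exact: (is_derive_eq (is_deriveB (is_derive_cst w x 1) (is_derive_id x (1 : R))) (sub0r 1)).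
  have h2 := is_derive1_sqrt xw.
  have h3 : is_derive x 1 (Num.sqrt \o (fun x => w - x)) ((2 * Num.sqrt (w - x))^-1 * (-1)).
    exact: is_derive1_comp.
  apply: (is_derive_eq (is_deriveZ (-2) h3)).
  have s0 : Num.sqrt (w - x) != 0 by rewrite gt_eqF// sqrtr_gt0.
  by rewrite /GRing.scale/=; field.
- move=> x y wx xy yb; rewrite !mulNr opprK addrC -[leRHS]subr0; apply: lerB.
    by rewrite ler_pM2l// ler_wsqrtr// lerB// ltW.
  by rewrite mulr_ge0// sqrtr_ge0.
Qed.

Lemma measurable_inv_sqrt_dist (R : realType) (w : R) :
  measurable_fun [set: R] (fun x => ((Num.sqrt `|x - w|)^-1)%:E).
Proof.
apply/measurable_EFinP.
rewrite (_ : (fun x => _) = (fun x => (`|x - w| `^ (- 2^-1)))); last first.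
  by apply/funext => x; rewrite powRN powR12_sqrt.
apply: (measurableT_comp (measurable_powR _)).
by apply: measurableT_comp => //; exact: measurable_funB.
Qed.

(** The kernel of the occupation estimates: after a time u, the density of B is of order 1 / sqrt u.
    At x = w the inverse takes its default value 0, on a null set. *)
Lemma integral_inv_sqrt_dist (R : realType) (a w b : R) : a <= w <= b ->
  (\int[lebesgue_measure]_(x in `[a, b]) ((Num.sqrt `|x - w|)^-1)%:E
    <= (4 * Num.sqrt (b - a))%:E)%E.
Proof.
move=> /andP[aw wb].
have mf D := measurable_funS measurableT (@subsetT _ D) (@measurable_inv_sqrt_dist R w).
have f0 (D : set R) (x : R) : D x -> (0 <= ((Num.sqrt `|x - w|)^-1)%:E)%E.
  by move=> _; rewrite lee_fin invr_ge0 sqrtr_ge0.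
have -> : `[a, b]%classic = `[a, w[%classic `|` `[w, b]%classic.
  by rewrite -itv_bndbnd_setU.
rewrite ge0_integral_setU; last 5 first.
- exact: measurable_itv.
- exact: measurable_itv.
- exact: mf.
- by move=> x; exact: f0.
- rewrite disj_set2E; apply/eqP/seteqP; split => // x [] /=.
  by rewrite !in_itv/= => /andP[_ h1] /andP[h2 _]; lra.
rewrite (integral_itv_bndoo _ _ (mf _)).
rewrite (_ : 4 = 2 + 2)%R; last by lra.
rewrite mulrDl EFinD; apply: leeD.
- have [/eqP aw'|aw'] := boolP (a == w).
    by rewrite aw' set_itvoo0 integral_set0 lee_fin mulr_ge0// sqrtr_ge0.
  have aw2 : a < w by rewrite lt_neqAle aw'.
  apply: (@le_trans _ _ (2 * Num.sqrt (w - a))%:E); last first.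
    by rewrite lee_fin ler_pM2l// ler_wsqrtr// lerB.
  apply: le_trans (integral_inv_sqrt_left aw2).
  rewrite le_eqVlt; apply/orP; left; apply/eqP; apply: eq_integral => x.
  rewrite inE/= in_itv/= => /andP[_ xw].
  by rewrite distrC gtr0_norm// subr_gt0.
- rewrite (integral_itv_bndoo _ _ (mf _)).
  have [/eqP aw'|aw'] := boolP (w == b).
    by rewrite aw' set_itvoo0 integral_set0 lee_fin mulr_ge0// sqrtr_ge0.
  have aw2 : w < b by rewrite lt_neqAle aw'.
  apply: (@le_trans _ _ (2 * Num.sqrt (b - w))%:E); last first.
    by rewrite lee_fin ler_pM2l// ler_wsqrtr// lerB.
  apply: le_trans (integral_inv_sqrt_right aw2).
  rewrite le_eqVlt; apply/orP; left; apply/eqP; apply: eq_integral => x.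
  rewrite inE/= in_itv/= => /andP[xw _].
  by rewrite gtr0_norm// subr_gt0.
Qed.

(** * Gaussian estimates *)

(** Maximum of the standard normal density; for variance u the maximum is
    [gauss_peak R / Num.sqrt u]. *)
Definition gauss_peak (R : realType) : R := (Num.sqrt (2 * pi))^-1.

Lemma gauss_peak_gt0 (R : realType) : 0 < gauss_peak R.
Proof. by rewrite invr_gt0 sqrtr_gt0 mulr_gt0// pi_gt0. Qed.

Lemma normal_pdf_sqrtE (R : realType) (u x : R) : 0 < u ->
  normal_pdf 0 (Num.sqrt u) x = gauss_peak R / Num.sqrt u * expR (- (x ^+ 2 / (2 * u))).
Proof.
move=> u0; rewrite normal_pdfE ?gt_eqF ?sqrtr_gt0//.
rewrite /normal_peak /normal_fun sqr_sqrtr ?(ltW u0)// subr0 mulNr.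
congr (_ * expR (- (_ / _))); last by rewrite mulr_natl.
rewrite /gauss_peak -invfM -sqrtrM ?mulr_ge0 ?pi_ge0//.
by rewrite -mulr_natl; congr (Num.sqrt _)^-1; ring.
Qed.

Lemma normal_prob_ub (R : realType) (u : R) (A : set R) : 0 < u -> measurable A ->
  (normal_prob 0 (Num.sqrt u) A <=
     (gauss_peak R / Num.sqrt u)%:E * lebesgue_measure A)%E.
Proof.
move=> u0 mA; rewrite -integral_cst//; apply: ge0_le_integral => //=.
- by move=> x _; rewrite lee_fin normal_pdf_ge0.
- by apply/measurable_EFinP; apply: measurable_funTS; exact: measurable_normal_pdf.
- move=> x _; rewrite lee_fin normal_pdf_sqrtE//.
  rewrite ler_piMr//; first by rewrite divr_ge0 ?sqrtr_ge0// ltW// gauss_peak_gt0.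
  by rewrite -expR0 ler_expR lerNl oppr0 divr_ge0// ?sqr_ge0// mulr_ge0// ltW.
Qed.

(** Within one standard deviation the exponential factor is at least 1 - 1/2, whence the 2 in the
    denominator. *)
Lemma normal_prob_lb (R : realType) (u : R) (A : set R) : 0 < u -> measurable A ->
  (forall x, A x -> x ^+ 2 <= u) ->
  ((gauss_peak R / (2 * Num.sqrt u))%:E * lebesgue_measure A <=
     normal_prob 0 (Num.sqrt u) A)%E.
Proof.
move=> u0 mA Au; rewrite -integral_cst//; apply: ge0_le_integral => //=.
- move=> x _; rewrite lee_fin divr_ge0//; exact/ltW/gauss_peak_gt0.
- by apply/measurable_EFinP; apply: measurable_funTS; exact: measurable_normal_pdf.
- move=> x Ax; rewrite lee_fin normal_pdf_sqrtE//.
  rewrite (_ : _ / (2 * _) = gauss_peak R / Num.sqrt u * 2^-1); last first.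
    by rewrite invfM mulrA mulrAC.
  rewrite ler_pM2l; last by rewrite divr_gt0 ?sqrtr_gt0// gauss_peak_gt0.
  apply: le_trans (expR_ge1Dx _).
  have : x ^+ 2 / (2 * u) <= 2^-1.
    rewrite invfM mulrCA ger_pMr// ler_pdivrMr// mul1r; exact: Au.
  lra.
Qed.

(** Half of the Gaussian exponent is traded for exp(- L^2 / 4); the other half makes up the density
    of variance 2u, of total mass 1, and the factor 2 covers the ratio sqrt 2 of the peaks. A
    polynomial bound suffices because L will be 2^j. *)
Lemma normal_prob_tail (R : realType) (u L : R) : 0 < u -> 0 < L ->
  (normal_prob 0 (Num.sqrt u) [set x | (L * Num.sqrt u < `|x|)%R] <=
     (8 / L ^+ 2)%:E)%E.
Proof.
move=> u0 L0.
have mA : measurable [set x : R | L * Num.sqrt u < `|x|].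
  have := @normr_measurable R setT measurableT _
    (measurable_itv `]L * Num.sqrt u, +oo[); rewrite setTI.
  by congr measurable; apply/seteqP; split => x /=; rewrite in_itv/= andbT.
apply: (@le_trans _ _
  (\int[lebesgue_measure]_x ((2 * expR (- (L ^+ 2 / 4)))%:E *
     (normal_pdf 0 (Num.sqrt (2 * u)) x)%:E)))%E; last first.
  rewrite ge0_integralZl//=; last 2 first.
  - by apply/measurable_EFinP; exact: measurable_normal_pdf.
  - by move=> x _; rewrite lee_fin normal_pdf_ge0.
  rewrite integral_normal_pdf mule1 lee_fin.
  rewrite expRN (_ : 8 / _ = 2 * (L ^+ 2 / 4)^-1); last by field; rewrite gt_eqF.
  rewrite ler_pM2l// lef_pV2 ?posrE ?expR_gt0 ?divr_gt0 ?exprn_gt0//.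
  by apply: le_trans (expR_ge1Dx _); rewrite lerDr.
rewrite /normal_prob integral_mkcond/=; apply: ge0_le_integral => //=.
- by move=> x _; apply: erestrict_ge0 => y _; rewrite lee_fin normal_pdf_ge0.
- apply/(measurable_restrictT _ mA)/measurable_EFinP; apply: measurable_funTS.
  exact: measurable_normal_pdf.
- apply: measurable_funeM; apply/measurable_EFinP; exact: measurable_normal_pdf.
- move=> x _; rewrite /patch; case: ifPn => [|_]; last first.
    by rewrite lee_fin mulr_ge0 ?normal_pdf_ge0// mulr_ge0 ?expR_ge0.
  rewrite inE/= => xL; rewrite -EFinM lee_fin !normal_pdf_sqrtE ?mulr_gt0//.
  rewrite sqrtrM//.
  have s0 : 0 < Num.sqrt u by rewrite sqrtr_gt0.
  have s2 : 0 < Num.sqrt (2 : R) by rewrite sqrtr_gt0.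
  have s22 : Num.sqrt (2 : R) <= 2.
    by rewrite -[leRHS]ger0_norm// -sqrtr_sqr ler_wsqrtr// expr2; lra.
  rewrite (_ : 2 * _ * (gauss_peak R / _ * _) =
    (gauss_peak R / Num.sqrt u) *
      (2 / Num.sqrt 2 * (expR (- (L ^+ 2 / 4)) * expR (- (x ^+ 2 / (2 * (2 * u)))))));
    last by rewrite invfM; ring.
  rewrite ler_pM2l; last by rewrite divr_gt0 ?gauss_peak_gt0.
  rewrite -expRD; apply: (@le_trans _ _ (expR (- (L ^+ 2 / 4) - x ^+ 2 / (2 * (2 * u))))); last first.
    by rewrite ler_peMl ?expR_ge0// ler_pdivlMr// mul1r.
  rewrite ler_expR.
  have : L ^+ 2 * u <= x ^+ 2.
    rewrite -(sqr_sqrtr (ltW u0)) -exprMn -(real_normK (num_real x)).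
    by apply: lerXn2r; rewrite ?nnegrE ?mulr_ge0// ltW.
  rewrite -ler_pdivlMr// => h.
  have -> : x ^+ 2 / (2 * u) = x ^+ 2 / u / 2 by field; rewrite gt_eqF.
  have -> : x ^+ 2 / (2 * (2 * u)) = x ^+ 2 / u / 4 by field; rewrite gt_eqF.
  lra.
Qed.

(** * Independence and the Markov property *)

Lemma setI_closed_dynkin_sub (T : Type) (G H : set_system T) :
  setI_closed G -> dynkin H -> G `<=` H -> <<s G >> `<=` H.
Proof.
by move=> GI dH GH; rewrite -setI_closed_g_dynkin_g_sigma_algebra//; exact: smallest_sub.
Qed.

Lemma fin_num_probability d (T : measurableType d) (R : realType)
  (P : probability T R) (A : set T) : measurable A -> P A \is a fin_num.
Proof. by move=> mA; exact: fin_num_measure. Qed.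

Lemma indep_dynkin d (T : measurableType d) (R : realType) (P : probability T R)
    (I : set T) : measurable I ->
  dynkin [set A | measurable A /\ (P (A `&` I) = P A * P I)%E].
Proof.
move=> mI; split.
- by split; [exact: measurableT|rewrite setTI probability_setT mul1e].
- move=> A /= [mA AI]; split; first exact: measurableC.
  have mAI := measurableI _ _ mA mI.
  rewrite probability_setC// muleBl ?fin_num_measure// mul1e -AI.
  have -> : (~` A `&` I) = I `\` (A `&` I).
    by apply/seteqP; split => x /= [h1 h2]; split => //; [move=> []|move=> Ax; apply: h2].
  rewrite measureD//; first by congr (_ - P _)%E; apply/seteqP; split => x /=; tauto.
  by rewrite -ge0_fin_numE// fin_num_measure.
- move=> F tF HF; split; first by apply: bigcupT_measurable => n; have [] := HF n.
  rewrite setI_bigcupl measure_semi_bigcup; last 3 first.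
  + by move=> n; apply: measurableI => //; have [] := HF n.
  + by under eq_fun do rewrite setIC; exact: trivIset_setIl.
  + by apply: bigcupT_measurable => n; apply: measurableI => //; have [] := HF n.
  rewrite measure_semi_bigcup//; last 2 first.
  + by move=> n; have [] := HF n.
  + by apply: bigcupT_measurable => n; have [] := HF n.
  rewrite -(fineK (fin_num_probability P mI)) muleC -nneseriesZl//.
  by apply: eq_eseriesr => n _; have [_ h] := HF n; rewrite muleC fineK ?fin_num_measure//; exact: h.
Qed.

(** Freezing: on [E], the variable [Y] has law [g] independently of [X], so [X] can be held fixed
    while [Y] is integrated out. Rectangles are a pi-system generating the Borel sets of the
    plane. *)
Lemma indep_pair_law d (T : measurableType d) (R : realType) (P : probability T R)
    (g : probability (measurableTypeR R) R) (E : set T) (X Y : T -> R) :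
  measurable E -> measurable_fun [set: T] X -> measurable_fun [set: T] Y ->
  (forall A C : set R, measurable A -> measurable C ->
    P (E `&` X @^-1` A `&` Y @^-1` C) = P (E `&` X @^-1` A) * g C)%E ->
  forall M : set (R * R), measurable M ->
    P (E `&` [set om | M (X om, Y om)]) = (\int[P]_(om in E) g (xsection M (X om)))%E.
Proof.
move=> mE mX mY XY.
pose G := [set M : set (R * R) | exists A C, [/\ measurable A, measurable C & M = A `*` C]].
pose H := [set M : set (R * R) | measurable M /\
  P (E `&` [set om | M (X om, Y om)]) = (\int[P]_(om in E) g (xsection M (X om)))%E].
have mXY : measurable_fun [set: T] (fun om => (X om, Y om)) by exact: measurable_fun_pair.
have mEM M : measurable M -> measurable (E `&` [set om | M (X om, Y om)]).
  move=> mM; apply: measurableI => //.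
  by rewrite -[X in measurable X]setTI; exact: mXY.
have mgX M : measurable M -> measurable_fun E (fun om => g (xsection M (X om))).
  move=> mM; apply: measurable_funTS.
  by apply: (measurableT_comp (measurable_fun_xsection g mM)).
have GH : <<s G >> `<=` H.
  apply: setI_closed_dynkin_sub.
  - move=> _ _ [A [C [mA mC ->]]] [A' [C' [mA' mC' ->]]]; exists (A `&` A'), (C `&` C').
    by split; [exact: measurableI|exact: measurableI|rewrite setXI].
  - split.
    + split => //; rewrite [X in P X](_ : _ = E); last by apply/seteqP; split => x //= [].
      under eq_integral do rewrite xsectionE preimage_setT probability_setT.
      by rewrite integral_cst// mul1e.
    + move=> M [mM HM]; split; first exact: measurableC.
      have mMC := measurableC mM.
      have h : P E = (P (E `&` [set om | M (X om, Y om)]) + P (E `&` [set om | (~` M) (X om, Y om)]))%E.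
        rewrite -measureU; [congr (P _)|exact: mEM|exact: mEM|].
          by apply/seteqP; split => x /=; [have [] := pselect (M (X x, Y x)); tauto|tauto].
        by apply/seteqP; split => x //= [[_ h1] [_ h2]].
      have h' : P E = (\int[P]_(om in E) g (xsection M (X om)) + \int[P]_(om in E) g (xsection (~` M) (X om)))%E.
        rewrite -ge0_integralD//; last 2 first.
        - exact: mgX.
        - exact: mgX.
        rewrite (eq_integral (cst 1%E)) ?integral_cst ?mul1e// => om _.
        rewrite -measureU; last 3 first.
        - exact: measurable_xsection.
        - exact: measurable_xsection.
        - by rewrite -xsectionI setICr xsection0.
        rewrite !xsectionE -preimage_setU setUCr preimage_setT.
        exact: (probability_setT g).
      (* The identities for M and its complement have the same total P E; the term of M is finite
         and cancels. *)
      have f1 := fin_num_probability P (mEM _ mM).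
      move: h'; rewrite h -HM => /eqP; rewrite eq_le => /andP[h1 h2].
      by apply/eqP; rewrite eq_le; move: h1 h2; rewrite !leeD2lE// => -> ->.
    + move=> F tF HF; have mF n : measurable (F n) by have [] := HF n.
      split; first exact: bigcupT_measurable.
      rewrite (_ : [set om | _] = \bigcup_n [set om | F n (X om, Y om)]); last first.
        by apply/seteqP; split => x /= [n _ h]; exists n.
      rewrite setI_bigcupr measure_semi_bigcup; last 3 first.
      * by move=> n; exact: mEM.
      * apply/trivIsetP => i j _ _ ij; apply/seteqP; split => om //= [[_ h1] [_ h2]].
        by move/trivIsetP : tF => /(_ i j Logic.I Logic.I ij)/seteqP[/(_ (X om, Y om)) h3 _]; exact: h3.
      * by apply: bigcupT_measurable => n; exact: mEM.
      transitivity (\int[P]_(om in E) (\sum_(n <oo) g (xsection (F n) (X om))))%E; last first.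
        apply: eq_integral => om _; rewrite xsection_bigcup measure_semi_bigcup.
        - by [].
        - by move=> i; apply: measurable_xsection; exact: mF.
        - exact: trivIset_xsection.
        - by apply: bigcupT_measurable => i; apply: measurable_xsection; exact: mF.
      rewrite integral_nneseries//; last by move=> n; apply: mgX; exact: mF.
      by apply: eq_eseriesr => n _; have [] := HF n.
  - move=> _ [A [C [mA mC ->]]]; split; first exact: measurableX.
    rewrite (_ : E `&` _ = E `&` X @^-1` A `&` Y @^-1` C); last first.
      by apply/seteqP; split => x /=; tauto.
    rewrite XY// (eq_integral (fun om => ((g C) * (\1_(X @^-1` A) om)%:E)%E)); last first.
      move=> om _; rewrite indicE; have [XA|XA] := pselect (A (X om)).
        by rewrite in_xsectionX ?mem_set// mule1.
      by rewrite notin_xsectionX ?memNset// measure0 mule0.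
    have mXA : measurable (X @^-1` A) by rewrite -[X in measurable X]setTI; exact: mX.
    rewrite ge0_integralZl//; last first.
      by apply/measurable_EFinP/measurable_funTS; exact: measurable_indic.
    by rewrite integral_indic// muleC setIC.
move=> M mM; have [] // : H M; apply: GH.
move: mM; rewrite measurable_prod_measurableType; apply: smallest_sub.
  exact: smallest_sigma_algebra.
move=> _ [A mA [C mC <-]]; apply: sub_sigma_algebra.
by exists A, C.
Qed.

Section brownian_past.
Context (d : measure_display) (T : measurableType d) (R : realType)
  (P : probability T R) (B : R -> {RV P >-> R}).
Context (HB : brownian_motion B).

Lemma measurable_incr_in (s t : R) (C : set R) : measurable C ->
  measurable (incr_in B s t C).
Proof.
move=> mC; rewrite -[X in measurable X]setTI.
have : measurable_fun [set: T] (fun om => B t om - B s om).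
  exact: measurable_funB.
exact.
Qed.

Let cylinder (n : nat) (t : nat -> R) : set_system T :=
  [set A | exists C : nat -> set R, (forall i, measurable (C i)) /\
    A = \bigcap_(i in `I_n) incr_in B (t i) (t i.+1) (C i)].

Lemma cylinder_setI_closed n t : setI_closed (cylinder n t).
Proof.
move=> _ _ [C [mC ->]] [C' [mC' ->]]; exists (fun i => C i `&` C' i); split.
  by move=> i; exact: measurableI.
apply/seteqP; split => om /=.
  by move=> [h h'] i ni; split; [exact: h|exact: h'].
by move=> h; split => i ni; have [] := h i ni.
Qed.

(** [bm_indep] factorizes all increments at once. Applied to the subdivision with and without the
    extra point u, it splits off the last increment. *)
Lemma cylinder_indep n t u (C0 : set R) A : subdivision n t -> t n < u ->
  measurable C0 -> <<s cylinder n t >> A ->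
  measurable A /\ (P (A `&` incr_in B (t n) u C0) = P A * P (incr_in B (t n) u C0))%E.
Proof.
move=> [t0 tn] tu mC0; move: A; apply: setI_closed_dynkin_sub.
- exact: cylinder_setI_closed.
- exact/indep_dynkin/measurable_incr_in.
- move=> _ [C [mC ->]].
  have mA : measurable (\bigcap_(i in `I_n) incr_in B (t i) (t i.+1) (C i)).
    by apply: bigcap_measurableType => i _; exact: measurable_incr_in.
  split => //.
  pose t' i := if (i <= n)%N then t i else u.
  pose C' i := if (i < n)%N then C i else C0.
  have sub' : subdivision n.+1 t'.
    split; first by rewrite /t'.
    move=> i; rewrite ltnS /t' => ni; rewrite ni; case: ltnP => [/tn//|ni'].
    by have /eqP -> : i == n; [rewrite eqn_leq ni|exact: ltW].
  have mC' i : measurable (C' i) by rewrite /C'; case: ifP.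
  have H1 i : (i < n)%N -> incr_in B (t' i) (t' i.+1) (C' i) = incr_in B (t i) (t i.+1) (C i).
    by move=> ni; rewrite /t' /C' ni (ltnW ni).
  have H2 : incr_in B (t' n) (t' n.+1) (C' n) = incr_in B (t n) u C0.
    by rewrite /t' /C' leqnn ltnn.
  have -> : \bigcap_(i in `I_n) incr_in B (t i) (t i.+1) (C i) `&` incr_in B (t n) u C0 =
     \bigcap_(i in `I_n.+1) incr_in B (t' i) (t' i.+1) (C' i).
    apply/seteqP; split => om /=.
      move=> [h h'] i /=; rewrite ltnS leq_eqVlt => /orP[/eqP ->|ni].
        by rewrite H2.
      by rewrite H1//; exact: h.
    move=> h; split => [i /= ni|].
      by rewrite -H1//; apply: h => /=; rewrite ltnS ltnW.
    by rewrite -H2; apply: h => /=.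
  rewrite (bm_indep HB)// (bm_indep HB)//.
  rewrite big_ord_recr/= H2; congr (_ * _)%E.
  by apply: eq_bigr => i _; rewrite H1.
Qed.

(** Positions are sums of increments from [B 0 = 0], so events on positions lie in the sigma-algebra
    generated by the increments. *)
Lemma cylinder_process_measurable n t j : subdivision n t -> t 0%N = 0 -> (j <= n)%N ->
  measurable_fun [set: g_sigma_algebraType (cylinder n t)] (B (t j)).
Proof.
move=> tsub t0; elim: j => [_|j IH jn].
  rewrite t0 (_ : (B 0 : T -> R) = cst 0); first exact: measurable_cst.
  by apply/funext => om; exact: bm_start HB om.
rewrite (_ : (B (t j.+1) : T -> R) = (fun om => B (t j) om + (B (t j.+1) om - B (t j) om))); last first.
  by apply/funext => om; rewrite addrCA subrr addr0.
apply: measurable_funD; first by apply: IH; exact: ltnW.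
move=> _ C mC; rewrite setTI; apply: sub_sigma_algebra.
exists (fun i => if i == j then C else setT); split.
  by move=> i; case: ifP.
apply/seteqP; split => om /=.
  by move=> h i /= _; rewrite /incr_in/=; case: eqP => // ->.
by move=> /(_ j jn); rewrite /incr_in/= eqxx.
Qed.

Let past_cylinder (s : R) : set_system T :=
  [set A | exists n (r : nat -> R) (C : nat -> set R),
    [/\ forall i, 0 <= r i <= s, forall i, measurable (C i) &
        A = \bigcap_(i in `I_n) (B (r i) @^-1` (C i))]].

Lemma past_cylinder_setI_closed s : setI_closed (past_cylinder s).
Proof.
move=> _ _ [n [r [C [rs mC ->]]]] [m [r' [C' [rs' mC' ->]]]].
exists (n + m)%N, (fun i => if (i < n)%N then r i else r' (i - n)%N),
  (fun i => if (i < n)%N then C i else C' (i - n)%N); split.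
- by move=> i; case: ifP.
- by move=> i; case: ifP.
- apply/seteqP; split => om /=.
    move=> [h h'] i /= inm; case: ltnP => ni; first exact: h.
    by apply: h' => /=; rewrite ltn_subLR.
  move=> h; split => i /= ni.
    by have := h i; rewrite /= ni; apply; rewrite ltn_addr.
  have nin : (n + i < n)%N = false by rewrite ltnNge leq_addr.
  have := h (n + i)%N; rewrite /= nin addKn; apply.
  by rewrite ltn_add2l.
Qed.

(** A finite cylinder of the past involves times in arbitrary order, possibly repeated. Sorted and
    framed by 0 and s, they form a subdivision to which [cylinder_indep] applies. *)
Lemma brownian_past_indep (s u : R) (C : set R) (E : set T) :
  0 <= s -> s < u -> measurable C -> path_sigma_algebra B `[0, s] E ->
  measurable E /\ (P (E `&` incr_in B s u C) = P E * normal_prob 0 (Num.sqrt (u - s)) C)%E.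
Proof.
move=> s0 su mC FE; rewrite -(bm_gaussian HB)//.
have FE' : <<s past_cylinder s >> E.
  move: FE; apply: smallest_sub; first exact: smallest_sigma_algebra.
  move=> _ [w /= ws [D mD ->]]; apply: sub_sigma_algebra.
  exists 1%N, (fun=> w), (fun=> D); split => //.
  apply/seteqP; split => om /=; first by move=> h i.
  by move=> /(_ 0%N); apply.
clear FE; move: E FE'; apply: setI_closed_dynkin_sub.
- exact: past_cylinder_setI_closed.
- exact/indep_dynkin/measurable_incr_in.
- move=> A [n [r [D [rs mD ->]]]].
  pose L := sort <=%R (mkseq r n).
  have sL : size L = n by rewrite size_sort size_mkseq.
  (* The default value s of [nth] supplies the last point t (n+1) = s of the subdivision. *)
  pose t i := nth s (0 :: L) i.
  have Ls x : x \in (0 :: L) -> 0 <= x <= s.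
    rewrite inE => /orP[/eqP ->|]; first by rewrite lexx.
    by rewrite mem_sort => /mapP[i _ ->].
  have tn : t n.+1 = s by rewrite /t nth_default//= sL.
  have tsub : subdivision n.+1 t.
    split; first exact: lexx.
    move=> i; rewrite ltnS leq_eqVlt => /orP[/eqP ->|ni].
      by rewrite tn; have /andP[] : 0 <= t n <= s by apply: Ls; apply: mem_nth; rewrite /= sL.
    have : sorted <=%R (0 :: L).
      rewrite /= path_min_sorted; first by apply: sort_sorted; exact: le_total.
      by apply/allP => x xL; have /andP[] : 0 <= x <= s by apply: Ls; rewrite inE xL orbT.
    by move/(sortedP s)/(_ i); apply; rewrite /= sL ltnS.
  have rt i : (i < n)%N -> exists2 j, (j <= n.+1)%N & r i = t j.
    move=> ni; have : r i \in L by rewrite mem_sort map_f// mem_iota.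
    move=> /(nthP s)[j jL jr]; exists j.+1; last by rewrite /t/= jr.
    by rewrite ltnS -sL ltnW.
  have tu : t n.+1 < u by rewrite tn.
  have := @cylinder_indep n.+1 t u C _ tsub tu mC; rewrite tn; apply.
  suff : @measurable _ (g_sigma_algebraType (cylinder n.+1 t)) (\bigcap_(i in `I_n) (B (r i) @^-1` (D i))) by [].
  apply: bigcap_measurableType => i ni; rewrite -[X in measurable X]setTI.
  have [j jn ->] := rt i ni.
  exact: cylinder_process_measurable.
Qed.

Lemma path_sigma_algebra_measurable (J : set R) (E : set T) :
  path_sigma_algebra B J E -> measurable E.
Proof.
apply: smallest_sub; first exact: sigma_algebra_measurable.
move=> _ [w Jw [C mC ->]]; rewrite -[X in measurable X]setTI.
exact: (measurable_funP (B w)).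
Qed.

Lemma path_sigma_algebra_proc (J : set R) (w : R) (C : set R) :
  J w -> measurable C -> path_sigma_algebra B J (B w @^-1` C).
Proof. by move=> Jw mC; apply: sub_sigma_algebra; exists w => //; exists C. Qed.

Lemma path_sigma_algebra_sub (J J' : set R) : J `<=` J' ->
  path_sigma_algebra B J `<=` path_sigma_algebra B J'.
Proof.
move=> JJ; apply: smallest_sub; first exact: smallest_sigma_algebra.
move=> _ [w Jw [C mC ->]]; apply: path_sigma_algebra_proc => //; exact: JJ.
Qed.

(** This is [indep_pair_law] for X = B s and Y the increment; its condition on rectangles holds
    since [E] cut by an event of B s still belongs to the past. *)
Lemma brownian_markov (s u : R) (E : set T) (A : set R) :
  0 <= s -> s < u -> path_sigma_algebra B `[0, s] E -> measurable A ->
  P (E `&` B u @^-1` A) =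
   (\int[P]_(om in E) normal_prob 0 (Num.sqrt (u - s)) [set y | A (B s om + y)%R])%E.
Proof.
move=> s0 su FE mA; have mE := path_sigma_algebra_measurable FE.
pose M : set (R * R) := [set p | A (p.1 + p.2)].
have mM : measurable M.
  rewrite -[X in measurable X]setTI.
  have : measurable_fun [set: R * R] (fun p => p.1 + p.2) by exact: measurable_funD.
  exact.
have mY : measurable_fun [set: T] (fun om => B u om - B s om) by exact: measurable_funB.
have := @indep_pair_law _ _ _ P (normal_prob 0 (Num.sqrt (u - s))) E (B s)
  (fun om => B u om - B s om) mE (measurable_funP (B s)) mY.
move=> /(_ _ M mM) H; transitivity (P (E `&` [set om | M (B s om, B u om - B s om)])).
  by congr (P _); apply/seteqP; split => om /=; rewrite /M/= addrCA subrr addr0.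
rewrite H; first by apply: eq_integral => om _; rewrite xsectionE.
move=> A' C mA' mC.
have FEA : path_sigma_algebra B `[0, s] (E `&` B s @^-1` A').
  apply: (@measurableI _ (g_sigma_algebraType _)) => //.
  by apply: path_sigma_algebra_proc => //=; rewrite in_itv/= s0 lexx.
by have [] := brownian_past_indep s0 su mC FEA.
Qed.

Lemma measurable_markov_kernel (s u : R) (E : set T) (A : set R) : measurable A ->
  measurable_fun E (fun om => normal_prob 0 (Num.sqrt (u - s)) [set y | A (B s om + y)%R]).
Proof.
move=> mA; apply: measurable_funTS.
pose M : set (R * R) := [set p | A (p.1 + p.2)].
have mM : measurable M.
  rewrite -[X in measurable X]setTI.
  have : measurable_fun [set: R * R] (fun p => p.1 + p.2) by exact: measurable_funD.
  exact.
have := measurableT_comp (measurable_fun_xsection (normal_prob 0 (Num.sqrt (u - s))) mM)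
  (measurable_funP (B s)).
move=> H; rewrite [X in measurable_fun _ X](_ : _ =
  (normal_prob 0 (Num.sqrt (u - s)) \o xsection M) \o B s)//.
by apply/funext => om /=; congr normal_prob; rewrite xsectionE.
Qed.

End brownian_past.

Lemma lebesgue_measure_shift (R : realType) (A : set R) (x : R) : measurable A ->
  measurable [set y | A (x + y)] /\
  (lebesgue_measure [set y | A (x + y)%R] = lebesgue_measure A)%E.
Proof.
move=> mA.
have mx : measurable_fun [set: R] (fun y : R => x + y) by exact: measurable_funD.
have ms : measurable [set y | A (x + y)].
  by rewrite -[X in measurable X]setTI; exact: mx.
split => //; suff -> : lebesgue_measure A = pushforward lebesgue_measure
    ((fun y => x + y) : measurableTypeR R -> measurableTypeR R) A by [].
apply: lebesgue_measure_unique => //= _ [[a b]] _ <-.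
rewrite /pushforward (_ : _ @^-1` _ = `]a - x, b - x]%classic); last first.
  by apply/seteqP; split => y /=; rewrite !in_itv/= => /andP[h1 h2]; lra.
rewrite !lebesgue_measure_itv/= !lte_fin ltrD2r; case: ifP => // _.
by rewrite -!EFinB; congr (_%:E); lra.
Qed.

Lemma brownian_markov_ub d (T : measurableType d) (R : realType) (P : probability T R)
    (B : R -> {RV P >-> R}) (HB : brownian_motion B)
    (s u : R) (E : set T) (A : set R) :
  0 <= s -> s < u -> path_sigma_algebra B `[0, s] E -> measurable A ->
  (P (E `&` B u @^-1` A) <=
    P E * ((gauss_peak R / Num.sqrt (u - s))%:E * lebesgue_measure A))%E.
Proof.
move=> s0 su FE mA; have mE := path_sigma_algebra_measurable FE.
rewrite (brownian_markov HB s0 su FE mA).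
have su0 : 0 < u - s by rewrite subr_gt0.
have c0 : (0 <= (gauss_peak R / Num.sqrt (u - s))%:E * lebesgue_measure A)%E.
  by rewrite mule_ge0// lee_fin divr_ge0 ?sqrtr_ge0// ltW// gauss_peak_gt0.
rewrite muleC -integral_cst//.
apply: ge0_le_integral => //.
- exact: (@measurable_markov_kernel _ _ _ _ B s u E A mA).
- move=> om Eom; have [mS <-] := lebesgue_measure_shift (B s om) mA.
  exact: normal_prob_ub.
Qed.

(** An increment that leads from |B s| <= r into A has size at most r + M, hence lies within one
    standard deviation, where [normal_prob_lb] applies. *)
Lemma brownian_markov_lb d (T : measurableType d) (R : realType) (P : probability T R)
    (B : R -> {RV P >-> R}) (HB : brownian_motion B)
    (s u r M : R) (E : set T) (A : set R) :
  0 <= s -> s < u -> path_sigma_algebra B `[0, s] E -> measurable A ->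
  0 <= r -> 0 <= M ->
  (forall om, E om -> `|B s om| <= r) -> (forall x, A x -> `|x| <= M) ->
  (r + M) ^+ 2 <= u - s ->
  (P E * ((gauss_peak R / (2 * Num.sqrt (u - s)))%:E * lebesgue_measure A) <=
   P (E `&` B u @^-1` A))%E.
Proof.
move=> s0 su FE mA r0 M0 Er AM rMu; have mE := path_sigma_algebra_measurable FE.
rewrite (brownian_markov HB s0 su FE mA).
have su0 : 0 < u - s by rewrite subr_gt0.
have c0 : (0 <= (gauss_peak R / (2 * Num.sqrt (u - s)))%:E * lebesgue_measure A)%E.
  by rewrite mule_ge0// lee_fin divr_ge0//; exact/ltW/gauss_peak_gt0.
rewrite muleC -integral_cst//.
apply: ge0_le_integral => //.
- exact: (@measurable_markov_kernel _ _ _ _ B s u E A mA).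
- move=> om Eom; have [mS <-] := lebesgue_measure_shift (B s om) mA.
  apply: normal_prob_lb => // y /= Ay; apply: le_trans rMu.
  rewrite -(real_normK (num_real y)); apply: lerXn2r; rewrite ?nnegrE ?addr_ge0//.
  have -> : y = (B s om + y) - B s om by lra.
  rewrite (le_trans (ler_normB _ _))// addrC lerD//; [exact: Er|exact: AM].
Qed.

(** * Occupation times of Brownian motion *)

(** Paths are continuous on the half-line only; a nonnegative change of time makes them continuous
    on the whole line, as [continuous_process_measurable] requires. *)
Lemma continuous_comp_within (R : realType) (f g : R -> R) :
  {within `[0, +oo[, continuous f} -> continuous g -> (forall x, 0 <= g x) ->
  continuous (f \o g).
Proof.
move=> /continuous_within_itvcyP[cf f0] cg g0 x.
have := g0 x; rewrite le_eqVlt => /orP[/eqP gx0|gx0]; last first.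
  have cfx : {for g x, continuous f} by apply: cf; rewrite in_itv/= gx0.
  by apply: (continuous_comp (f := g) (g := f)); [exact: cg|exact: cfx].
apply/cvgrPdist_lt => e e0 /=; rewrite -gx0.
move/cvgrPdist_lt : f0 => /(_ e e0); rewrite near_withinE => f0.
have h : \forall y \near nbhs (g x), 0 <= y -> `|f 0 - f y| < e.
  rewrite -gx0; apply: filterS f0 => y H.
  by rewrite le_eqVlt => /orP[/eqP <-|//]; rewrite subrr normr0.
have h2 : \forall y \near x, 0 <= g y -> `|f 0 - f (g y)| < e := cg x _ h.
by apply: filterS h2 => y; apply; exact: g0.
Qed.

Section occupation.
Context (d : measure_display) (T : measurableType d) (R : realType).

(** The weight [g] will be 1 for the first moment of an occupation time and the occupation time
    itself for the second one. *)
Lemma fubini_section (P : probability T R) (S : set (R * T)) (E : set T) (g : T -> \bar R) :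
  measurable S -> measurable E -> measurable_fun [set: T] g -> (forall om, 0 <= g om)%E ->
  (\int[P]_(om in E) (g om * lebesgue_measure (ysection S om)) =
   \int[lebesgue_measure]_w \int[P]_(om in E `&` xsection S w) g om)%E.
Proof.
move=> mS mE mg g0.
pose f (p : R * T) : \bar R := ((g \_ E) p.2 * (\1_S p)%:E)%E.
have gE0 om : (0 <= (g \_ E) om)%E by apply: erestrict_ge0 => ? _.
have mgE : measurable_fun [set: T] (g \_ E).
  by apply/(measurable_restrictT _ mE); exact: measurable_funTS.
have mf : measurable_fun [set: R * T] f.
  apply: emeasurable_funM; first exact: (measurableT_comp mgE).
  by apply/measurable_EFinP; exact: measurable_indic.
have f0 p : (0 <= f p)%E by rewrite mule_ge0// lee_fin.
have := @fubini_tonelli _ _ _ _ R lebesgue_measure P f mf f0.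
rewrite /fubini_F /fubini_G => H.
transitivity (\int[P]_om \int[lebesgue_measure]_w f (w, om))%E.
  rewrite integral_mkcond; apply: eq_integral => om _.
  have mSo : measurable (ysection S om) by exact: measurable_ysection.
  transitivity (\int[lebesgue_measure]_w ((g \_ E) om * (\1_(ysection S om) w)%:E))%E; last first.
    by apply: eq_integral => w _; rewrite /f/= !indicE mem_ysection.
  rewrite ge0_integralZl//=; last first.
    by apply/measurable_EFinP; exact: measurable_indic.
  rewrite integral_indic//.
  by rewrite setIT /patch; case: ifP => //; rewrite mul0e.
rewrite -H; apply: eq_integral => w _.
rewrite [RHS]integral_mkcond; apply: eq_integral => om _.
rewrite /f/= /patch in_setI mem_xsection indicE.
by case: (om \in E); case: ((w, om) \in S); rewrite /= ?mule1 ?mule0 ?mul0e.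
Qed.

End occupation.

(** A subset of the product of time and sample space, so that its sections give measurable
    occupation times and Tonelli exchanges the two integrals. *)
Definition occ_graph (R : realType) (T : Type) (B : R -> T -> R) (a b : R) (A : set R) :
  set (R * T) := [set p | a <= p.1 <= b /\ A (B p.1 p.2)].

(* The clamped process has continuous paths on the whole line and never looks
   outside of [0, b], so that it is measurable for the past at time [b]. *)
Lemma measurable_occ_graph (R : realType) d (T : measurableType d) (B : R -> T -> R)
    (a b : R) (A : set R) : 0 <= a -> measurable A ->
  (forall w, 0 <= w <= b -> measurable_fun [set: T] (B w)) ->
  (forall om, {within `[0, +oo[, continuous (B ^~ om)}) ->
  measurable (occ_graph B a b A).
Proof.
move=> a0 mA mB cB.
have [ab|ba] := leP a b; last first.
  rewrite (_ : occ_graph _ _ _ _ = set0)//.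
  by apply/seteqP; split => // -[w om] [/= /andP[h1 h2] _]; lra.
pose cl (w : R) : R := Num.max 0 (Num.min b w).
have cl0 w : 0 <= cl w <= b.
  by rewrite /cl le_max lexx/= ge_max ge_min lexx/= andbT (le_trans a0).
have ccl : continuous cl.
  by move=> w; apply: continuous_max; [exact: cvg_cst|apply: continuous_min; [exact: cvg_cst|exact: cvg_id]].
have mZ : measurable_fun [set: R * T] (fun p => B (cl p.1) p.2).
  apply: (@continuous_process_measurable _ _ _ (fun w om => B (cl w) om)).
    by move=> w; exact: mB.
  move=> om; apply: (continuous_comp_within (cB om) ccl) => w.
  by have /andP[] := cl0 w.
have -> : occ_graph B a b A = (`[a, b] `*` setT) `&` (fun p => B (cl p.1) p.2) @^-1` A.
  apply/seteqP; split => -[w om]; rewrite /occ_graph/= in_itv/=.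
    move=> [/andP[h1 h2] h]; rewrite h1 h2; split => //.
    by rewrite /cl min_r// max_r//; lra.
  move=> [[/andP[h1 h2] _]]; rewrite h1 h2 /cl min_r// max_r//; lra.
apply: measurableI; first by apply: measurableX => //; exact: measurable_itv.
by rewrite -[X in measurable X]setTI; exact: mZ.
Qed.

Definition occ_time (R : realType) (T : Type) (B : R -> T -> R) (a b : R) (A : set R)
  (om : T) : \bar R := lebesgue_measure (ysection (occ_graph B a b A) om).

Lemma occ_timeE (R : realType) (T : Type) (B : R -> T -> R) (a b : R) (A : set R) om :
  occ_time B a b A om = lebesgue_measure (`[a, b] `&` [set w | A (B w om)]).
Proof.
congr lebesgue_measure; apply/seteqP.
by rewrite ysectionE; split => w; rewrite /occ_graph/= in_itv.
Qed.

Section brownian_occupation.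
Context (d : measure_display) (T : measurableType d) (R : realType)
  (P : probability T R) (B : R -> {RV P >-> R}).
Context (HB : brownian_motion B).
Notation occ a b A := (occ_time (fun w om => B w om) a b A).

Lemma measurable_occ_graph_bm (a b : R) (A : set R) : 0 <= a -> measurable A ->
  measurable (occ_graph (fun w om => B w om) a b A).
Proof.
move=> a0 mA; apply: measurable_occ_graph => //.
- exact: bm_continuous HB.
Qed.

Lemma measurable_occ (a b : R) (A : set R) : 0 <= a -> measurable A ->
  measurable_fun [set: T] (occ a b A).
Proof.
by move=> a0 mA; exact: (measurable_fun_ysection lebesgue_measure (measurable_occ_graph_bm _ a0 mA)).
Qed.

Lemma occ_le (a b : R) (A : set R) om : 0 <= a -> a <= b -> measurable A ->
  (occ a b A om <= (b - a)%:E)%E.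
Proof.
move=> a0 ab mA.
have -> : ((b - a)%:E = lebesgue_measure `[a, b])%E.
  by rewrite lebesgue_measure_itv/= lte_fin; case: ltgtP ab => // -> _; rewrite subrr.
apply: le_measure; rewrite ?inE.
- by apply: measurable_ysection; exact: measurable_occ_graph_bm.
- exact: measurable_itv.
- by rewrite ysectionE => w; rewrite /occ_graph/= in_itv/= => -[].
Qed.

Lemma occ_ge0 (a b : R) (A : set R) om : (0 <= occ a b A om)%E.
Proof. exact: measure_ge0. Qed.

Lemma occ_mono (a b a' b' : R) (A : set R) om : 0 <= a' -> a' <= a -> b <= b' ->
  measurable A -> (occ a b A om <= occ a' b' A om)%E.
Proof.
move=> a0 aa bb mA; apply: le_measure; rewrite ?inE.
- by apply: measurable_ysection; apply: measurable_occ_graph_bm => //; exact: le_trans aa.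
- by apply: measurable_ysection; exact: measurable_occ_graph_bm.
- rewrite !ysectionE => w; rewrite /occ_graph/= => -[/andP[h1 h2] ?].
  by split => //; apply/andP; split; lra.
Qed.

Lemma integral_occ (a b : R) (A : set R) (E : set T) (g : T -> \bar R) :
  0 <= a -> measurable A -> measurable E ->
  measurable_fun [set: T] g -> (forall om, 0 <= g om)%E ->
  (\int[P]_(om in E) (g om * occ a b A om) =
   \int[lebesgue_measure]_(w in `[a, b]) \int[P]_(om in E `&` B w @^-1` A) g om)%E.
Proof.
move=> a0 mA mE mg g0; rewrite fubini_section//; last exact: measurable_occ_graph_bm.
rewrite [RHS]integral_mkcond; apply: eq_integral => w _.
rewrite xsectionE /patch; case: ifPn => [|/negP]; rewrite in_setE/= in_itv/= => wab.
  congr integral; congr setI; apply/seteqP; split => om; rewrite /occ_graph/= wab.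
    by case.
  by [].
rewrite (_ : _ `&` _ = set0) ?integral_set0//.
by apply/seteqP; split => // om [_]; rewrite /occ_graph/= => -[h _].
Qed.

Lemma expected_occ (a b : R) (A : set R) (E : set T) :
  0 <= a -> measurable A -> measurable E ->
  (\int[P]_(om in E) occ a b A om =
   \int[lebesgue_measure]_(w in `[a, b]) P (E `&` B w @^-1` A))%E.
Proof.
move=> a0 mA mE.
have := @integral_occ a b A E (cst 1%E) a0 mA mE (measurable_cst _) (fun=> lee01).
under eq_integral do rewrite mul1e.
move=> ->; apply: eq_integral => w _; rewrite integral_cst ?mul1e//.
apply: measurableI => //; rewrite -[X in measurable X]setTI; exact: measurable_funP.
Qed.

Lemma measurable_pre_occ (a b : R) (A : set R) (E : set T) : 0 <= a ->
  measurable A -> measurable E ->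
  measurable_fun `[a, b] (fun w => P (E `&` B w @^-1` A)).
Proof.
move=> a0 mA mE.
have mS := measurable_occ_graph_bm b a0 mA.
have mES : measurable (occ_graph (fun w om => B w om) a b A `&` (setT `*` E)).
  by apply: measurableI => //; apply: measurableX.
have H := measurable_funTS (measurable_fun_xsection P mES) (D := `[a, b]).
apply: eq_measurable_fun (H) => w; rewrite in_setE/= in_itv/= => wab.
congr (P _); rewrite xsectionE; by apply/seteqP; split => om; rewrite /occ_graph/=; tauto.
Qed.

Lemma measurable_integral_pre (a b : R) (A : set R) (E : set T) (g : T -> \bar R) :
  0 <= a -> measurable A -> measurable E ->
  measurable_fun [set: T] g -> (forall om, 0 <= g om)%E ->
  measurable_fun `[a, b] (fun w => \int[P]_(om in E `&` B w @^-1` A) g om)%E.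
Proof.
move=> a0 mA mE mg g0.
have mS := measurable_occ_graph_bm b a0 mA.
have mgE : measurable_fun [set: T] (g \_ E).
  by apply/(measurable_restrictT _ mE); exact: measurable_funTS.
pose f (p : R * T) : \bar R := ((g \_ E) p.2 * (\1_(occ_graph (fun w om => B w om) a b A) p)%:E)%E.
have mf : measurable_fun [set: R * T] f.
  apply: emeasurable_funM; first exact: (measurableT_comp mgE).
  by apply/measurable_EFinP; exact: measurable_indic.
have f0 p : (0 <= f p)%E.
  by rewrite mule_ge0// ?lee_fin//; apply: erestrict_ge0 => ? _.
have H := measurable_funTS (@measurable_fun_fubini_tonelli_F _ _ _ _ R P f mf f0) (D := `[a, b]).
apply: eq_measurable_fun (H) => w; rewrite in_setE/= in_itv/= => wab.
rewrite /fubini_F integral_mkcond [RHS]integral_mkcond; apply: eq_integral => om _.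
rewrite /f/= /patch in_setI indicE.
have -> : ((w, om) \in occ_graph (fun w om => B w om) a b A) = (om \in B w @^-1` A).
  by apply/idP/idP => /set_mem h; apply/mem_set; move: h; rewrite /occ_graph/= wab; [case|move=> ?; split].
by rewrite in_setT; case: (om \in E); case: (om \in B w @^-1` A); rewrite /= ?mule1 ?mule0 ?mul0e.
Qed.

End brownian_occupation.

(** At every time of the window the elapsed time since s is between tau and 2 tau. The delay puts A
    within one standard deviation, and the density is at least of order 1 / sqrt tau throughout. *)
Lemma occ_first_moment d (T : measurableType d) (R : realType)
  (P : probability T R) (B : R -> {RV P >-> R}) (HB : brownian_motion B)
  (s tau r M a0 : R) (A : set R) (E : set T) :
  0 <= s -> 0 < tau -> path_sigma_algebra B `[0, s] E ->
  measurable A -> 0 <= r -> 0 <= M ->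
  (forall om, E om -> `|B s om| <= r) -> (forall x, A x -> `|x| <= M) ->
  (r + M) ^+ 2 <= tau -> 0 < a0 -> lebesgue_measure A = a0%:E ->
  ((gauss_peak R / 4 * (a0 * Num.sqrt tau) * fine (P E))%:E <=
   \int[P]_(om in E) occ_time (fun w om => B w om) (s + tau) (s + 2 * tau) A om)%E.
Proof.
move=> s0 tau0 FE mA r0 M0 Er AM rMtau a00 Aa0.
set k := gauss_peak R; set pE := fine (P E).
have mE : measurable E := path_sigma_algebra_measurable FE.
have PE : P E = pE%:E by rewrite fineK// fin_num_measure.
have pE0 : 0 <= pE by rewrite fine_ge0.
have k0 : 0 < k by exact: gauss_peak_gt0.
have st0 : 0 < Num.sqrt tau by rewrite sqrtr_gt0.
have stau0 : 0 <= s + tau by rewrite addr_ge0// ltW.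
have sqr_st : Num.sqrt tau * Num.sqrt tau = tau by rewrite -expr2 sqr_sqrtr// ltW.
have mpre w : measurable (B w @^-1` A).
  by rewrite -[X in measurable X]setTI; exact: measurable_funP.
have len : lebesgue_measure `[s + tau, s + 2 * tau] = tau%:E.
  by rewrite lebesgue_measure_itv/= lte_fin ifT -?EFinB; [congr EFin; lra|lra].
rewrite (expected_occ HB)//.
apply: (@le_trans _ _ (\int[lebesgue_measure]_(w in `[(s + tau)%R, (s + 2 * tau)%R])
   (k / (4 * Num.sqrt tau) * a0 * pE)%:E)%E).
  rewrite integral_cst//= len -EFinM lee_fin.
  rewrite [leRHS](_ : _ = k / 4 * (a0 * Num.sqrt tau) * pE * (tau / (Num.sqrt tau * Num.sqrt tau))).
    by rewrite sqr_st divff ?mulr1// gt_eqF.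
  by field; rewrite gt_eqF.
apply: ge0_le_integral => //=.
- by move=> w _; rewrite lee_fin !mulr_ge0// ?invr_ge0 ?mulr_ge0// ltW.
- exact: (measurable_pre_occ HB).
- move=> w; rewrite in_itv/= => /andP[w1 w2].
  apply: (@le_trans _ _ (P E * ((k / (2 * Num.sqrt (w - s)))%:E * lebesgue_measure A))%E).
    rewrite PE Aa0 -!EFinM lee_fin [leRHS]mulrC ler_wpM2r// ler_wpM2r//; first exact: ltW.
    rewrite ler_pM2l// lef_pV2 ?posrE ?mulr_gt0 ?sqrtr_gt0//; last lra.
    rewrite (_ : 4 * _ = 2 * Num.sqrt (4 * tau)); last first.
      rewrite sqrtrM// (_ : 4 = 2 ^+ 2 :> R); last by rewrite expr2; lra.
      by rewrite sqrtr_sqr ger0_norm//; lra.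
    by rewrite ler_pM2l// ler_wsqrtr//; lra.
  apply: (brownian_markov_lb HB (r := r) (M := M)) => //; first lra.
  by apply: le_trans rMtau _; lra.
Qed.

(** The square is a double integral over times x, y of the probability of being in A at both. Using
    the Markov property at s and at the earlier time bounds it by (k a0)^2 / sqrt (tau |y - x|): the
    delay tau removes the singularity at s, and the one on the diagonal is integrable. *)
Lemma occ_second_moment d (T : measurableType d) (R : realType)
  (P : probability T R) (B : R -> {RV P >-> R}) (HB : brownian_motion B)
  (s tau r M a0 : R) (A : set R) (E : set T) :
  0 <= s -> 0 < tau -> path_sigma_algebra B `[0, s] E ->
  measurable A -> 0 <= r -> 0 <= M ->
  (forall om, E om -> `|B s om| <= r) -> (forall x, A x -> `|x| <= M) ->
  (r + M) ^+ 2 <= tau -> 0 < a0 -> lebesgue_measure A = a0%:E ->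
  (\int[P]_(om in E) (occ_time (fun w om => B w om) (s + tau) (s + 2 * tau) A om *
       occ_time (fun w om => B w om) (s + tau) (s + 2 * tau) A om)
    <= (4 * (gauss_peak R * (a0 * Num.sqrt tau)) ^+ 2 * fine (P E))%:E)%E.
Proof.
move=> s0 tau0 FE mA r0 M0 Er AM rMtau a00 Aa0.
set k := gauss_peak R; set pE := fine (P E).
have mE : measurable E := path_sigma_algebra_measurable FE.
have PE : P E = pE%:E by rewrite fineK// fin_num_measure.
have pE0 : 0 <= pE by rewrite fine_ge0.
have k0 : 0 < k by exact: gauss_peak_gt0.
have st0 : 0 < Num.sqrt tau by rewrite sqrtr_gt0.
have stau0 : 0 <= s + tau by rewrite addr_ge0// ltW.
have sqr_st : Num.sqrt tau * Num.sqrt tau = tau by rewrite -expr2 sqr_sqrtr// ltW.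
have mpre w : measurable (B w @^-1` A).
  by rewrite -[X in measurable X]setTI; exact: measurable_funP.
have len : lebesgue_measure `[s + tau, s + 2 * tau] = tau%:E.
  by rewrite lebesgue_measure_itv/= lte_fin ifT -?EFinB; [congr EFin; lra|lra].
have pair_hit x y : s + tau <= x -> x < y ->
    (P (E `&` B x @^-1` A `&` B y @^-1` A) <=
      (k ^+ 2 * a0 ^+ 2 * pE / Num.sqrt tau)%:E * ((Num.sqrt (y - x))^-1)%:E)%E.
  move=> sx xy.
  have FEx : path_sigma_algebra B `[0, x] (E `&` B x @^-1` A).
    apply: (@measurableI _ (g_sigma_algebraType _)).
      apply: path_sigma_algebra_sub FE => z /=; rewrite !in_itv/= => /andP[z0 z1].
      by rewrite z0/=; lra.
    by apply: path_sigma_algebra_proc => //=; rewrite in_itv/= lexx andbT; lra.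
  apply: (le_trans (brownian_markov_ub HB _ xy FEx mA)); first lra.
  rewrite Aa0 -EFinM.
  apply: (@le_trans _ _ ((pE * (k / Num.sqrt tau * a0))%:E * (k / Num.sqrt (y - x) * a0)%:E)%E).
    apply: lee_wpmul2r; first by rewrite lee_fin !mulr_ge0 ?invr_ge0 ?sqrtr_ge0// ltW.
    have sx' : s < x by lra.
    apply: (le_trans (brownian_markov_ub HB s0 sx' FE mA)).
    rewrite PE Aa0 -!EFinM lee_fin ler_wpM2l// ler_wpM2r//; first exact: ltW.
    rewrite ler_pM2l// lef_pV2 ?posrE ?sqrtr_gt0//; last lra.
    by rewrite ler_wsqrtr//; lra.
  by rewrite -!EFinM lee_fin le_eqVlt; apply/orP; left; apply/eqP; ring.
have mo := measurable_occ HB (s + 2 * tau) stau0 mA.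
rewrite (integral_occ HB _ stau0 mA mE mo); last by move=> om; exact: occ_ge0.
apply: (@le_trans _ _ (\int[lebesgue_measure]_(w in `[(s + tau)%R, (s + 2 * tau)%R])
   (4 * (k * a0) ^+ 2 * pE)%:E)%E); last first.
  rewrite integral_cst//= len -EFinM lee_fin.
  rewrite [leRHS](_ : _ = 4 * (k * a0) ^+ 2 * pE * (Num.sqrt tau * Num.sqrt tau)).
    by rewrite sqr_st.
  by ring.
apply: ge0_le_integral => //=.
- by move=> w _; apply: integral_ge0 => om _; exact: occ_ge0.
- have og0 om : (0 <= occ_time (fun w om => B w om) (s + tau) (s + 2 * tau) A om)%E by exact: occ_ge0.
  exact: (measurable_integral_pre HB stau0 mA mE mo og0).
- move=> w; rewrite in_itv/= => /andP[w1 w2].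
  have mEw : measurable (E `&` B w @^-1` A) by exact: measurableI.
  rewrite (expected_occ HB)//.
  set D := `[s + tau, s + 2 * tau]%classic.
  have mD : measurable D by exact: measurable_itv.
  have mD' : measurable (D `\ w) by exact: measurableD.
  have mpo := measurable_pre_occ HB (b := s + 2 * tau) stau0 mA mEw.
  have mpo' : measurable_fun (D `\ w) (fun v => P (E `&` B w @^-1` A `&` B v @^-1` A)).
    by apply: measurable_funS mpo => // x [].
  (* [pair_hit] needs two distinct times, so the null set {w} is removed from the inner integral. *)
  rewrite -(@integral_setD1 _ _ w)//.
  have c0 : 0 <= k ^+ 2 * a0 ^+ 2 * pE / Num.sqrt tau.
    by rewrite divr_ge0 ?mulr_ge0 ?exprn_ge0// ltW.
  have mg : measurable_fun [set: R] (fun v => ((Num.sqrt `|v - w|)^-1)%:E).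
    exact: measurable_inv_sqrt_dist.
  have mcg : measurable_fun [set: R] (fun v =>
      (k ^+ 2 * a0 ^+ 2 * pE / Num.sqrt tau)%:E * ((Num.sqrt `|v - w|)^-1)%:E)%E.
    exact: measurable_funeM.
  have g0 v : (0 <= ((Num.sqrt `|v - w|)^-1)%:E)%E.
    by rewrite lee_fin invr_ge0 sqrtr_ge0.
  apply: (@le_trans _ _ (\int[lebesgue_measure]_(v in D)
     ((k ^+ 2 * a0 ^+ 2 * pE / Num.sqrt tau)%:E * ((Num.sqrt `|v - w|)^-1)%:E))%E).
    apply: (@le_trans _ _ (\int[lebesgue_measure]_(v in D `\ w)
     ((k ^+ 2 * a0 ^+ 2 * pE / Num.sqrt tau)%:E * ((Num.sqrt `|v - w|)^-1)%:E))%E); last first.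
      apply: ge0_subset_integral => //.
      - exact: measurable_funTS.
      - by move=> v _; rewrite mule_ge0.
    apply: ge0_le_integral => //=.
    + exact: measurable_funTS.
    + move=> v []; rewrite /D/= in_itv/= => /andP[v1 v2] /eqP vw.
      have [wv|vw'] := ltP w v.
        by rewrite gtr0_norm ?subr_gt0//; exact: pair_hit.
      rewrite setIAC distrC gtr0_norm ?subr_gt0//; first by apply: pair_hit => //; rewrite lt_neqAle vw vw'.
      by rewrite lt_neqAle vw vw'.
  rewrite ge0_integralZl//; last exact: measurable_funTS.
  apply: (@le_trans _ _ ((k ^+ 2 * a0 ^+ 2 * pE / Num.sqrt tau)%:E * (4 * Num.sqrt tau)%:E)%E).
    apply: lee_wpmul2l; first by rewrite lee_fin.
    have w12 : s + tau <= w <= s + 2 * tau by rewrite w1 w2.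
    apply: (le_trans (integral_inv_sqrt_dist w12)).
    by rewrite lee_fin ler_pM2l// ler_wsqrtr//; lra.
  rewrite -EFinM lee_fin le_eqVlt; apply/orP; left; apply/eqP; field.
  by rewrite gt_eqF.
Qed.

(* Integrate X <= th + X^2 / (2 c) + (c / 2) 1_{th <= X} over E, where th is a
   quarter of the lower bound for E[X | E] and c is chosen such that the second
   term contributes another quarter. *)
Lemma occ_lower_prob d (T : measurableType d) (R : realType)
  (P : probability T R) (B : R -> {RV P >-> R}) (HB : brownian_motion B)
  (s tau r M a0 : R) (A : set R) (E : set T) :
  0 <= s -> 0 < tau -> path_sigma_algebra B `[0, s] E ->
  measurable A -> 0 <= r -> 0 <= M ->
  (forall om, E om -> `|B s om| <= r) -> (forall x, A x -> `|x| <= M) ->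
  (r + M) ^+ 2 <= tau -> 0 < a0 -> lebesgue_measure A = a0%:E ->
  ((fine (P E) / 128)%:E <=
   P (E `&` [set om | ((gauss_peak R / 16 * (a0 * Num.sqrt tau))%:E <=
        occ_time (fun w om => B w om) (s + tau) (s + 2 * tau) A om)%E]))%E.
Proof.
move=> s0 tau0 FE mA r0 M0 Er AM rMtau a00 Aa0.
set k := gauss_peak R; set pE := fine (P E).
have mE : measurable E := path_sigma_algebra_measurable FE.
have PE : P E = pE%:E by rewrite fineK// fin_num_measure.
have pE0 : 0 <= pE by rewrite fine_ge0.
have k0 : 0 < k by exact: gauss_peak_gt0.
have st0 : 0 < Num.sqrt tau by rewrite sqrtr_gt0.
have stau0 : 0 <= s + tau by rewrite addr_ge0// ltW.
pose X := occ_time (fun w om => B w om) (s + tau) (s + 2 * tau) A.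
pose S := a0 * Num.sqrt tau.
have S0 : 0 < S by rewrite mulr_gt0.
pose th := k / 16 * S; pose c := 32 * k * S.
have c0 : 0 < c by rewrite !mulr_gt0.
have th0 : 0 < th by rewrite !mulr_gt0.
have mX : measurable_fun [set: T] X by exact: (measurable_occ HB).
have X0 om : (0 <= X om)%E by exact: occ_ge0.
have Xfin om : X om \is a fin_num.
  rewrite ge0_fin_numE//; apply: le_lt_trans (ltry tau).
  have ab : s + tau <= s + 2 * tau by lra.
  apply: (le_trans (occ_le HB om stau0 ab mA)).
  by rewrite lee_fin; lra.
pose F := [set om | (th%:E <= X om)%E].
have mF : measurable F.
  by rewrite -[X in measurable X]setTI; exact: emeasurable_fun_c_infty.
have mEF : measurable (E `&` F) by exact: measurableI.
have PEF : P (E `&` F) = (fine (P (E `&` F)))%:E by rewrite fineK// fin_num_measure.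
have mXX : measurable_fun E (fun om => (2 * c)^-1%:E * (X om * X om))%E.
  by apply: measurable_funeM; apply: measurable_funTS; exact: emeasurable_funM.
have mI : measurable_fun E (fun om => (c / 2)%:E * (\1_F om)%:E)%E.
  by apply: measurable_funeM; apply/measurable_EFinP; apply: measurable_funTS; exact: measurable_indic.
have c20 : 0 <= c / 2 by rewrite divr_ge0// ltW.
have c2V0 : 0 <= (2 * c)^-1 by rewrite invr_ge0 mulr_ge0// ltW.
have H : (\int[P]_(om in E) X om <= \int[P]_(om in E)
    (th%:E + (2 * c)^-1%:E * (X om * X om) + (c / 2)%:E * (\1_F om)%:E))%E.
  apply: ge0_le_integral => //.
  - exact: measurable_funTS.
  - by apply: emeasurable_funD => //; apply: emeasurable_funD.
  - move=> om _; rewrite -(fineK (Xfin om)) -!EFinM -!EFinD lee_fin.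
    set x := fine (X om).
    have x0 : 0 <= x by rewrite fine_ge0.
    have [xth|xth] := leP th x.
      have -> : \1_F om = 1 :> R.
        by rewrite indicE mem_set// /F/= -(fineK (Xfin om)) lee_fin.
      have : 0 <= (2 * c)^-1 * (x - c) ^+ 2 by rewrite mulr_ge0// sqr_ge0.
      have -> : (2 * c)^-1 * (x - c) ^+ 2 = (2 * c)^-1 * (x * x) - x + c / 2.
        by field; rewrite gt_eqF.
      by lra.
    have h1 : 0 <= (2 * c)^-1 * (x * x) by rewrite !mulr_ge0.
    have h2 : 0 <= c / 2 * \1_F om by rewrite mulr_ge0.
    by lra.
have {H} := le_trans (occ_first_moment HB s0 tau0 FE mA r0 M0 Er AM rMtau a00 Aa0) H.
have X2 om : E om -> (0 <= (2 * c)^-1%:E * (X om * X om))%E.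
  by move=> _; rewrite mule_ge0// mule_ge0.
have th2 om : E om -> (0 <= th%:E)%E by move=> _; rewrite lee_fin ltW.
have I2 om : E om -> (0 <= (c / 2)%:E * (\1_F om)%:E)%E by move=> _; rewrite mule_ge0 ?lee_fin.
have mthX : measurable_fun E (fun om => th%:E + (2 * c)^-1%:E * (X om * X om))%E.
  by apply: emeasurable_funD.
have thX2 om : E om -> (0 <= th%:E + (2 * c)^-1%:E * (X om * X om))%E.
  by move=> Eom; apply: adde_ge0; [exact: th2 Eom|exact: X2].
rewrite (ge0_integralD _ mE thX2 mthX I2 mI).
rewrite (ge0_integralD _ mE th2 (measurable_cst _) X2 mXX).
have mXX' : measurable_fun E (fun om => X om * X om)%E.
  by apply: measurable_funTS; exact: emeasurable_funM.
have X2' om : E om -> (0 <= X om * X om)%E by move=> _; rewrite mule_ge0.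
rewrite integral_cst// PE (ge0_integralZl _ mE mXX' X2'); last by rewrite lee_fin.
have mI' : measurable_fun E (fun om => (\1_F om)%:E : \bar R).
  by apply/measurable_EFinP; apply: measurable_funTS; exact: measurable_indic.
rewrite (ge0_integralZl _ mE mI'); [|by move=> om _; rewrite lee_fin|by rewrite lee_fin].
rewrite integral_indic// [F `&` E]setIC PEF => H.
have H2 := occ_second_moment HB s0 tau0 FE mA r0 M0 Er AM rMtau a00 Aa0.
have : ((k / 4 * S * pE)%:E <= th%:E * pE%:E + (2 * c)^-1%:E * (4 * (k * S) ^+ 2 * pE)%:E
    + (c / 2)%:E * (fine (P (E `&` F)))%:E)%E.
  apply: (le_trans H); apply: leeD; last by rewrite fineK// fin_num_measure.
  apply: leeD; first by rewrite fineK// fin_num_measure.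
  by apply: lee_wpmul2l => //; rewrite lee_fin.
rewrite -!EFinM -!EFinD !lee_fin.
set p' := fine (P (E `&` F)).
have -> : (2 * c)^-1 * (4 * (k * S) ^+ 2 * pE) = k / 16 * S * pE.
  by rewrite /c; field; rewrite !gt_eqF.
rewrite /th /c => H3.
have kS : 0 < k * S by rewrite mulr_gt0.
(* What is left of the first moment, k S pE (1/4 - 1/16 - 1/16), is at most c / 2 = 16 k S times the
   wanted probability; this gives 1/128. *)
have : k * S * (pE / 128) <= k * S * p' by lra.
by rewrite ler_pM2l.
Qed.

Lemma path_sigma_algebraI d (T : measurableType d) (R : realType)
  (P : probability T R) (B : R -> {RV P >-> R}) (J : set R) (E F : set T) :
  path_sigma_algebra B J E -> path_sigma_algebra B J F -> path_sigma_algebra B J (E `&` F).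
Proof.
pose G := [set A | exists2 w, J w &
         exists2 C : set R, measurable C & A = B w @^-1` C].
exact: (@measurableI _ (g_sigma_algebraType G)).
Qed.

Lemma path_sigma_algebra_occ d (T : measurableType d) (R : realType)
  (P : probability T R) (B : R -> {RV P >-> R}) (HB : brownian_motion B)
  (a b th : R) (A : set R) : 0 <= a -> a <= b -> measurable A ->
  path_sigma_algebra B `[0, b] [set om | (occ_time (fun w om => B w om) a b A om < th%:E)%E].
Proof.
move=> a0 ab mA.
pose G := [set A | exists2 w, `[0, b]%classic w &
         exists2 C : set R, measurable C & A = B w @^-1` C].
pose T' := g_sigma_algebraType G.
have mB w : 0 <= w <= b -> measurable_fun [set: T'] (B w : T' -> R).
  move=> wb _ C mC; rewrite setTI; apply: sub_sigma_algebra.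
  by exists w; [rewrite /= in_itv|exists C].
have mS : measurable (occ_graph (fun w (om : T') => B w om) a b A).
  by apply: measurable_occ_graph => //; exact: bm_continuous HB.
have mX : measurable_fun [set: T'] (fun om : T' => occ_time (fun w om => B w om) a b A om).
  exact: (measurable_fun_ysection lebesgue_measure mS).
have := emeasurable_fun_infty_o measurableT mX th%:E.
by rewrite setTI.
Qed.

(* The windows [t_k + tau_k, t_k + 2 tau_k] with tau_k = 4 L^2 t_k and
   t_(k+1) = t_k + 2 tau_k are disjoint.  E k is the event that all the windows
   before k fail and |B| <= L sqrt t at their starting times, N k that the latter
   bound is violated somewhere. *)
Lemma occ_lower_tail d (T : measurableType d) (R : realType)
  (P : probability T R) (B : R -> {RV P >-> R}) (HB : brownian_motion B)
  (A : set R) (a0 M L t0 Y : R) (m : nat) :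
  measurable A -> 0 < a0 -> lebesgue_measure A = a0%:E ->
  (forall x, A x -> `|x| <= M) -> 0 <= M -> 1 <= L -> 0 < t0 -> M <= Num.sqrt t0 ->
  t0 * (1 + 8 * L ^+ 2) ^+ m <= Y ->
  (P [set om | occ_time (fun w om => B w om) 0 Y A om <
      (gauss_peak R / 16 * (a0 * Num.sqrt t0))%:E] <=
   ((127 / 128) ^+ m + m%:R * (8 / L ^+ 2))%:E)%E.
Proof.
move=> mA a00 Aa0 AM M0 L1 t00 Mt0 tY.
set th := gauss_peak R / 16 * (a0 * Num.sqrt t0).
have L0 : 0 < L by lra.
pose rho := 1 + 8 * L ^+ 2.
have rho1 : 1 <= rho by rewrite /rho lerDl mulr_ge0// sqr_ge0.
pose t k := t0 * rho ^+ k.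
have t_gt0 k : 0 < t k by rewrite mulr_gt0// exprn_gt0//; lra.
have t0t k : t0 <= t k by rewrite /t ler_peMr ?(ltW t00)// exprn_ege1.
have tS k : t k.+1 = t k + 2 * (4 * L ^+ 2 * t k) by rewrite /t exprSr /rho; ring.
have tle i j : (i <= j)%N -> t i <= t j.
  by move=> ij; rewrite /t ler_pM2l// ler_weXn2l.
(* The factor 4 makes sqrt tau = 2 L sqrt t, which leaves room for the bound L sqrt t on the path
   and for M <= sqrt t0 <= L sqrt t. *)
pose tau k := 4 * L ^+ 2 * t k.
have tau0 k : 0 < tau k.
  by apply: mulr_gt0 => //; apply: mulr_gt0 => //; apply: exprn_gt0.
pose G k := [set om | `|B (t k) om| <= L * Num.sqrt (t k)].
pose X k := occ_time (fun w om => B w om) (t k + tau k) (t k + 2 * tau k) A.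
pose F k := [set om | (X k om < th%:E)%E].
have GE k : G k = B (t k) @^-1` [set x | `|x| <= L * Num.sqrt (t k)] by [].
have mabs c : measurable [set x : R | `|x| <= c].
  have := @normr_measurable R setT measurableT _ (measurable_itv `]-oo, c]).
  by rewrite setTI; congr measurable; apply/seteqP; split => x /=; rewrite in_itv.
have FG k : path_sigma_algebra B `[0, t k] (G k).
  by rewrite GE; apply: path_sigma_algebra_proc => //=; rewrite in_itv/= lexx andbT ltW.
pose E := fix E k := if k is k'.+1 then E k' `&` G k' `&` F k' else [set: T].
have FE k : path_sigma_algebra B `[0, t k] (E k) /\
    (P (E k) <= ((127 / 128) ^+ k)%:E)%E.
  elim: k => [|k [IH1 IH2]].
    split; last by rewrite expr0/= probability_setT.
    exact: (@measurableT _ (g_sigma_algebraType [set A | exists2 w, `[0, t 0%N]%classic w &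
         exists2 C : set R, measurable C & A = B w @^-1` C])).
  have FEG : path_sigma_algebra B `[0, t k] (E k `&` G k).
    exact: path_sigma_algebraI.
  have tauS : t k + 2 * tau k = t k.+1 by rewrite tS.
  have FF : path_sigma_algebra B `[0, t k.+1] (F k).
    rewrite /F /X -tauS; apply: path_sigma_algebra_occ => //.
      by rewrite addr_ge0// ltW.
    by have := tau0 k; lra.
  split.
    apply: path_sigma_algebraI => //.
    apply: path_sigma_algebra_sub FEG => z /=; rewrite !in_itv/= => /andP[-> h]/=.
    by apply: le_trans h (tle _ _ _).
  have mEG := path_sigma_algebra_measurable FEG.
  have mF := path_sigma_algebra_measurable FF.
  have sq2 : Num.sqrt (tau k) = 2 * (L * Num.sqrt (t k)).
    rewrite /tau (_ : 4 * _ = (2 * L) ^+ 2); last by ring.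
    by rewrite sqrtrM ?sqr_ge0// sqrtr_sqr ger0_norm ?mulr_ge0 ?(ltW L0)// mulrA.
  have st : Num.sqrt t0 <= Num.sqrt (t k) by rewrite ler_wsqrtr.
  have Lst : Num.sqrt (t k) <= L * Num.sqrt (t k) by rewrite ler_peMl// sqrtr_ge0.
  have r0 : 0 <= L * Num.sqrt (t k) by rewrite mulr_ge0 ?sqrtr_ge0// ltW.
  have rM : (L * Num.sqrt (t k) + M) ^+ 2 <= tau k.
    rewrite -[leRHS](sqr_sqrtr (ltW (tau0 k))) sq2.
    by apply: lerXn2r; rewrite ?nnegrE ?addr_ge0 ?mulr_ge0//; lra.
  have := @occ_lower_prob _ _ _ P B HB (t k) (tau k) (L * Num.sqrt (t k)) M a0 A _
    (ltW (t_gt0 k)) (tau0 k) FEG mA r0 M0 (fun om h => h.2) AM rM a00 Aa0.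
  (* Window k has its own threshold [th'], at least the common [th]; staying below [th] is thus a
     failure for [th'], which costs a factor 127/128. *)
  set th' := gauss_peak R / 16 * (a0 * Num.sqrt (tau k)).
  have thth' : th <= th'.
    rewrite /th /th' ler_pM2l ?divr_gt0 ?gauss_peak_gt0// ler_pM2l// sq2; lra.
  rewrite -/(X k) => H.
  have EFG : E k `&` G k `&` F k `<=` (E k `&` G k) `\` (E k `&` G k `&` [set om | (th'%:E <= X k om)%E]).
    move=> om [EG Fom]; split => // -[_ /= h].
    by have := lt_le_trans Fom (le_trans _ h); rewrite lee_fin ltxx => /(_ thth').
  have mth : measurable [set om | (th'%:E <= X k om)%E].
    rewrite -[X in measurable X]setTI; apply: emeasurable_fun_c_infty => //.
    by apply: (measurable_occ HB) => //; rewrite addr_ge0// ltW.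
  have mEGth : measurable (E k `&` G k `&` [set om | (th'%:E <= X k om)%E]) by exact: measurableI.
  apply: (@le_trans _ _ (P ((E k `&` G k) `\` (E k `&` G k `&` [set om | (th'%:E <= X k om)%E])))).
    by apply: le_measure => //; rewrite inE; [exact: measurableI|exact: measurableD].
  rewrite measureD//; last by rewrite -ge0_fin_numE// fin_num_measure.
  rewrite setIA setIid.
  have PEG : (P (E k `&` G k) <= ((127 / 128) ^+ k)%:E)%E.
    apply: le_trans IH2; apply: le_measure; rewrite ?inE//.
    exact: path_sigma_algebra_measurable IH1.
  rewrite [leLHS](_ : _ = (fine (P (E k `&` G k)) -
      fine (P (E k `&` G k `&` [set om | (th'%:E <= X k om)%E])))%:E); last first.
    by rewrite EFinB !fineK ?fin_num_measure.
  have {}PEG : fine (P (E k `&` G k)) <= (127 / 128) ^+ k.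
    by rewrite -lee_fin fineK// fin_num_measure.
  have {}H : fine (P (E k `&` G k)) / 128 <=
      fine (P (E k `&` G k `&` [set om | (th'%:E <= X k om)%E])).
    by rewrite -lee_fin; apply: (le_trans H); rewrite fineK// fin_num_measure.
  rewrite lee_fin exprS; lra.
have mG k : measurable (G k) := path_sigma_algebra_measurable (FG k).
have PG k : (P (~` G k) <= (8 / L ^+ 2)%:E)%E.
  rewrite (_ : ~` G k = incr_in B 0 (t k) [set x | (L * Num.sqrt (t k) < `|x|)%R]).
    rewrite (bm_gaussian HB)// ?subr0; first exact: normal_prob_tail.
    rewrite (_ : mkset _ = ~` [set x | `|x| <= L * Num.sqrt (t k)]); first exact: measurableC.
    by apply/seteqP; split => x /=; [rewrite ltNge => /negP|move=> /negP; rewrite -ltNge].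
  apply/seteqP; split => om; rewrite /incr_in /G/= (bm_start HB) subr0.
    by move=> /negP; rewrite -ltNge.
  by rewrite ltNge => /negP.
pose N := fix N k := if k is k'.+1 then N k' `|` ~` G k' else set0.
have NP k : measurable (N k) /\ (P (N k) <= (k%:R * (8 / L ^+ 2))%:E)%E.
  elim: k => [|k [IH1 IH2]]; first by split; [exact: measurable0|rewrite mul0r; rewrite measure0].
  split; first by apply: measurableU => //; exact: measurableC.
  have mGC := measurableC (mG k).
  apply: (le_trans (measureU2 _ IH1 mGC)).
  by rewrite -natr1 mulrDl mul1r EFinD; apply: leeD; [exact: IH2|exact: PG].
have sub : [set om | (occ_time (fun w om => B w om) 0 Y A om < th%:E)%E] `<=` E m `|` N m.
  move=> om Hom.
  have : forall k, (k <= m)%N -> E k om \/ N k om.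
    elim=> [_|k IH km]; first by left.
    have [Ek|Nk] := IH (ltnW km); last by right; left.
    have [Gk|Gk] := pselect (G k om); last by right; right.
    left; split => //; apply: le_lt_trans Hom; apply: occ_mono => //.
    - by rewrite addr_ge0// ltW.
    - by rewrite -/(tau k) -tS; apply: le_trans tY; exact: tle.
  exact.
have mEm := path_sigma_algebra_measurable (FE m).1.
have [mN PN] := NP m.
apply: (@le_trans _ _ (P (E m `|` N m))).
  apply: le_measure => //; rewrite inE; last exact: measurableU.
  rewrite -[X in measurable X]setTI; apply: emeasurable_fun_infty_o => //.
  exact: (measurable_occ HB).
apply: (le_trans (measureU2 _ mEm mN)).
by rewrite EFinD; apply: leeD => //; exact: (FE m).2.
Qed.

(** * Growth of the subordinator *)

Lemma geometric_borel_cantelli d (T : measurableType d) (R : realType)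
    (P : probability T R) (F : nat -> set T) (C q : R) (j0 : nat) :
  (forall j, measurable (F j)) -> 0 <= C -> 0 < q < 1 ->
  (forall j, (j0 <= j)%N -> (P (F j) <= (C * q ^+ j)%:E)%E) ->
  \forall om \ae P, exists J, forall j, (J <= j)%N -> ~ F j om.
Proof.
move=> mF C0 /andP[q0 q1] PF.
pose F' j := if (j0 <= j)%N then F j else set0.
have mF' j : measurable (F' j) by rewrite /F'; case: ifP.
have PF' j : (P (F' j) <= (C * q ^+ j)%:E)%E.
  rewrite /F'; case: ifPn => [|_]; first exact: PF.
  by rewrite measure0 lee_fin mulr_ge0// exprn_ge0// ltW.
have hS : (\sum_(j <oo) P (F' j) < +oo)%E.
  apply: (@le_lt_trans _ _ (C / (1 - q))%:E); last exact: ltry.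
  apply: lime_le; first exact: is_cvg_nneseries.
  apply: nearW => n.
  apply: (@le_trans _ _ (\sum_(0 <= i < n) (C * q ^+ i)%:E)%E).
    by apply: lee_sum => i _; exact: PF'.
  rewrite sumEFin lee_fin.
  have -> : \sum_(0 <= i < n) C * q ^+ i = C * (1 - q ^+ n) / (1 - q).
    have q1' : 1 - q != 0 by rewrite subr_eq0 eq_sym lt_eqF.
    elim: n => [|n IH]; first by rewrite big_nil expr0 subrr mulr0 mul0r.
    by rewrite big_nat_recr//= IH exprS; field.
  by rewrite ler_pM2r ?invr_gt0 ?subr_gt0// ler_piMr// gerBl exprn_ge0// ltW.
suff: P.-negligible (~` [set om | exists J, forall j, (J <= j)%N -> ~ F j om]) by [].
exists (lim_sup_set F'); split.
- apply: bigcap_measurableType => k _; apply: bigcup_measurable => i _; exact: mF'.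
- apply: lim_sup_set_cvg0; [exact: mF'|exact: hS].
- move=> om /= Hom n _.
  apply: contrapT => H; apply: Hom; exists (maxn n j0) => j; rewrite geq_max => /andP[nj j0j] Fj.
  by apply: H; exists j => //=; rewrite /F' j0j.
Qed.

Lemma brownian_path_measurable d (T : measurableType d) (R : realType)
  (P : probability T R) (B : R -> {RV P >-> R}) (HB : brownian_motion B) (y : R) om :
  measurable_fun `[0, y] (fun w => B w om).
Proof.
have mI : measurable `[0, y]%classic by exact: measurable_itv.
have sub : `[0, y] `<=` `[0, +oo[%classic.
  by move=> w /=; rewrite !in_itv/= => /andP[->].
exact: (subspace_continuous_measurable_fun mI
  (continuous_subspaceW sub (@bm_continuous _ _ _ _ _ HB om))).
Qed.

Lemma is_cond_exp_total d (T : measurableType d) (R : realType)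
  (P : probability T R) (G : set_system T) (X Y : T -> \bar R) :
  sigma_algebra [set: T] G -> (forall A, G A -> measurable A) ->
  is_cond_exp P G X Y ->
  measurable_fun [set: T] Y /\ (\int[P]_om X om = \int[P]_om Y om)%E.
Proof.
move=> sG Gm [mX X0 Y0 mY H]; split.
  by move=> _ C mC; rewrite setTI; exact/Gm/mY.
apply: H; case: sG => G0 GC _.
by have := GC _ G0; rewrite setD0.
Qed.

(** Only the time spent in A is kept; there H^(- alpha) >= H^(- a), because H >= 1 and alpha <=
    a. *)
Lemma laplace_exponent_lb d (T : measurableType d) (R : realType)
  (P : probability T R) (B : R -> {RV P >-> R}) (HB : brownian_motion B)
  (alpha : R -> R) (malpha : measurable_fun [set: R] alpha)
  (alpha0 : forall x, 0 < alpha x) (A : set R) (a y H th : R) om :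
  measurable A -> (forall x, A x -> alpha x <= a) -> 0 <= y -> 1 <= H ->
  (th%:E <= occ_time (fun w om => B w om) 0 y A om)%E ->
  H `^ (- a) * th <= \int[lebesgue_measure]_(w in `[0, y]) (H^-1 `^ alpha (B w om)).
Proof.
move=> mA Aa y0 H1 thocc.
have H0 : 0 < H by lra.
have mB : measurable_fun `[0, y] (fun w => B w om) by exact: (brownian_path_measurable HB).
have mf : measurable_fun `[0, y] (fun w => (H^-1 `^ alpha (B w om))%:E).
  apply/measurable_EFinP; apply: (measurableT_comp (measurable_powRr _)).
  exact: (measurableT_comp malpha).
have f0 w : (0 <= (H^-1 `^ alpha (B w om))%:E)%E by rewrite lee_fin powR_ge0.
have HV1 : 0 < H^-1 <= 1 by rewrite invr_gt0 H0 invf_le1//; lra.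
(* The real integral is [fine] of the extended one and would be 0 if the latter were infinite; here
   the integrand is at most 1. *)
have fin : (\int[lebesgue_measure]_(w in `[0%R, y]) (H^-1 `^ alpha (B w om))%:E \is a fin_num)%E.
  rewrite ge0_fin_numE; last by apply: integral_ge0 => w _.
  apply: (@le_lt_trans _ _ (\int[lebesgue_measure]_(w in `[0%R, y]) (cst 1 w))%E).
    apply: ge0_le_integral => //.
    by move=> w _; rewrite lee_fin -[leRHS](powRr0 H^-1); apply: ger_powR => //; exact: ltW.
  by rewrite integral_cst//= mul1e lebesgue_measure_itv/=; case: ifP => _; rewrite ?ltry// -EFinB ltry.
rewrite /Rintegral -lee_fin fineK//.
pose S := `[0, y]%classic `&` [set w | A (B w om)].
have mS : measurable S by exact: mB.
have SE : occ_time (fun w om => B w om) 0 y A om = lebesgue_measure S by rewrite occ_timeE.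
apply: (@le_trans _ _ (\int[lebesgue_measure]_(w in S) (cst (H `^ (- a))%:E w))%E).
  by rewrite integral_cst//= EFinM -SE; apply: lee_wpmul2l => //; rewrite lee_fin powR_ge0.
apply: (@le_trans _ _ (\int[lebesgue_measure]_(w in S) (H^-1 `^ alpha (B w om))%:E)%E).
  apply: ge0_le_integral => //.
  - by move=> w _; rewrite lee_fin powR_ge0.
  - by apply: measurable_funS mf => // w [].
  - move=> w [_ /= ABw]; rewrite lee_fin.
    have -> : H `^ (- a) = H^-1 `^ a.
      by rewrite -[in RHS](powR_inv1 (ltW H0)) -powRrM mulN1r.
    by apply: ger_powR => //; exact: Aa.
by apply: ge0_subset_integral => // w [].
Qed.

(** Chernoff bound with lambda = 1 / H: where sigma y < H, the exponential is at least 1 / e. Its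
    mean is given by the Laplace formula and is small on the paths that spend at least th in A. *)
Lemma sigma_lower_tail d (T : measurableType d) (R : realType)
  (P : probability T R) (B sigma : R -> {RV P >-> R}) (HB : brownian_motion B)
  (alpha : R -> R) (malpha : measurable_fun [set: R] alpha)
  (alpha0 : forall x, 0 < alpha x) (Hs : multistable_subordinator alpha B sigma)
  (A : set R) (a y H th : R) :
  measurable A -> (forall x, A x -> alpha x <= a) -> 0 <= y -> 1 <= H ->
  (P [set om | (sigma y om < H)%R] <= (expR 1)%:E *
    (P [set om | occ_time (fun w om => B w om) 0 y A om < th%:E] +
     (expR (- (H `^ (- a) * th)))%:E))%E.
Proof.
move=> mA Aa y0 H1; have H0 : 0 < H by lra.
have HV0 : 0 < H^-1 by rewrite invr_gt0.
have [mY] := is_cond_exp_total (smallest_sigma_algebra _ _)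
  (@path_sigma_algebra_measurable _ _ _ P B _) (ms_laplace Hs y0 HV0).
set U := [set om | (occ_time (fun w om => B w om) 0 y A om < th%:E)%E].
have mU : measurable U.
  rewrite -[X in measurable X]setTI; apply: emeasurable_fun_infty_o => //.
  exact: (measurable_occ HB).
set V := [set om | (sigma y om < H)%R].
have mV : measurable V.
  have := measurable_funP (sigma y) measurableT _ (measurable_itv `]-oo, H[).
  by rewrite setTI; congr measurable; apply/seteqP; split => x /=; rewrite in_itv.
set f := (fun om => (expR (- (H^-1 * sigma y om)))%:E).
have mf : measurable_fun [set: T] f.
  apply/measurable_EFinP; apply: measurableT_comp => //.
  by apply: measurableT_comp => //; apply: measurable_funM.
move=> E.
have h1 : (P V <= (expR 1)%:E * \int[P]_om f om)%E.
  have f0 om : [set: T] om -> (0 <= f om)%E by move=> _; rewrite lee_fin expR_ge0.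
  rewrite -(ge0_integralZl _ measurableT mf f0); last by rewrite lee_fin expR_ge0.
  rewrite -[P V]mul1e -integral_cst// integral_mkcond.
  apply: ge0_le_integral => //.
  - by move=> om _; apply: erestrict_ge0.
  - by apply/(measurable_restrictT _ mV); exact: measurable_cst.
  - exact: measurable_funeM.
  - move=> om _; rewrite /patch; case: ifPn => [|_]; last first.
      by rewrite mule_ge0// lee_fin expR_ge0.
    rewrite inE /V/= => sH; rewrite -EFinM lee_fin -expRD -[leLHS]expR0 ler_expR.
    by rewrite subr_ge0 -[leRHS](mulVf (lt0r_neq0 H0)) ler_pM2l// ltW.
apply: (le_trans h1); apply: lee_wpmul2l; first by rewrite lee_fin expR_ge0.
rewrite E.
apply: (@le_trans _ _ (\int[P]_om ((\1_U om)%:E + (expR (- (H `^ (- a) * th)))%:E))%E).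
  apply: ge0_le_integral => //.
  - apply: emeasurable_funD => //; apply/measurable_EFinP; exact: measurable_indic.
  - move=> om _; rewrite -EFinD lee_fin.
    have [Uom|Uom] := pselect (U om).
      rewrite indicE mem_set//= -[leLHS]addr0; apply: lerD; last exact: expR_ge0.
      rewrite -expR0 ler_expR oppr_le0; apply: Rintegral_ge0 => w _; exact: powR_ge0.
    rewrite indicE memNset// add0r ler_expR lerN2.
    apply: (laplace_exponent_lb HB malpha alpha0 mA Aa y0 H1).
    by rewrite leNgt; apply/negP.
have m1 : measurable_fun [set: T] (fun om => (\1_U om)%:E : \bar R).
  by apply/measurable_EFinP; exact: measurable_indic.
have p1 om : [set: T] om -> (0 <= (\1_U om)%:E :> \bar R)%E by move=> _; rewrite lee_fin.
have p2 om : [set: T] om -> (0 <= (expR (- (H `^ (- a) * th)))%:E)%E.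
  by move=> _; rewrite lee_fin expR_ge0.
rewrite (ge0_integralD _ measurableT p1 m1 p2 (measurable_cst _)).
rewrite integral_indic// setIT integral_cst//; apply: leeD => //.
rewrite -[leRHS]mule1; apply: lee_wpmul2l; [by rewrite lee_fin expR_ge0|exact: probability_le1].
Qed.

(* Sparse enough for Borel-Cantelli with geometric bounds, yet Y_(j+1) is at most
   a power of Y_j with exponent tending to 1. *)
Definition scale (R : realType) (n j : nat) : R := 2 ^+ (n * j ^ 2).

Lemma scale_ge1 (R : realType) n j : 1 <= scale R n j.
Proof. by rewrite /scale exprn_ege1// ler1n. Qed.

Lemma scale_powR (R : realType) n j (g : R) : scale R n j `^ g = 2 `^ (n%:R * g * j%:R ^+ 2).
Proof.
by rewrite /scale -powR_mulrn// -powRrM natrM natrX; congr (_ `^ _); ring.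
Qed.

(** By expR x >= x the right-hand side is at least K j^2, which exceeds j once K j >= 1. *)
Lemma powR2_eventually_ge (R : realType) (c e : R) : 0 < c -> 0 < e ->
  exists j0, forall j, (j0 <= j)%N -> j%:R <= c * 2 `^ (e * j%:R ^+ 2).
Proof.
move=> c0 e0.
have l2 : 0 < ln (2 : R) by rewrite ln_gt0// ltr1n.
pose K := c * e * ln 2; have K0 : 0 < K by rewrite !mulr_gt0.
exists (Num.bound K^-1) => j jb.
have h1 : K^-1 <= j%:R.
  apply: (@le_trans _ _ (Num.bound K^-1)%:R); last by rewrite ler_nat.
  by apply/ltW/archi_boundP; rewrite invr_ge0 ltW.
have h2 : 1 <= K * j%:R by rewrite -[leLHS](mulfV (lt0r_neq0 K0)) ler_pM2l.
apply: (@le_trans _ _ (K * j%:R * j%:R)); first by rewrite ler_peMl.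
rewrite /powR gt_eqF//.
apply: (@le_trans _ _ (c * (e * j%:R ^+ 2 * ln 2))); first by rewrite /K le_eqVlt; apply/orP; left; apply/eqP; ring.
by rewrite ler_pM2l//; apply: le_trans (expR_ge1Dx _); rewrite lerDr.
Qed.

(* With L = 2^j, one window multiplies the time by 1 + 8 * 4^j <= 2^(6 j), so that
   j windows starting at time 2^(n j^2) fit before 2^((n + 6) j^2). *)
Lemma sigma_lower_as d (T : measurableType d) (R : realType)
  (P : probability T R) (B sigma : R -> {RV P >-> R}) (HB : brownian_motion B)
  (alpha : R -> R) (malpha : measurable_fun [set: R] alpha)
  (alpha0 : forall x, 0 < alpha x) (Hs : multistable_subordinator alpha B sigma)
  (n j0 : nat) (A : nat -> set R) (a0 M H : nat -> R) (a : R) :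
  (forall j, (j0 <= j)%N -> [/\ measurable (A j), 0 < a0 j,
     lebesgue_measure (A j) = (a0 j)%:E &
     forall x, A j x -> `|x| <= M j /\ alpha x <= a]) ->
  (forall j, (j0 <= j)%N -> [/\ 0 <= M j, M j <= Num.sqrt (scale R n j), 1 <= H j &
     j%:R <= H j `^ (- a) * (gauss_peak R / 16 * (a0 j * Num.sqrt (scale R n j)))]) ->
  \forall om \ae P, exists J, forall j, (J <= j)%N -> H j <= sigma (scale R (n + 6) j) om.
Proof.
move=> HA HH.
have q0 : 0 < (127 / 128 : R) < 1 by apply/andP; split; lra.
(* 10 = 1 + 8 + 1: the failing windows, the excursions beyond 2^j sqrt t, and exp(- j) <= 2^(- j),
   all compared with (127/128)^j. *)
have C0 : 0 <= expR 1 * 10 :> R by rewrite mulr_ge0// expR_ge0.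
pose F j := [set om | sigma (scale R (n + 6) j) om < H j].
have mF j : measurable (F j).
  have := measurable_funP (sigma (scale R (n + 6) j)) measurableT _ (measurable_itv `]-oo, H j[).
  by rewrite setTI; congr measurable; apply/seteqP; split => x /=; rewrite in_itv.
suff PF j : (j0 <= j)%N -> (P (F j) <= (expR 1 * 10 * (127 / 128) ^+ j)%:E)%E.
  apply: filterS (geometric_borel_cantelli mF C0 q0 PF) => om [J HJ].
  by exists J => j Jj; rewrite leNgt; apply/negP; exact: HJ.
move=> jj; have [mA a00 Aa0 AM] := HA j jj; have [M0 Mt H1 jH] := HH j jj.
set th := gauss_peak R / 16 * (a0 j * Num.sqrt (scale R n j)).
have y0 : 0 <= scale R (n + 6) j by apply: le_trans (scale_ge1 _ _ _).
have Aa x : A j x -> alpha x <= a by move=> /AM[].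
have AM' x : A j x -> `|x| <= M j by move=> /AM[].
apply: (le_trans (sigma_lower_tail HB malpha alpha0 Hs th mA Aa y0 H1)).
rewrite (_ : expR 1 * 10 * _ = expR 1 * (10 * (127 / 128) ^+ j)); last by rewrite mulrA.
rewrite [leRHS]EFinM; apply: lee_wpmul2l; first by rewrite lee_fin expR_ge0.
have L1 : 1 <= 2 ^+ j :> R by rewrite exprn_ege1// ler1n.
have t00 : 0 < scale R n j by apply: lt_le_trans (scale_ge1 _ _ _).
(* 1 + 8 x <= 16 x for x = 4^j >= 1, and 2 j^2 + 4 j <= 6 j^2; this is the origin of the 6. *)
have tY : scale R n j * (1 + 8 * (2 ^+ j) ^+ 2) ^+ j <= scale R (n + 6) j.
  apply: (@le_trans _ _ (scale R n j * (2 ^+ (2 * j + 4)) ^+ j)).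
    have p1 : 0 <= 1 + 8 * (2 ^+ j) ^+ 2 :> R by rewrite addr_ge0// mulr_ge0// sqr_ge0.
    rewrite ler_pM2l//; apply: lerXn2r; [by rewrite nnegrE|by rewrite nnegrE exprn_ge0|].
    rewrite exprD -exprM mulnC; have : 1 <= 2 ^+ (2 * j) :> R by rewrite exprn_ege1// ler1n.
    by rewrite (_ : 2 ^+ 4 = 16 :> R); [lra|rewrite !exprS expr0; lra].
  rewrite /scale -exprM -exprD; apply: ler_weXn2l; first by rewrite ler1n.
  rewrite [leqRHS]mulnDl leq_add2l -mulnn mulnA leq_mul2r.
  by case: (posnP j) => //= k; rewrite (mulnDl 2 4) leq_add2l leq_pmulr.
have half : 2^-1 ^+ j <= (127 / 128 : R) ^+ j.
  by apply: lerXn2r; rewrite ?nnegrE; lra.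
apply: (@le_trans _ _ (((127 / 128) ^+ j + j%:R * (8 / (2 ^+ j) ^+ 2))%:E + (2^-1 ^+ j)%:E)%E).
  apply: leeD; first exact: (occ_lower_tail HB mA a00 Aa0 AM' M0 L1 t00 Mt tY).
  rewrite lee_fin; apply: (@le_trans _ _ (expR (- j%:R))); first by rewrite ler_expR lerN2.
  rewrite expRN exprVn lef_pV2 ?posrE ?expR_gt0 ?exprn_gt0//.
  rewrite -[X in expR X]mulr_natl mulr1 -[X in expR X]mulr1 expRM_natl.
  apply: lerXn2r; rewrite ?nnegrE ?expR_ge0//.
  by apply: le_trans (expR_ge1Dx _).
rewrite -EFinD lee_fin.
have : j%:R * (8 / (2 ^+ j) ^+ 2) <= 8 * 2^-1 ^+ j :> R.
  have p0 : 0 < 2 ^+ j :> R by rewrite exprn_gt0.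
  have jp : j%:R <= 2 ^+ j :> R by rewrite -natrX ler_nat ltnW// ltn_expl.
  rewrite exprVn (_ : _ * _ = 8 / (2 ^+ j) * (j%:R / 2 ^+ j)); last first.
    by field; rewrite gt_eqF.
  by rewrite ler_piMr ?divr_ge0 ?(ltW p0)// ler_pdivrMr// mul1r.
lra.
Qed.

(** * Jumps of the subordinator *)

Lemma measurable_powR2 d (T : measurableType d) (R : realType) (f g : T -> R) :
  measurable_fun [set: T] f -> measurable_fun [set: T] g ->
  measurable_fun [set: T] (fun x => f x `^ g x).
Proof.
move=> mf mg; rewrite /powR.
apply: measurable_fun_ifT.
- exact: measurable_fun_eqr.
- rewrite (_ : (fun x => _) = (fun x => if g x == 0 then 1 else 0)); last first.
    by apply/funext => x; case: eqP.
  by apply: measurable_fun_ifT => //; exact: measurable_fun_eqr.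
- apply: measurableT_comp => //; apply: measurable_funM => //.
  by apply: measurableT_comp => //; exact: measurable_ln.
Qed.

Lemma Gamma_ge0 (R : realType) (b : R) : 0 <= Gamma b.
Proof. by apply: Rintegral_ge0 => s _; rewrite mulr_ge0 ?powR_ge0 ?expR_ge0. Qed.

(** The Levy density is normalized by Gamma (1 - alpha (B_w)), so the joint measurability of the
    jump intensity passes through that of Gamma. *)
Lemma measurable_Gamma (R : realType) : measurable_fun [set: R] (@Gamma R).
Proof.
pose f (p : R * R) : \bar R :=
  ((p.2 `^ (p.1 - 1) * expR (- p.2)) * \1_(`]0, +oo[) p.2)%:E.
have mf : measurable_fun [set: R * R] f.
  have mi (D : set R) : measurable D -> measurable_fun [set: R] (\1_D : R -> R).
    exact: measurable_indic.
  apply/measurable_EFinP; apply: measurable_funM; last first.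
    exact: (measurableT_comp (mi _ (measurable_itv _)) measurable_snd).
  apply: measurable_funM; last first.
    by apply: measurableT_comp => //; apply: measurableT_comp.
  by apply: measurable_powR2 => //; exact: measurable_funB.
have f0 p : (0 <= f p)%E.
  by rewrite lee_fin !mulr_ge0 ?powR_ge0 ?expR_ge0.
have H := @measurable_fun_fubini_tonelli_F _ _ _ _ R lebesgue_measure f mf f0.
have := measurableT_comp (fine_measurable measurableT) H.
congr measurable_fun; apply/funext => b; rewrite /fubini_F/= /Gamma /Rintegral.
congr fine; rewrite [RHS]integral_mkcond; apply: eq_integral => s _.
rewrite /f/= patchE indicE; case: (s \in _); rewrite ?mulr1 ?mulr0//.
Qed.

(* If the integral diverges, the junk value [Gamma _ = 0] gives [_^-1 = 0]. *)
Lemma Gamma_inv_le (R : realType) (a : R) : 0 < a < 1 -> (Gamma (1 - a))^-1 <= expR 1.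
Proof.
move=> /andP[a0 a1].
have mf D : measurable_fun D (fun s : R => (s `^ (1 - a - 1) * expR (- s))%:E).
  apply/measurable_EFinP/measurable_funTS; apply: measurable_funM.
    exact: measurable_powR.
  by apply: measurableT_comp => //; exact: oppr_measurable.
have f0 (s : R) : (0 <= (s `^ (1 - a - 1) * expR (- s))%:E)%E.
  by rewrite lee_fin mulr_ge0 ?powR_ge0 ?expR_ge0.
have lb : ((expR (- 1))%:E <=
    \int[lebesgue_measure]_(s in `]0%R, +oo[) (s `^ (1 - a - 1) * expR (- s))%:E)%E.
  apply: (@le_trans _ _ (\int[lebesgue_measure]_(s in `]0%R, 1%R])
    (s `^ (1 - a - 1) * expR (- s))%:E)%E); last first.
    apply: ge0_subset_integral => //; first exact: mf.
    by move=> s /=; rewrite !in_itv/= => /andP[->].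
  apply: (@le_trans _ _ (\int[lebesgue_measure]_(s in `]0%R, 1%R]) (cst (expR (- 1))%:E s))%E).
    by rewrite integral_cst//= lebesgue_measure_itv/= lte_fin ltr01 sube0 mule1.
  apply: ge0_le_integral => //.
  - by move=> s _; rewrite lee_fin expR_ge0.
  - exact: mf.
  - move=> s /=; rewrite in_itv/= => /andP[s0 s1]; rewrite lee_fin.
    rewrite -[leLHS]mul1r; apply: ler_pM => //; rewrite ?expR_ge0//.
      rewrite -[leLHS](powRr0 s); apply: ger_powR; first by rewrite s0.
      by lra.
    by rewrite ler_expR lerN2.
have [fin|] := boolP (\int[lebesgue_measure]_(s in `]0%R, +oo[)
  (s `^ (1 - a - 1) * expR (- s))%:E \is a fin_num)%E.
  have : expR (- 1) <= Gamma (1 - a).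
    by rewrite -lee_fin /Gamma /Rintegral fineK.
  move=> h; rewrite -[leRHS]invrK -expRN lef_pV2 ?posrE ?expR_gt0//.
  by apply: lt_le_trans h; rewrite expR_gt0.
rewrite ge0_fin_numE; last by apply: integral_ge0 => s _.
by rewrite -leNgt leye_eq /Gamma /Rintegral => /eqP ->; rewrite /= invr0 expR_ge0.
Qed.

(** The function - G s^(- a) is an antiderivative of the density. The constant does not depend on a,
    so the bound can be used along a path on which the index varies. *)
Lemma stable_levy_tail_le (R : realType) (a h : R) : 0 < a < 1 -> 0 < h ->
  (stable_levy a `]h, +oo[ <= (expR 1 * h `^ (- a))%:E)%E.
Proof.
move=> a01 h0; have /andP[a0 a1] := a01.
pose G := (Gamma (1 - a))^-1.
have G0 : 0 <= G by rewrite invr_ge0 Gamma_ge0.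
pose f s := a * s `^ (- a - 1) * G.
have mf D : measurable_fun D (fun s => (f s)%:E).
  apply/measurable_EFinP/measurable_funTS; apply: measurable_funM => //.
  by apply: measurable_funM => //; exact: measurable_powR.
have f0 s : 0 <= f s by rewrite !mulr_ge0 ?powR_ge0// ltW.
have dp (p s : R) : 0 < s -> is_derive s 1 (@powR R ^~ p) (p * s `^ (p - 1)).
  move=> s0; have sI : s \in `]0, +oo[ by rewrite in_itv/= s0.
  apply: DeriveDef; first exact: derivable_powR.
  by rewrite -derive1E powR_derive1.
have cp (p s : R) : 0 < s -> {for s, continuous (@powR R ^~ p)}.
  move=> s0; apply: differentiable_continuous; apply/derivable1_diffP.
  by have [] := dp p s s0.
rewrite /stable_levy.
pose S (n : nat) : set R := `]h, h + n.+1%:R[%classic.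
have SE : `]h, +oo[%classic = \bigcup_n S n.
  apply/seteqP; split => s /=; rewrite in_itv/= ?andbT; first move=> hs.
    exists (Num.bound (s - h)) => //; rewrite /S /= in_itv/= hs/= -ltrBlDl.
    have h1 : s - h < (Num.bound (s - h))%:R by apply: archi_boundP; rewrite subr_ge0 ltW.
    by apply: (lt_trans h1); rewrite ltr_nat.
  by move=> [n _]; rewrite /S/= in_itv/= => /andP[].
have cvgS : (\int[lebesgue_measure]_(s in S n) (f s)%:E)%E @[n --> \oo] -->
    (\int[lebesgue_measure]_(s in \bigcup_n S n) (f s)%:E)%E.
  apply: ge0_nondecreasing_set_cvg_integral.
  - move=> n m nm; rewrite subsetEset; apply: subset_itvl; rewrite bnd_simp lerD2l ler_nat ltnS//.
  - by move=> i; exact: measurable_itv.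
  - by move=> n; exact: mf.
  - by move=> n s _; rewrite lee_fin.
rewrite SE -(cvg_lim _ cvgS)//; apply: lime_le; first by apply/cvg_ex; eexists; exact: cvgS.
apply: nearW => n.
apply: (@le_trans _ _ (G * h `^ (- a))%:E); last first.
  by rewrite lee_fin ler_wpM2r ?powR_ge0// Gamma_inv_le.
apply: (@integral_oo_le_increment _ f (fun s => (- G) * s `^ (- a))).
- by rewrite ltrDl.
- by move=> s _.
- move=> s /andP[hs _]; have s0 : 0 < s by lra.
  apply: cvgM; last exact: cvg_cst.
  by apply: cvgM; [exact: cvg_cst|exact: cp].
- move=> s /andP[hs _]; have s0 : 0 < s by lra.
  apply: (is_derive_eq (is_deriveZ (- G) (dp (- a) s s0))).
  by rewrite /GRing.scale/= /f; ring.
- move=> x z hx xz _; rewrite !mulNr opprK addrC.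
  have x0 : 0 < x by lra.
  apply: (@le_trans _ _ (G * x `^ (- a))).
    by rewrite gerBl mulr_ge0// powR_ge0.
  rewrite ler_wpM2l// !powRN lef_pV2 ?posrE ?powR_gt0//.
  by apply: ge0_ler_powR; rewrite ?nnegrE; lra.
Qed.

Lemma measurable_stable_levy_tail d (T : measurableType d) (R : realType) (h : R) (al : T -> R) :
  (forall x, 0 < al x < 1) -> measurable_fun [set: T] al ->
  measurable_fun [set: T] (fun x => stable_levy (al x) `]h, +oo[).
Proof.
move=> al01 mal.
pose f (p : T * R) : \bar R :=
  ((al p.1 * p.2 `^ (- al p.1 - 1) * (Gamma (1 - al p.1))^-1) * \1_(`]h, +oo[) p.2)%:E.
have mal1 : measurable_fun [set: T * R] (fun p => al p.1) by exact: measurableT_comp.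
have mf : measurable_fun [set: T * R] f.
  have mi (D : set R) : measurable D -> measurable_fun [set: R] (\1_D : R -> R).
    exact: measurable_indic.
  apply/measurable_EFinP; apply: measurable_funM; last first.
    exact: (measurableT_comp (mi _ (measurable_itv _)) measurable_snd).
  apply: measurable_funM.
    apply: measurable_funM => //; apply: measurable_powR2 => //.
    by apply: measurable_funB => //; exact: measurableT_comp.
  rewrite (_ : (fun x => _) = (fun x => Gamma (1 - al x.1) `^ (-1))); last first.
    by apply/funext => x; rewrite powR_inv1// Gamma_ge0.
  apply: (measurableT_comp (measurable_powR _)).
  apply: (measurableT_comp (@measurable_Gamma R)).
  exact: measurable_funB.
have f0 p : (0 <= f p)%E.
  have /andP[a0 a1] := al01 p.1.
  by rewrite lee_fin !mulr_ge0 ?powR_ge0 ?invr_ge0 ?Gamma_ge0// ltW.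
have H := @measurable_fun_fubini_tonelli_F _ _ _ _ R lebesgue_measure f mf f0.
rewrite (_ : (fun x => _) = fubini_F lebesgue_measure f)//.
apply/funext => x; rewrite /fubini_F/= /stable_levy.
rewrite integral_mkcond; apply: eq_integral => s _.
by rewrite /f/= patchE indicE; case: (s \in _); rewrite ?mulr1 ?mulr0.
Qed.

Lemma left_limit_bounds (R : realType) (f : R -> R) (w : R) :
  (forall s t, 0 <= s -> s < t -> f s < f t) -> 0 < w ->
  (forall s, 0 <= s -> s < w -> f s <= lim (f s @[s --> w^'-])) /\
  lim (f s @[s --> w^'-]) <= f w.
Proof.
move=> finc w0.
have fnd s t : 0 <= s -> s <= t -> f s <= f t.
  by move=> s0; rewrite le_eqVlt => /orP[/eqP ->//|st]; apply/ltW/finc.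
have cf : cvg (f s @[s --> w^'-]).
  apply: nondecreasing_at_left_is_cvgr.
  - near=> x => s t; rewrite !in_itv/= => /andP[xs _] _ st; apply: fnd => //.
    by apply: ltW; apply: lt_trans xs; near: x; exact: nbhs_left_gt.
  - near=> x; exists (f w) => _ [s /=] sx <-; move: sx; rewrite in_itv/= => /andP[xs sw].
    apply: fnd; last exact: ltW.
    by apply: ltW; apply: lt_trans xs; near: x; exact: nbhs_left_gt.
split.
- move=> s s0 sw; apply: limr_ge => //; near=> x; apply: fnd => //.
  by apply: ltW; near: x; exact: nbhs_left_gt.
- apply: limr_le => //; near=> x; apply: fnd; last by apply: ltW; near: x; exact: nbhs_left_lt.
  by apply: ltW; near: x; exact: nbhs_left_gt.
Unshelve. all: by end_near. Qed.

Lemma jump_ge0 (R : realType) (f : R -> R) (w : R) :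
  (forall s t, 0 <= s -> s < t -> f s < f t) -> 0 < w -> 0 <= jump f w.
Proof. by move=> finc w0; rewrite subr_ge0; have [] := left_limit_bounds finc w0. Qed.

Definition big_jumps (R : realType) (f : R -> R) (y h : R) : set R :=
  [set w | 0 < w <= y /\ h < jump f w].

(** Jumps larger than h add up to at most f y - f 0, so there cannot be more than (f y - f 0) / h of
    them. *)
Lemma finite_big_jumps (R : realType) (f : R -> R) (y h : R) :
  (forall s t, 0 <= s -> s < t -> f s < f t) -> pure_jump f -> 0 <= y -> 0 < h ->
  finite_set (big_jumps f y h).
Proof.
move=> finc pj y0 h0; apply: contrapT => inf.
have K0 : 0 <= (f y - f 0) / h.
  rewrite divr_ge0 ?subr_ge0//; last exact: ltW.
  by move: y0; rewrite le_eqVlt => /orP[/eqP <-//|y0]; exact/ltW/finc.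
have [F FJ Fn] := infinite_set_fset (Num.bound ((f y - f 0) / h)) inf.
have : ((f y - f 0)%:E < (h * (Num.bound ((f y - f 0) / h))%:R)%:E)%E.
  by rewrite lte_fin mulrC -ltr_pdivrMr//; exact: archi_boundP.
rewrite (pj y y0); apply/negP; rewrite -leNgt; apply: esum_ge; exists [set` F].
  by split; [exact: finite_fset|by move=> w /FJ []].
rewrite fsbig_finite; last exact: finite_fset.
rewrite set_fsetK sumEFin lee_fin.
apply: (@le_trans _ _ (\sum_(i <- finmap.enum_fset F) h)).
  rewrite big_const_seq count_predT iter_addr addr0 -[leRHS]mulr_natr ler_pM2l// ler_nat.
  exact: Fn.
rewrite !big_seq; apply: ler_sum => i iF; apply: ltW.
by have [] := FJ i iF.
Qed.

Lemma counting_ge0 (R : realType) (A : set R) :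
  (0 <= counting A :> \bar R)%E.
Proof. by rewrite /counting; case: ifPn; rewrite ?lee_fin// lee_pinfty. Qed.

(** The intensity formula speaks about time intervals and events of sigma(B); this makes the
    corresponding rectangles a generator for the pi-lambda argument in [campbell]. *)
Lemma prod_sigma_algebra_rect (R : realType) (T : pointedType) (G0 : set_system T) :
  (measurable : set_system (R * g_sigma_algebraType G0)) `<=`
  <<s [set E : set (R * T) | exists u v G, <<s G0 >> G /\ E = `]u, v] `*` G] >>.
Proof.
set GG := [set E : set (R * T) | _].
rewrite measurable_prod_measurableType; apply: smallest_sub.
  exact: smallest_sigma_algebra.
move=> _ [A mA [G mG <-]].
pose T2 := g_sigma_algebraType GG.
have rect u v : <<s GG >> (`]u, v] `*` G).
  by apply: sub_sigma_algebra; exists u, v, G.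
have TG : <<s GG >> ([set: R] `*` G).
  have -> : [set: R] `*` G = \bigcup_n (`]- n%:R, n%:R] `*` G).
    apply/seteqP; split => -[w om] /=; last by move=> [n _ []].
    move=> [_ Gom]; exists (Num.bound `|w|).+1 => //=; split => //.
    have h : `|w| < (Num.bound `|w|).+1%:R.
      by apply: (lt_trans (archi_boundP (normr_ge0 w))); rewrite ltr_nat.
    by move: h; rewrite ltr_norml in_itv/= => /andP[-> /ltW].
  by apply: (@bigcupT_measurable _ T2) => n; exact: rect.
have : <<s @ocitv R >> A by exact: mA.
suff : <<s @ocitv R >> `<=` [set A' | <<s GG >> (A' `*` G)] by apply.
apply: smallest_sub.
- split => /=.
  + by rewrite set0X; exact: (@measurable0 _ T2).
  + move=> X XG; rewrite (_ : (_ `\` X) `*` G = ([set: R] `*` G) `\` (X `*` G)).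
      exact: (@measurableD _ T2).
    by apply/seteqP; split => -[w om] /=; tauto.
  + move=> F FG; rewrite (_ : _ `*` G = \bigcup_k (F k `*` G)).
      exact: (@bigcupT_measurable _ T2).
    by apply/seteqP; split => -[w om] /=; [move=> [[k _ ?] ?]; exists k|move=> [k _ [? ?]]; split => //; exists k].
- by move=> _ [[u v] _ <-]; exact: rect.
Qed.

Lemma finite_set_measurable (R : realType) (A : set R) : finite_set A -> measurable A.
Proof.
move=> fA; apply: countable_measurable; last exact: finite_set_countable.
by move=> t; exact: measurable_set1.
Qed.

Lemma counting_fin_num (R : realType) (A : set R) : finite_set A ->
  (counting A : \bar R) \is a fin_num.
Proof. by move=> fA; rewrite /counting asboolT. Qed.

(* By Dynkin's theorem, the intensity formula for the jumps in ]u, v] on an event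
   of sigma(B) extends to every set in the product of the Borel sets and sigma(B), here
   {(w, om) | B_w(om) in D}. *)
Lemma campbell d (T : measurableType d) (R : realType)
  (P : probability T R) (B sigma : R -> {RV P >-> R}) (HB : brownian_motion B)
  (alpha : R -> R) (malpha : measurable_fun [set: R] alpha)
  (alpha01 : forall x, 0 < alpha x < 1) (Hs : multistable_subordinator alpha B sigma)
  (y h c : R) (D : set R) : 0 <= y -> 0 < h -> 0 <= c -> measurable D ->
  (forall x, D x -> (stable_levy (alpha x) `]h, +oo[ <= c%:E)%E) ->
  let N om := counting (big_jumps (fun s => sigma s om) y h `&` [set w | D (B w om)]) in
  measurable_fun [set: T] N /\
  (\int[P]_om N om <= c%:E * \int[lebesgue_measure]_(w in `[0%R, y]) P (B w @^-1` D))%E.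
Proof.
move=> y0 h0 c0 mD Dc /=.
pose J om := big_jumps (fun s => sigma s om) y h.
have fJ om : finite_set (J om).
  apply: finite_big_jumps => //; [exact: (ms_increasing Hs)|exact: (ms_pure_jump Hs)].
pose N (E : set (R * T)) om : \bar R := counting (J om `&` [set w | E (w, om)]).
have fJE E om : finite_set (J om `&` [set w | E (w, om)]).
  exact: finite_setIl.
have N0 E om : (0 <= N E om)%E by exact: counting_ge0.
have Nfin E om : N E om \is a fin_num by exact: counting_fin_num.
pose cl (w : R) : R := Num.max 0 (Num.min y w).
have cl0 w : 0 <= cl w <= y.
  by rewrite /cl le_max lexx/= ge_max ge_min lexx/= andbT.
have ccl : continuous cl.
  by move=> w; apply: continuous_max; [exact: cvg_cst|apply: continuous_min; [exact: cvg_cst|exact: cvg_id]].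
have mZ : measurable_fun [set: R * T] (fun p => B (cl p.1) p.2).
  apply: (@continuous_process_measurable _ _ _ (fun w om => B (cl w) om)).
    by move=> w; exact: measurable_funP.
  move=> om; apply: (continuous_comp_within (@bm_continuous _ _ _ _ _ HB om) ccl) => w.
  by have /andP[] := cl0 w.
have clE w : 0 < w <= y -> cl w = w.
  by move=> /andP[w0 wy]; rewrite /cl min_r// max_r// ltW.
pose v (p : R * T) := stable_levy (alpha (B (cl p.1) p.2)) `]h, +oo[.
have mv : measurable_fun [set: R * T] v.
  apply: (@measurable_stable_levy_tail _ _ _ h (fun p : R * T => alpha (B (cl p.1) p.2))) => //.
  exact: (measurableT_comp malpha).
have v0 p : (0 <= v p)%E.
  apply: integral_ge0 => s _; have /andP[a0 a1] := alpha01 (B (cl p.1) p.2).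
  by rewrite lee_fin !mulr_ge0 ?powR_ge0 ?invr_ge0 ?Gamma_ge0// ltW.
pose S0 : set (R * T) := `]0, y] `*` setT.
have mS0 : measurable S0 by apply: measurableX => //; exact: measurable_itv.
pose g (p : R * T) : \bar R := ((\1_S0 p)%:E * v p)%E.
have mg D' : measurable_fun D' g.
  apply: measurable_funTS; apply: emeasurable_funM => //.
  by apply/measurable_EFinP; exact: measurable_indic.
have g0 p : (0 <= g p)%E by rewrite mule_ge0// lee_fin.
pose mu := (lebesgue_measure \x P)%E.
have muS0 : (mu S0 = lebesgue_measure `]0%R, y])%E.
  transitivity (lebesgue_measure `]0%R, y] * P setT)%E.
    by apply: product_measure1E => //; exact: measurable_itv.
  by rewrite probability_setT mule1.
(* The compensator of the jumps larger than h before y, as a measure on time and sample space; [H]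
   collects the sets on which it agrees with the mean number of jumps. *)
pose m2 E := (\int[mu]_(p in E) g p)%E.
pose H := [set E : set (R * T) | [/\ measurable E, measurable_fun [set: T] (N E) &
  (\int[P]_om N E om = m2 E)%E]].
have m2fin E : measurable E -> m2 E \is a fin_num.
  move=> mE; rewrite ge0_fin_numE; last exact: integral_ge0.
  (* h^(- alpha) <= 1 + 1/h whatever alpha in (0, 1). The resulting finiteness allows the
     subtraction for complements. *)
  pose c1 := expR 1 * (1 + h^-1) : R.
  have c10 : 0 <= c1 by rewrite mulr_ge0 ?expR_ge0// addr_ge0// invr_ge0 ltW.
  apply: (@le_lt_trans _ _ (\int[mu]_(p in setT) (c1%:E * (\1_S0 p)%:E))%E).
    apply: (@le_trans _ _ (\int[mu]_(p in setT) g p)%E).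
      by apply: ge0_subset_integral => //; exact: mg.
    apply: ge0_le_integral => //.
    - exact: mg.
    - by apply: measurable_funeM; apply/measurable_EFinP; exact: measurable_indic.
    - move=> p _; rewrite /g muleC; apply: lee_wpmul2r; first by rewrite lee_fin.
      have /andP[a0 a1] := alpha01 (B (cl p.1) p.2).
      apply: (le_trans (stable_levy_tail_le (alpha01 _) h0)).
      rewrite lee_fin ler_pM2l ?expR_gt0//.
      have [h1|h1] := leP 1 h.
        apply: (@le_trans _ _ 1); last by rewrite lerDl invr_ge0 ltW.
        by rewrite -[leRHS](powRr0 h) ler_powR// oppr_le0 ltW.
      rewrite -[leLHS]add0r -(powR_inv1 (ltW h0)); apply: lerD => //.
      by apply: ger_powR; [rewrite h0 ltW|rewrite lerN2 ltW].
  rewrite ge0_integralZl//; last first.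
    by apply/measurable_EFinP; exact: measurable_indic.
  rewrite integral_indic// setIT; apply: (@le_lt_trans _ _ (c1%:E * mu S0)%E) => //.
  rewrite muS0 lebesgue_measure_itv/= lte_fin.
  by case: ifP => _; rewrite -?EFinB -EFinM ltry.
have ysec_mN (E : set (R * T)) om : measurable (J om `&` [set w | E (w, om)]).
  exact: finite_set_measurable.
(* [E] only has to agree with a rectangle at times in ]0, y], the only ones seen by [N] and [m2];
   this also covers the whole space. *)
have Hrect (E : set (R * T)) (u u' : R) (G : set T) : measurable E ->
    path_sigma_algebra B `[0, +oo[ G ->
    (forall w om, 0 < w <= y -> E (w, om) <-> (u < w <= u' /\ G om)) -> H E.
  move=> mE FG EE.
  have mG := path_sigma_algebra_measurable FG.
  (* ]u, u'] clipped to ]0, y]; the outer maximum keeps a <= b when nothing remains. *)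
  pose a := Num.max u 0; pose b := Num.max a (Num.min u' y).
  have a0 : 0 <= a by rewrite le_max lexx orbT.
  have ab : a <= b by rewrite le_max lexx.
  have abE w : (a < w <= b) = ((u < w <= u') && (0 < w <= y)).
    apply/idP/idP.
      rewrite /b le_max /a => /andP[]; rewrite gt_max => /andP[h1 h2] /orP[h3|].
        by move: h3; rewrite leNgt gt_max h1 h2.
      by rewrite le_min => /andP[h3 h4]; rewrite h1 h2 h3 h4.
    move=> /andP[/andP[h1 h2] /andP[h3 h4]].
    by rewrite /b /a gt_max h1 h3/= le_max le_min h2 h4 orbT.
  have hC : `]h, +oo[ `<=` `]0, +oo[%classic.
    by move=> s /=; rewrite !in_itv/= !andbT; apply: lt_trans.
  have [mjc jc0 _ _ Hjc] := ms_jump_intensity Hs a0 ab (measurable_itv `]h, +oo[) hC.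
  have NE om : N E om = ((\1_G om)%:E * jump_count (fun s => sigma s om) a b `]h, +oo[)%E.
    have [Gom|Gom] := pselect (G om).
      rewrite indicE mem_set// mul1e /N /jump_count; congr counting.
      apply/seteqP; split => w /=; rewrite /J /big_jumps/= in_itv/= andbT abE.
        by move=> [[wy jw] /(EE _ _ wy)[-> _]]; rewrite wy.
      by move=> [/andP[uw wy] jw]; split => //; apply/(EE _ _ wy).
    rewrite indicE memNset// mul0e /N (_ : _ `&` _ = set0).
      by rewrite /counting asboolT// fset_set0.
    by apply/seteqP; split => // w [[wy jw] /= /(EE _ _ wy)[_ /Gom]].
  have mN : measurable_fun [set: T] (N E).
    rewrite (_ : N E = (fun om => (\1_G om)%:E * jump_count (fun s => sigma s om) a b `]h, +oo[)%E); last exact/funext.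
    by apply: emeasurable_funM => //; apply/measurable_EFinP; exact: measurable_indic.
  split => //.
  rewrite (eq_integral (((fun om => jump_count (fun s => sigma s om) a b `]h, +oo[)) \_ G)); last first.
    move=> om _; rewrite NE indicE patchE; case: (om \in G); rewrite ?mul1e ?mul0e//.
  rewrite -integral_mkcond Hjc//.
  rewrite /m2 [RHS]integral_mkcond /mu.
  have mgE : measurable_fun [set: R * T] (g \_ E).
    by apply/(measurable_restrictT _ mE); exact: mg.
  have gE0 p : (0 <= (g \_ E) p)%E by apply: erestrict_ge0 => ? _.
  have H2 := @fubini_tonelli2 _ _ _ _ R lebesgue_measure P _ mgE gE0.
  transitivity (\int[P]_om fubini_G lebesgue_measure (g \_ E) om)%E; last by symmetry; exact: H2.
  rewrite integral_mkcond; apply: eq_integral => om _; rewrite /fubini_G patchE.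
  case: ifPn => [|/negP]; rewrite in_setE => Gom.
    rewrite [LHS]integral_mkcond; apply: eq_integral => w _; rewrite !patchE.
    have -> : (w \in `]a, b]%classic) = (a < w <= b).
      by apply/idP/idP => [/set_mem|h']; [|apply/mem_set]; rewrite /= in_itv.
    rewrite abE; have [wy|wy] := boolP (0 < w <= y); last first.
      rewrite andbF; case: ifP => // _; rewrite /g indicE memNset ?mul0e// /S0/= in_itv/=.
      by move=> [wy' _]; rewrite wy' in wy.
    rewrite andbT; have -> : ((w, om) \in E) = (u < w <= u').
      by apply/idP/idP => [/set_mem h'|h']; [have [] := (EE w om wy).1 h'|apply/mem_set/(EE w om wy)].
    case: ifP => // _; rewrite /g indicE mem_set ?mul1e /v/= ?clE//.
  apply/esym/integral0_eq => w _; rewrite patchE; case: ifPn => // /set_mem h'.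
  rewrite /g indicE; have [wy|wy] := boolP (0 < w <= y).
    by have [_ /Gom] := (EE w om wy).1 h'.
  by rewrite memNset ?mul0e// /S0/= in_itv/= => -[wy' _]; rewrite wy' in wy.
have HT : H setT.
  apply: (Hrect setT (-1) y setT) => //.
    exact: (@measurableT _ (g_sigma_algebraType [set A | exists2 w, `[0, +oo[%classic w &
         exists2 C : set R, measurable C & A = B w @^-1` C])).
  by move=> w om /andP[w0 wy]; split => // _; split => //; rewrite wy andbT; apply: lt_trans w0.
have m2C E : measurable E -> m2 setT = (m2 E + m2 (~` E))%E.
  move=> mE; have mEC := measurableC mE.
  have dE : [disjoint E & ~` E] by rewrite disj_set2E setICr.
  rewrite -(setUv E) /m2.
  by apply: ge0_integral_setU => //; exact: mg.
have NC E om : N setT om = (N E om + N (~` E) om)%E.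
  rewrite /N -measureU//; last first.
    by apply/seteqP; split => // w /= [[_ h1] [_ h2]].
  congr counting; apply/seteqP; split => w /=; last by tauto.
  by have [] := pselect (E (w, om)); tauto.
have dH : dynkin H.
  split => //.
  - move=> E [mE mN NE]; have mCE := measurableC mE; split => //.
      rewrite (_ : N (~` E) = (fun om => N setT om - N E om)%E).
        by apply: emeasurable_funB => //; have [] := HT.
      by apply/funext => om; rewrite (NC E om) [X in (X - _)%E]addeC addeK.
    have [_ _ NT] := HT.
    have mNC : measurable_fun [set: T] (N (~` E)).
      rewrite (_ : N (~` E) = (fun om => N setT om - N E om)%E).
        by apply: emeasurable_funB => //; have [] := HT.
      by apply/funext => om; rewrite (NC E om) [X in (X - _)%E]addeC addeK.
    move: NT; rewrite (m2C _ mE) (eq_integral (fun om => N E om + N (~` E) om)%E); last first.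
      by move=> om _; exact: NC.
    rewrite ge0_integralD// NE => /eqP; rewrite eq_le => /andP[h1 h2].
    have m2f := m2fin _ mE.
    by apply/eqP; rewrite eq_le; move: h1 h2; rewrite !leeD2lE// => -> ->.
  - move=> F tF HF.
    have mF n : measurable (F n) by have [] := HF n.
    have mU : measurable (\bigcup_n F n) by exact: bigcupT_measurable.
    have NU om : N (\bigcup_n F n) om = (\sum_(n <oo) N (F n) om)%E.
      rewrite /N -measure_semi_bigcup//.
      + congr counting; apply/seteqP; split => w /=.
          by move=> [Jw [n _ Fn]]; exists n.
        by move=> [n _ [Jw Fn]]; split => //; exists n.
      + apply/trivIsetP => i j _ _ ij; apply/seteqP; split => w //= [[_ h1] [_ h2]].
        by move/trivIsetP : tF => /(_ i j Logic.I Logic.I ij)/seteqP[/(_ (w, om)) h3 _]; exact: h3.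
      + by apply: bigcupT_measurable => n.
    have mNF n : measurable_fun [set: T] (N (F n)) by have [] := HF n.
    split => //.
      rewrite (_ : N _ = (fun om => \sum_(n <oo) N (F n) om)%E); last exact/funext.
      exact: ge0_emeasurable_sum.
    rewrite (eq_integral (fun om => \sum_(n <oo) N (F n) om)%E); last by move=> om _.
    rewrite integral_nneseries// /m2 ge0_integral_bigcup//; last exact: mg.
    by apply: eq_eseriesr => n _; have [] := HF n.
(* The sample space is given sigma(B) instead of its full sigma-algebra, because the intensity
   formula can only be tested on events of sigma(B). *)
have Hocc : H (occ_graph (fun w om => B w om) 0 y D).
  pose G0 := [set A | exists2 w, `[0, +oo[%classic w &
         exists2 C : set R, measurable C & A = B w @^-1` C].
  pose T' := g_sigma_algebraType G0.
  have mB w : 0 <= w <= y -> measurable_fun [set: T'] (B w : T' -> R).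
    move=> /andP[w0 _] _ C mC; rewrite setTI; apply: sub_sigma_algebra.
    by exists w; [rewrite /= in_itv/= w0|exists C].
  have mS : measurable (occ_graph (fun w (om : T') => B w om) 0 y D).
    by apply: measurable_occ_graph => //; exact: bm_continuous HB.
  move: (prod_sigma_algebra_rect mS); apply: setI_closed_dynkin_sub; last 1 first.
  - move=> _ [u [u' [G [mG ->]]]]; apply: (Hrect _ u u' G) => //.
      apply: measurableX; first exact: measurable_itv.
      exact: (path_sigma_algebra_measurable mG).
  - move=> _ _ [u [u' [G [mG ->]]]] [u2 [u2' [G2 [mG2 ->]]]].
    exists (Num.max u u2), (Num.min u' u2'), (G `&` G2); split.
      exact: path_sigma_algebraI.
    apply/seteqP; split => -[w om] /=; rewrite !in_itv/= gt_max le_min.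
      by move=> [[/andP[-> ->] ?] [/andP[-> ->] ?]].
    by move=> [/andP[/andP[-> ->] /andP[-> ->]] []].
  - exact: dH.
have [mE mN NE] := Hocc.
have NEE : (fun om => counting (J om `&` [set w | D (B w om)]) : \bar R) =
    N (occ_graph (fun w om => B w om) 0 y D).
  apply/funext => om; rewrite /N; congr counting; apply/seteqP; split => w /=.
    by move=> [Jw Dw]; split => //; rewrite /occ_graph/=; have [/andP[/ltW -> ->] _] := Jw.
  by move=> [Jw [_ Dw]].
rewrite NEE; split => //; rewrite NE.
apply: (@le_trans _ _ (\int[mu]_(p in occ_graph (fun w om => B w om) 0%R y D) (cst c%:E p))%E).
  apply: ge0_le_integral => //.
  - exact: mg.
  - move=> [w om] [/= wy Dw]; rewrite /g indicE.
    have [wS|wS] := pselect (S0 (w, om)); last by rewrite memNset// mul0e lee_fin.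
    rewrite mem_set// mul1e /v/= clE; first exact: Dc.
    by move: wS; rewrite /S0/= in_itv/= => -[].
rewrite integral_cst//; apply: lee_wpmul2l; first by rewrite lee_fin.
rewrite /mu /product_measure1/= [leRHS]integral_mkcond.
rewrite le_eqVlt; apply/orP; left; apply/eqP; apply: eq_integral => w _.
rewrite /= xsectionE patchE; case: ifPn => [|/negP]; rewrite in_setE/= in_itv/= => wab.
  by congr (P _); apply/seteqP; split => om; rewrite /occ_graph/= wab; [case|move=> ?; split].
rewrite (_ : _ @^-1` _ = set0) ?measure0//.
by apply/seteqP; split => // om; rewrite /occ_graph/= => -[].
Qed.

(** One term is enough. Take the least k with s > H / 2^(k+1): either k = 0 and its weight is 1, or
    s <= H / 2^k and its weight 2^(- k) is at least s / H. *)
Lemma min_le_dyadic_series (R : realType) (H s : R) : 0 < H -> 0 <= s ->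
  ((Num.min (s / H) 1)%:E <=
    \sum_(k <oo) ((2 ^+ k)^-1 * (H / 2 ^+ k.+1 < s)%R%:R)%:E)%E.
Proof.
move=> H0; rewrite le_eqVlt => /orP[/eqP <-|s0].
  rewrite mul0r min_l//; apply: nneseries_ge0 => k _ _.
  by rewrite lee_fin mulr_ge0 ?invr_ge0 ?exprn_ge0.
have sH0 : 0 < s / H by rewrite divr_gt0.
have : exists k, H / 2 ^+ k.+1 < s.
  exists (Num.bound (H / s)).
  rewrite ltr_pdivrMr ?exprn_gt0// mulrC -ltr_pdivrMr//.
  apply: (@lt_trans _ _ (Num.bound (H / s))%:R).
    by apply: archi_boundP; rewrite divr_ge0 ?ltW.
  by rewrite -natrX ltr_nat; apply: (ltn_trans (ltnSn _)); exact: ltn_expl.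
move=> /ex_minnP[k Hk kmin].
apply: (@le_trans _ _ ((2 ^+ k)^-1 * (H / 2 ^+ k.+1 < s)%R%:R)%:E).
  rewrite lee_fin Hk mulr1; case: k Hk kmin => [|k] Hk kmin.
    by rewrite expr0 invr1 ge_min lexx orbT.
  rewrite ge_min; apply/orP; left; rewrite ler_pdivrMr// mulrC leNgt.
  by apply/negP => /kmin; rewrite ltnn.
have f0 i : (0 <= ((2 ^+ i)^-1 * (H / 2 ^+ i.+1 < s)%R%:R)%:E :> \bar R)%E.
  by rewrite lee_fin mulr_ge0 ?invr_ge0 ?exprn_ge0.
apply: (@le_trans _ _ (\sum_(0 <= i < k.+1) ((2 ^+ i)^-1 * (H / 2 ^+ i.+1 < s)%R%:R)%:E)%E).
  by rewrite big_nat_recr//= leeDr// sume_ge0.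
by apply: nneseries_lim_ge => i _ _; exact: f0.
Qed.

(** The jumps are indexed by their times without any enumeration, as a supremum of finite sums.
    Measurability in om is not part of this, so tails are bounded through a measurable superset. *)
Definition jump_mass (R : realType) (f b : R -> R) (y : R) (D : set R) : \bar R :=
  (\esum_(w in [set w | (0 < w <= y)%R /\ D (b w)]) (jump f w)%:E)%E.

(** This replaces the mass by counts of large jumps, whose means are finite. On a finite set of
    jumps of total size above H, the truncated sizes min (jump / H, 1) already add up to at least
    1. *)
Lemma jump_mass_count (R : realType) (f b : R -> R) (y H : R) (D : set R) :
  (forall s t, 0 <= s -> s < t -> f s < f t) -> pure_jump f -> 0 <= y -> 0 < H ->
  (H%:E < jump_mass f b y D)%E ->
  (1 <= \sum_(k <oo) ((2 ^+ k)^-1%:E *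
     (counting (big_jumps f y (H / 2 ^+ k.+1) `&` [set w | D (b w)]) : \bar R)))%E.
Proof.
move=> finc pj y0 H0 /ereal_sup_gt[_ [X [fX XS] <-]] HX.
set F := fset_set X.
have FX w : (w \in F) = (w \in X) by rewrite in_fset_set.
have FS w : w \in F -> 0 < w <= y /\ D (b w) by rewrite FX => /set_mem /XS.
have j0 w : w \in F -> 0 <= jump f w.
  by move=> /FS[/andP[w0 _] _]; exact: jump_ge0.
rewrite fsbig_finite//= -/F sumEFin lte_fin in HX.
apply: (@le_trans _ _ (\sum_(w <- F) (Num.min (jump f w / H) 1)%:E)%E).
  rewrite sumEFin lee_fin.
  (* A single jump above H contributes 1 on its own; without such a jump nothing is truncated and
     the sum is the total size divided by H. *)
  have [[w wF jw]|noj] := pselect (exists2 w, w \in F & H < jump f w).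
    rewrite (big_rem w)//= min_r; last by rewrite ler_pdivlMr// mul1r ltW.
    rewrite lerDl big_seq; apply: sumr_ge0 => z /mem_rem zF.
    by rewrite le_min ler01 andbT divr_ge0 ?j0// ltW.
  rewrite big_seq (eq_bigr (fun w => jump f w / H)); last first.
    move=> w wF; rewrite min_l// ler_pdivrMr// mul1r leNgt; apply/negP => jw.
    by apply: noj; exists w.
  by rewrite -big_seq -mulr_suml ler_pdivlMr// mul1r ltW.
apply: (@le_trans _ _ (\sum_(w <- F) \sum_(k <oo) ((2 ^+ k)^-1 * (H / 2 ^+ k.+1 < jump f w)%R%:R)%:E)%E).
  rewrite !big_seq; apply: lee_sum => w wF.
  by apply: min_le_dyadic_series => //; exact: j0.
rewrite -nneseries_sum; last first.
  by move=> w k _; rewrite lee_fin mulr_ge0 ?invr_ge0 ?exprn_ge0.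
apply: lee_nneseries => k _.
  by move=> _; apply: sume_ge0 => w _; rewrite lee_fin mulr_ge0 ?invr_ge0 ?exprn_ge0.
rewrite sumEFin -mulr_sumr EFinM; apply: lee_wpmul2l.
  by rewrite lee_fin invr_ge0 exprn_ge0.
pose h := H / 2 ^+ k.+1.
have h0 : 0 < h by rewrite divr_gt0// exprn_gt0.
have fB : finite_set (big_jumps f y h `&` [set w | D (b w)]).
  by apply: finite_setIl; exact: finite_big_jumps.
pose F' := [fset w in F | h < jump f w]%fset.
apply: (@le_trans _ _ (counting [set` F'] : \bar R)).
  rewrite /counting asboolT; last exact: finite_fset.
  rewrite set_fsetK lee_fin -natr_sum ler_nat -sum1_size big_fset/= [leqRHS]big_mkcond/=.
  by apply: leq_sum => w _; rewrite -/h; case: ifP.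
have mF' : measurable ([set` F'] : set R).
  by apply: finite_set_measurable; exact: finite_fset.
have mB : measurable (big_jumps f y h `&` [set w | D (b w)]) by exact: finite_set_measurable.
apply: le_measure; [exact/mem_set|exact/mem_set|].
move=> w /=; rewrite !inE/= => /andP[wF jw].
by have [wy Dw] := FS w wF; split => //; split.
Qed.

(** Markov's inequality for the dyadic series. Lowering the level to H / 2^(k+1) multiplies the jump
    rate by at most 2^((k+1) amax) against the weight 2^(- k), so the series converges because amax
    < 1. *)
Lemma jump_mass_tail d (T : measurableType d) (R : realType)
  (P : probability T R) (B sigma : R -> {RV P >-> R}) (HB : brownian_motion B)
  (alpha : R -> R) (malpha : measurable_fun [set: R] alpha)
  (alpha01 : forall x, 0 < alpha x < 1) (Hs : multistable_subordinator alpha B sigma)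
  (amax a y H I : R) (D : set R) :
  (forall x, alpha x <= amax) -> amax < 1 -> (forall x, D x -> a <= alpha x) ->
  measurable D -> 0 <= y -> 1 <= H -> 0 <= I ->
  (\int[lebesgue_measure]_(w in `[0%R, y]) P (B w @^-1` D) <= I%:E)%E ->
  exists U, [/\ measurable U,
    [set om | (H%:E < jump_mass (fun s => sigma s om) (fun w => B w om) y D)%E] `<=` U &
    (P U <= (2 * expR 1 / (1 - 2 `^ (amax - 1)) * (H `^ (- a) * I))%:E)%E].
Proof.
move=> Aamax amax1 Da mD y0 H1 I0 HI.
have H0 : 0 < H by lra.
have amax0 : 0 < amax by have /andP[h _] := alpha01 0; apply: lt_le_trans h (Aamax 0).
pose h k := H / 2 ^+ k.+1.
have p2 k : 0 < 2 ^+ k :> R by rewrite exprn_gt0.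
have h0 k : 0 < h k by rewrite divr_gt0.
pose N k om := counting (big_jumps (fun s => sigma s om) y (h k) `&` [set w | D (B w om)]) : \bar R.
(* Bounds (H / 2^(k+1))^(- alpha) on D: the index is replaced by a in the power of H and by amax in
   the power of 2^(k+1), as both bases are at least 1. *)
pose c k := expR 1 * ((2 ^+ k.+1) `^ amax * H `^ (- a)).
have c0 k : 0 <= c k by rewrite mulr_ge0 ?expR_ge0// mulr_ge0// powR_ge0.
have Hc k x : D x -> (stable_levy (alpha x) `]h k, +oo[ <= (c k)%:E)%E.
  move=> Dx; apply: (le_trans (stable_levy_tail_le (alpha01 x) (h0 k))).
  have /andP[ax0 ax1] := alpha01 x.
  have pV0 : 0 <= (2 ^+ k.+1)^-1 :> R by rewrite invr_ge0 ltW.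
  rewrite lee_fin /c ler_pM2l ?expR_gt0// /h (powRM _ (ltW H0) pV0) [leLHS]mulrC.
  apply: ler_pM; rewrite ?powR_ge0//.
    rewrite -(powR_inv1 (ltW (p2 k.+1))) -powRrM mulrNN mul1r.
    by apply: ler_powR => //; rewrite exprn_ege1// ler1n.
  by apply: ler_powR => //; rewrite lerN2; exact: Da.
have HN k := campbell HB malpha alpha01 Hs y0 (h0 k) (c0 k) mD (Hc k).
pose X om := (\sum_(k <oo) ((2 ^+ k)^-1%:E * N k om))%E.
have N0 k om : (0 <= N k om)%E by exact: counting_ge0.
have q0 k : 0 <= (2 ^+ k)^-1 :> R by rewrite invr_ge0 ltW.
have mN k : measurable_fun [set: T] (N k) by have [] := HN k.
have mcN k : measurable_fun [set: T] (fun om => (2 ^+ k)^-1%:E * N k om)%E.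
  exact: measurable_funeM.
have cN0 k om : (0 <= (2 ^+ k)^-1%:E * N k om)%E by rewrite mule_ge0.
have mX : measurable_fun [set: T] X by apply: ge0_emeasurable_sum.
exists [set om | (1 <= X om)%E]; split.
- by rewrite -[X in measurable X]setTI; exact: emeasurable_fun_c_infty.
- move=> om Hom; apply: jump_mass_count => //; [exact: (ms_increasing Hs)|exact: (ms_pure_jump Hs)].
- have mU : measurable [set om | (1 <= X om)%E].
    by rewrite -[X in measurable X]setTI; exact: emeasurable_fun_c_infty.
  have X0 om : (0 <= X om)%E by apply: nneseries_ge0 => k _ _.
  apply: (@le_trans _ _ (\int[P]_om X om)%E).
    rewrite -[leLHS]mul1e -integral_cst// integral_mkcond.
    apply: ge0_le_integral => //.
    + by move=> om _; apply: erestrict_ge0.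
    + by apply/(measurable_restrictT _ mU); exact: measurable_cst.
    + by move=> om _; rewrite patchE; case: ifPn => // /set_mem.
  rewrite integral_nneseries//.
  apply: lime_le.
    apply: is_cvg_nneseries => k _ _; exact: integral_ge0.
  apply: nearW => n.
  pose rho := 2 `^ (amax - 1) : R.
  have rho0 : 0 < rho by rewrite powR_gt0.
  have rho1 : rho < 1.
    rewrite /rho -[ltRHS](powRr0 2) /powR gt_eqF// mul0r expR0 -[ltRHS]expR0 ltr_expR.
    by rewrite nmulr_rlt0 ?ln_gt0 ?ltr1n//; lra.
  have term k : (\int[P]_om ((2 ^+ k)^-1%:E * N k om) <=
      (2 * expR 1 * (H `^ (- a) * I) * rho ^+ k)%:E)%E.
    rewrite ge0_integralZl//.
    have [_ h1] := HN k.
    apply: (@le_trans _ _ ((2 ^+ k)^-1%:E * ((c k)%:E * I%:E))%E).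
      apply: lee_wpmul2l; first by rewrite lee_fin.
      apply: (le_trans h1); apply: lee_wpmul2l => //; by rewrite lee_fin.
    rewrite -!EFinM lee_fin /c.
    have -> : (2 ^+ k)^-1 * (expR 1 * ((2 ^+ k.+1) `^ amax * H `^ (- a)) * I) =
       (2 `^ amax * rho ^+ k) * (expR 1 * (H `^ (- a) * I)).
      have -> : (2 ^+ k.+1) `^ amax = 2 `^ amax * (2 `^ amax) ^+ k :> R.
        rewrite -exprS -[RHS]powR_mulrn ?powR_ge0//.
        by rewrite -(powR_mulrn k.+1 (ler0n R 2)) -!powRrM mulrC.
      have -> : rho ^+ k = (2 `^ amax) ^+ k * (2 ^+ k)^-1.
        by rewrite /rho powRB ?powRr1// ?expr_div_n//; apply/implyP.
      ring.
    have -> : 2 * expR 1 * (H `^ (- a) * I) * rho ^+ k = (2 * rho ^+ k) * (expR 1 * (H `^ (- a) * I)) by ring.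
    apply: ler_wpM2r; first by rewrite !mulr_ge0 ?expR_ge0 ?powR_ge0.
    apply: ler_wpM2r; first by rewrite exprn_ge0// ltW.
    by rewrite -[leRHS](powRr1) ?ler_powR//; rewrite ?ler1n// ltW.
  apply: (@le_trans _ _ (\sum_(0 <= k < n) (2 * expR 1 * (H `^ (- a) * I) * rho ^+ k)%:E)%E).
    by apply: lee_sum => k _; exact: term.
  rewrite sumEFin lee_fin.
  pose C := 2 * expR 1 * (H `^ (- a) * I).
  have C0 : 0 <= C by rewrite !mulr_ge0 ?expR_ge0 ?powR_ge0.
  have -> : \sum_(0 <= i < n) 2 * expR 1 * (H `^ (- a) * I) * rho ^+ i = C * (1 - rho ^+ n) / (1 - rho).
    have q1' : 1 - rho != 0 by rewrite subr_eq0 eq_sym lt_eqF.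
    elim: n => [|n IH]; first by rewrite big_nil expr0 subrr mulr0 mul0r.
    by rewrite big_nat_recr//= IH exprS -/C; field.
  have -> : 2 * expR 1 / (1 - 2 `^ (amax - 1)) * (H `^ (- a) * I) = C / (1 - rho).
    by rewrite /C /rho; ring.
  rewrite ler_pM2r ?invr_gt0 ?subr_gt0// ler_piMr// gerBl exprn_ge0// ltW//.
Qed.

(** With level Y^g and expected occupation C Y^rho, the tail is of order Y^(rho - g a), a negative
    power, hence at most geometric in j along Y = 2^(n j^2). *)
Lemma jump_mass_upper_as d (T : measurableType d) (R : realType)
  (P : probability T R) (B sigma : R -> {RV P >-> R}) (HB : brownian_motion B)
  (alpha : R -> R) (malpha : measurable_fun [set: R] alpha)
  (alpha01 : forall x, 0 < alpha x < 1) (Hs : multistable_subordinator alpha B sigma)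
  (n : nat) (amax a rho C g : R) (D : set R) :
  (forall x, alpha x <= amax) -> amax < 1 -> (forall x, D x -> a <= alpha x) ->
  measurable D -> 0 <= C -> 0 <= g -> rho < g * a -> (0 < n)%N ->
  (forall y, 1 <= y ->
    (\int[lebesgue_measure]_(w in `[0%R, y]) P (B w @^-1` D) <= (C * y `^ rho)%:E)%E) ->
  \forall om \ae P, exists J, forall j, (J <= j)%N ->
    (jump_mass (fun s => sigma s om) (fun w => B w om) (scale R n j) D <=
      (scale R n j `^ g)%:E)%E.
Proof.
move=> Aamax amax1 Da mD C0 g0 rga n0 HC.
pose Y j := scale R n j.
have Y1 j : 1 <= Y j by exact: scale_ge1.
have Y0 j : 0 <= Y j by apply: le_trans (Y1 j).
have H1 j : 1 <= Y j `^ g by rewrite -(powRr0 (Y j)); apply: ler_powR.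
have I0 j : 0 <= C * Y j `^ rho by rewrite mulr_ge0// powR_ge0.
have U_ j := jump_mass_tail HB malpha alpha01 Hs Aamax amax1 Da mD (Y0 j) (H1 j) (I0 j) (HC _ (Y1 j)).
pose U j := sval (cid (U_ j)).
have UP j := svalP (cid (U_ j)).
pose K := 2 * expR 1 / (1 - 2 `^ (amax - 1)) * C : R.
pose q := 2 `^ (- (n%:R * (g * a - rho))) : R.
have e0 : 0 < n%:R * (g * a - rho) by rewrite mulr_gt0 ?ltr0n// subr_gt0.
have q01 : 0 < q < 1.
  rewrite powR_gt0//= /q /powR gt_eqF// -[ltRHS]expR0 ltr_expR.
  by rewrite nmulr_rlt0 ?ln_gt0 ?ltr1n// oppr_lt0.
have K0 : 0 <= K.
  rewrite mulr_ge0// divr_ge0 ?mulr_ge0 ?expR_ge0// subr_ge0.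
  by rewrite -[leRHS](powRr0 2); apply: ler_powR; [rewrite ler1n|lra].
have mU j : measurable (U j) by have [] := UP j.
have PU j : (0 <= j)%N -> (P (U j) <= (K * q ^+ j)%:E)%E.
  move=> _; have [_ _ h] := UP j; apply: (le_trans h); rewrite lee_fin.
  rewrite /K -[leRHS]mulrA; apply: ler_wpM2l.
    rewrite divr_ge0 ?mulr_ge0 ?expR_ge0// subr_ge0.
    by rewrite -[leRHS](powRr0 2); apply: ler_powR; [rewrite ler1n|lra].
  rewrite [leLHS]mulrCA; apply: ler_wpM2l => //.
  rewrite -/(Y j) -powRrM -powRD; last by apply/implyP => _; rewrite gt_eqF//; apply: lt_le_trans (Y1 j).
  have -> : q ^+ j = 2 `^ (- (n%:R * (g * a - rho)) * j%:R).
    by rewrite /q -[LHS]powR_mulrn ?powR_ge0// -powRrM.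
  rewrite /Y scale_powR; apply: ler_powR; first by rewrite ler1n.
  rewrite (_ : n%:R * (g * - a + rho) * _ = - (n%:R * (g * a - rho) * j%:R ^+ 2)); last by ring.
  rewrite mulNr lerN2 ler_pM2l// -natrX ler_nat.
  by case: j {h} => // j; rewrite expnS expn1 leq_pmulr.
apply: filterS (geometric_borel_cantelli mU K0 q01 PU) => om [J HJ].
exists J => j Jj; rewrite leNgt; apply/negP => h.
by apply: (HJ j Jj); have [_ sub _] := UP j; exact: sub.
Qed.

Lemma expected_occ_bounded d (T : measurableType d) (R : realType)
  (P : probability T R) (B : R -> {RV P >-> R}) (HB : brownian_motion B)
  (D : set R) (a0 y : R) : measurable D -> lebesgue_measure D = a0%:E -> 0 <= a0 -> 0 < y ->
  (\int[lebesgue_measure]_(w in `[0%R, y]) P (B w @^-1` D) <=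
    (4 * (gauss_peak R * a0) * y `^ 2^-1)%:E)%E.
Proof.
move=> mD Da0 a00 y0.
have mpo : measurable_fun `[0, y] (fun w => P (B w @^-1` D)).
  rewrite (_ : (fun w => _) = (fun w => P ([set: T] `&` B w @^-1` D))).
    exact: (measurable_pre_occ HB).
  by apply/funext => w; rewrite setTI.
have k0 : 0 <= gauss_peak R * a0 by rewrite mulr_ge0// ltW// gauss_peak_gt0.
rewrite -(@integral_setD1 _ _ 0); last 2 first.
- by apply: measurableD => //; exact: measurable_itv.
- by apply: measurable_funS mpo => // x [].
have mg D' : measurable_fun D' (fun w : R =>
    ((gauss_peak R * a0)%:E * ((Num.sqrt `|w - 0|)^-1)%:E)%E).
  by apply: measurable_funTS; apply: measurable_funeM; exact: measurable_inv_sqrt_dist.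
apply: (@le_trans _ _ (\int[lebesgue_measure]_(w in `[0%R, y])
    ((gauss_peak R * a0)%:E * ((Num.sqrt `|w - 0|)^-1)%:E))%E).
  apply: (@le_trans _ _ (\int[lebesgue_measure]_(w in `[0%R, y] `\ 0%R)
    ((gauss_peak R * a0)%:E * ((Num.sqrt `|w - 0|)^-1)%:E))%E); last first.
    apply: ge0_subset_integral => //.
    - by apply: measurableD => //; exact: measurable_itv.
    - exact: mg.
    - by move=> w _; rewrite mule_ge0// lee_fin.
  apply: ge0_le_integral => //.
  - by apply: measurableD => //; exact: measurable_itv.
  - by apply: measurable_funS mpo => // x [].
  - exact: mg.
  - move=> w [/=]; rewrite in_itv/= => /andP[w0 wy] /eqP wn0.
    have w0' : 0 < w by rewrite lt_neqAle eq_sym wn0.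
    have FT : path_sigma_algebra B `[0, 0] [set: T].
      exact: (@measurableT _ (g_sigma_algebraType [set A | exists2 w, `[0, 0]%classic w &
         exists2 C : set R, measurable C & A = B w @^-1` C])).
    have := brownian_markov_ub HB (lexx 0) w0' FT mD.
    rewrite setTI probability_setT mul1e !subr0 (gtr0_norm w0') => h.
    by apply: (le_trans h); rewrite Da0 -!EFinM lee_fin mulrAC.
have mi : measurable_fun `[0, y] (fun w : R => ((Num.sqrt `|w - 0|)^-1)%:E).
  by apply: measurable_funTS; exact: measurable_inv_sqrt_dist.
rewrite ge0_integralZl//.
have wy : (0 : R) <= (0 : R) <= y by apply/andP; split; [exact: lexx|exact: ltW].
rewrite (powR12_sqrt (ltW y0)).
apply: (@le_trans _ _ ((gauss_peak R * a0)%:E * (4 * Num.sqrt (y - 0))%:E)%E).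
  by apply: lee_wpmul2l; [rewrite lee_fin|exact: integral_inv_sqrt_dist].
by rewrite subr0 -EFinM lee_fin le_eqVlt; apply/orP; left; apply/eqP; ring.
Qed.

(** Stated in the shape C y^rho, with C = rho = 1, that [jump_mass_upper_as] expects. *)
Lemma expected_occ_le d (T : measurableType d) (R : realType)
  (P : probability T R) (B : R -> {RV P >-> R}) (HB : brownian_motion B)
  (D : set R) (y : R) : measurable D -> 0 < y ->
  (\int[lebesgue_measure]_(w in `[0%R, y]) P (B w @^-1` D) <= (1 * y `^ 1)%:E)%E.
Proof.
move=> mD y0.
apply: (@le_trans _ _ (\int[lebesgue_measure]_(w in `[0%R, y]) (cst 1 w))%E).
  apply: ge0_le_integral => //.
  - rewrite (_ : (fun w => _) = (fun w => P ([set: T] `&` B w @^-1` D))).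
      exact: (measurable_pre_occ HB).
    by apply/funext => w; rewrite setTI.
  - move=> w _; apply: probability_le1.
    by rewrite -[X in measurable X]setTI; exact: measurable_funP.
rewrite integral_cst//= mul1e lebesgue_measure_itv/= lte_fin y0 sube0.
by rewrite mul1r powRr1// ltW.
Qed.

(** * Time change *)

(** Unboundedness of f keeps the sets under [inf] nonempty, so no default value enters. The last
    property is the plateau at w created by a jump at w. *)
Lemma right_inverse_props (R : realType) (f : R -> R) :
  (forall s t, 0 <= s -> s < t -> f s < f t) ->
  (forall t, exists y, 0 <= y /\ t < f y) ->
  [/\ forall s, 0 <= right_inverse f s,
      forall s s', s <= s' -> right_inverse f s <= right_inverse f s' &
      forall w s, 0 < w -> lim (f x @[x --> w^'-]) <= s < f w -> right_inverse f s = w].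
Proof.
move=> finc funb.
have ne s : [set x | 0 <= x /\ s < f x] !=set0.
  by have [y Hy] := funb s; exists y.
have lb s : has_lbound [set x | 0 <= x /\ s < f x].
  by exists 0 => x [].
split.
- by move=> s; apply: lb_le_inf => // x [].
- move=> s s' ss; apply: lb_le_inf => // x [x0 fx]; apply: ge_inf => //.
  by split => //; apply: le_lt_trans fx.
- move=> w s w0 /andP[h1 h2]; apply/eqP; rewrite eq_le; apply/andP; split.
    by apply: ge_inf => //; split => //; exact: ltW.
  apply: lb_le_inf => // x [x0 fx]; rewrite leNgt; apply/negP => xw.
  have [h3 _] := left_limit_bounds finc w0.
  by have := lt_le_trans fx (le_trans (h3 x x0 xw) h1); rewrite ltxx.
Qed.

Lemma jump_mass_setC (R : realType) (f b : R -> R) (y : R) (D : set R) :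
  (forall s t, 0 <= s -> s < t -> f s < f t) -> pure_jump f -> 0 <= y ->
  ((f y - f 0)%:E = jump_mass f b y D + jump_mass f b y (~` D))%E.
Proof.
move=> finc pj y0; rewrite pj// (esumID (b @^-1` D)); last first.
  by move=> w [/andP[w0 _]]; rewrite lee_fin; exact: jump_ge0.
by congr (_ + _)%E.
Qed.

Lemma measurable_time_changed (R : realType) (f b : R -> R) (D : set R) :
  (forall s t, 0 <= s -> s < t -> f s < f t) ->
  (forall t, exists y, 0 <= y /\ t < f y) ->
  {within `[0, +oo[, continuous b} -> measurable D ->
  measurable [set s | D (b (right_inverse f s))].
Proof.
move=> finc funb cb mD; have [L0 Lnd _] := right_inverse_props finc funb.
have mL : measurable_fun [set: R] (right_inverse f).
  by apply: nondecreasing_measurable => // s s' _ _; exact: Lnd.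
have cb' : continuous (b \o Num.max 0).
  apply: continuous_comp_within => //.
    by move=> x; apply: continuous_max; [exact: cvg_cst|exact: cvg_id].
  by move=> x; rewrite le_max lexx.
have := measurableT_comp (continuous_measurable_fun cb') mL.
move=> /(_ measurableT D mD); rewrite setTI; congr measurable.
by apply/seteqP; split => s /=; rewrite max_r.
Qed.

(** Each jump time w in D owns the interval [f(w-), f(w)[, of length the jump, on which the
    time-changed path sits at b w. These intervals are disjoint and lie below f Y. *)
Lemma jump_mass_le_occupation (R : realType) (f b : R -> R) (Y : R) (D : set R) :
  (forall s t, 0 <= s -> s < t -> f s < f t) ->
  (forall t, exists y, 0 <= y /\ t < f y) -> f 0 = 0 -> 0 <= Y ->
  {within `[0, +oo[, continuous b} -> measurable D ->
  (jump_mass f b Y D <=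
    lebesgue_measure (`[0%R, f Y[ `&` [set s | D (b (right_inverse f s))]))%E.
Proof.
move=> finc funb f0 Y0 cb mD; have [L0 Lnd LE] := right_inverse_props finc funb.
apply: ge_ereal_sup => _ [X [fX XS] <-].
have fnd s t : 0 <= s -> s <= t -> f s <= f t.
  by move=> s0; rewrite le_eqVlt => /orP[/eqP ->//|st]; apply/ltW/finc.
pose l w := lim (f x @[x --> w^'-]).
have lb w : 0 < w -> (forall s, 0 <= s -> s < w -> f s <= l w) /\ l w <= f w.
  exact: left_limit_bounds.
pose I w : set R := `[l w, f w[%classic.
have tI : trivIset X I.
  have disj v w : X v -> X w -> v < w -> I v `&` I w = set0.
    move=> /XS[/andP[v0 _] _] /XS[/andP[w0 _] _] vw.
    apply/seteqP; split => // s [] /andP[_ h1] /andP[h2 _]; rewrite !bnd_simp in h1 h2.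
    have [h3 _] := lb w w0.
    by have := lt_le_trans h1 (le_trans (h3 v (ltW v0) vw) h2); rewrite ltxx.
  apply/trivIsetP => v w Xv Xw; rewrite neq_lt => /orP[vw|vw]; first exact: disj.
  by rewrite setIC; exact: disj.
rewrite [leLHS](_ : _ = lebesgue_measure (\bigcup_(w in X) I w)).
  apply: le_measure.
  - by apply/mem_set; apply: fin_bigcup_measurable => // w _; exact: measurable_itv.
  - apply/mem_set; apply: measurableI; [exact: measurable_itv|exact: (measurable_time_changed finc funb cb mD)].
  - move=> s [w Xw]; rewrite /I => /andP[]; rewrite !bnd_simp => h1 h2.
    have [/andP[w0 wY] Dw] := XS w Xw; have [h3 _] := lb w w0.
    split; last by rewrite /= (LE w)// h1.
    rewrite /= in_itv/=; apply/andP; split; last by apply: lt_le_trans h2 _; apply: fnd => //; exact: ltW.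
    by rewrite -f0; apply: le_trans h1; apply: h3.
rewrite measure_fin_bigcup//; last by move=> w _; exact: measurable_itv.
apply: eq_fsbigr => w /set_mem/XS[/andP[w0 _] _].
have [_ h] := lb w w0.
transitivity (lebesgue_measure (I w)) => //.
rewrite /I lebesgue_measure_itv/= lte_fin /jump -/(l w).
by move: h; rewrite le_eqVlt => /orP[/eqP ->|->]; rewrite ?ltxx ?subrr// EFinB.
Qed.

(** The inequality of [jump_mass_le_occupation], used for A, yields the converse one for its
    complement: since f is pure jump, both the two masses and the two occupation times add up to f
    Y. *)
Lemma occupation_fraction_ge (R : realType) (f b : R -> R) (Y t m : R) (A : set R) :
  (forall s t, 0 <= s -> s < t -> f s < f t) -> pure_jump f ->
  (forall t, exists y, 0 <= y /\ t < f y) -> f 0 = 0 -> 0 <= Y ->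
  {within `[0, +oo[, continuous b} -> measurable A ->
  0 < t -> t < f Y -> (jump_mass f b Y (~` A) <= m%:E)%E ->
  1 - m / t <= occupation_fraction (fun s => b (right_inverse f s)) A t <= 1.
Proof.
move=> finc pj funb f0 Y0 cb mA t0 tY Hm.
pose X s := b (right_inverse f s).
have mXA : measurable (X @^-1` A) by exact: (measurable_time_changed finc funb cb mA).
have mXC : measurable (X @^-1` (~` A)) by exact: measurableC.
have mI : measurable `[0, t]%classic by exact: measurable_itv.
have muI : (lebesgue_measure `[0%R, t] = t%:E)%E.
  by rewrite lebesgue_measure_itv/= lte_fin t0 sube0.
have fin (S : set R) : measurable S -> lebesgue_measure (`[0%R, f Y[ `&` S)%classic \is a fin_num.
  move=> mS; rewrite ge0_fin_numE//; apply: (@le_lt_trans _ _ (lebesgue_measure `[0%R, f Y[)).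
    by apply: le_measure => //; apply/mem_set; [apply: measurableI => //; exact: measurable_itv|exact: measurable_itv].
  by rewrite lebesgue_measure_itv/=; case: ifP => _; rewrite -?EFinB ltry.
have fin' (S : set R) : measurable S -> lebesgue_measure (`[0%R, t] `&` S)%classic \is a fin_num.
  move=> mS; rewrite ge0_fin_numE//; apply: (@le_lt_trans _ _ (lebesgue_measure `[0%R, t])).
    by apply: le_measure => //; apply/mem_set => //; exact: measurableI.
  by rewrite muI ltry.
have fY : ((f Y)%:E = lebesgue_measure (`[0%R, f Y[ `&` X @^-1` A) +
    lebesgue_measure (`[0%R, f Y[ `&` X @^-1` (~` A)))%E.
  rewrite -measureU; last 3 first.
  - by apply: measurableI => //; exact: measurable_itv.
  - by apply: measurableI => //; exact: measurable_itv.
  - by apply/seteqP; split => // s [[_ h1] [_ h2]].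
  rewrite -setIUr -preimage_setU setUCr preimage_setT setIT.
  transitivity (lebesgue_measure `[0%R, f Y[); last by [].
  by rewrite lebesgue_measure_itv/= lte_fin (lt_trans t0 tY) sube0.
have muD : (lebesgue_measure (`[0%R, f Y[ `&` X @^-1` (~` A)) <= m%:E)%E.
  apply: le_trans Hm.
  have := jump_mass_setC b A finc pj Y0; rewrite f0 subr0 fY => e.
  have h := jump_mass_le_occupation finc funb f0 Y0 cb mA.
  have jfin : jump_mass f b Y A \is a fin_num.
    rewrite ge0_fin_numE; first by apply: le_lt_trans h _; rewrite -ge0_fin_numE//; exact: fin.
    apply: esum_ge0 => w [/andP[w0 _] _]; rewrite lee_fin; exact: jump_ge0.
  by rewrite -(leeD2lE _ _ (fin _ mXA)) e; apply: leeD2r; exact: h.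
have muDt : (lebesgue_measure (`[0%R, t] `&` X @^-1` (~` A)) <= m%:E)%E.
  apply: le_trans muD; apply: le_measure.
  - by apply/mem_set; exact: measurableI.
  - by apply/mem_set; apply: measurableI => //; exact: measurable_itv.
  - move=> s [/=]; rewrite !in_itv/= => /andP[-> h1] h2; split => //=.
    by apply: le_lt_trans tY.
have tE : (t%:E = lebesgue_measure (`[0%R, t] `&` X @^-1` A) +
    lebesgue_measure (`[0%R, t] `&` X @^-1` (~` A)))%E.
  rewrite -measureU; last 3 first.
  - exact: measurableI.
  - exact: measurableI.
  - by apply/seteqP; split => // s [[_ h1] [_ h2]].
  by rewrite -setIUr -preimage_setU setUCr preimage_setT setIT -muI.
have occE : \int[lebesgue_measure]_(s in `[0, t]) \1_A (X s) =
    fine (lebesgue_measure (`[0%R, t] `&` X @^-1` A)).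
  rewrite /Rintegral; congr fine.
  by rewrite setIC -integral_indic.
rewrite /occupation_fraction occE.
have [fA fC] := (fin' _ mXA, fin' _ mXC).
move: tE muDt; rewrite -(fineK fA) -(fineK fC) -EFinD lee_fin => -[tE] muDt.
have C0 : 0 <= fine (lebesgue_measure (`[0%R, t] `&` X @^-1` (~` A))%classic) by rewrite fine_ge0.
rewrite /=; set p := fine _ in tE *; set q := fine _ in tE muDt C0.
rewrite -[X in X - _](mulVf (lt0r_neq0 t0)) [m / t]mulrC -mulrBr ler_pM2l ?invr_gt0//.
rewrite -[X in _ && (_ <= X)](mulVf (lt0r_neq0 t0)) ler_pM2l ?invr_gt0//.
by apply/andP; split; lra.
Qed.

Lemma scale_le (R : realType) n i j : (i <= j)%N -> scale R n i <= scale R n j.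
Proof.
move=> ij; rewrite /scale; apply: ler_weXn2l; first by rewrite ler1n.
by rewrite leq_mul2l leq_exp2r// ij orbT.
Qed.

(** The ratio of exponents (j+1)^2 / j^2 tends to 1, so any gap between g and g' survives one step
    of the scale and absorbs constants. *)
Lemma scale_succ_powR_lt (R : realType) (n : nat) (g g' c e : R) :
  (0 < n)%N -> 0 <= g < g' -> 0 <= c -> 0 < e ->
  exists j0, forall j, (j0 <= j)%N ->
    c * scale R n j.+1 `^ g < e * scale R n j `^ g'.
Proof.
move=> n0 /andP[g0 gg'] c0 e0.
have n0' : 0 < n%:R :> R by rewrite ltr0n.
have d0 : 0 < n%:R * ((g' - g) / 2) by rewrite mulr_gt0// divr_gt0// subr_gt0.
have [j1 Hj1] := powR2_eventually_ge (@ltr01 R) d0.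
(* For j >= 6 g / (g' - g), 2 g j + g <= 3 g j <= (g' - g) j^2 / 2, so (j+1)^2 g <= j^2 (g + g') /
   2. The other half of the gap gives 2^x >= j > c / e. *)
exists (maxn j1 (maxn 1 (maxn (Num.bound (6 * g / (g' - g))) (Num.bound (c / e))))) => j.
rewrite !geq_max => /and4P[jj1 j1' jb1 jb2].
have b1 : 6 * g / (g' - g) <= j%:R.
  apply/ltW/(lt_le_trans (archi_boundP _)); last by rewrite ler_nat.
  by rewrite divr_ge0 ?mulr_ge0// subr_ge0 ltW.
have b2 : c / e < j%:R.
  by apply: (lt_le_trans (archi_boundP _)); [rewrite divr_ge0// ltW|rewrite ler_nat].
have j1R : 1 <= j%:R :> R by rewrite ler1n.
have := Hj1 j jj1; rewrite mul1r => Hj.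
rewrite !scale_powR.
set x := n%:R * ((g' - g) / 2) * j%:R ^+ 2 in Hj.
pose z := n%:R * ((g + g') / 2) * j%:R ^+ 2.
apply: (@le_lt_trans _ _ (c * 2 `^ z)).
  apply: ler_wpM2l => //; apply: ler_powR; first by rewrite ler1n.
  rewrite /z -!mulrA ler_pM2l// -natr1.
  rewrite ler_pdivrMr ?subr_gt0// in b1.
  have h : 6 * g * j%:R <= j%:R * (g' - g) * j%:R by apply: ler_wpM2r => //; lra.
  have h1 : g * 1 <= g * j%:R by apply: ler_wpM2l.
  rewrite (_ : g * _ = g * j%:R ^+ 2 + 2 * (g * j%:R) + g); last by ring.
  rewrite (_ : (g + g') * _ = g * j%:R ^+ 2 + 2^-1 * (j%:R * (g' - g) * j%:R)); last by field.
  lra.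
rewrite (_ : _ * g' * _ = x + z); last by rewrite /x/z; field.
rewrite powRD; last by apply/implyP => _; rewrite pnatr_eq0.
rewrite mulrA ltr_pM2r ?powR_gt0// mulrC -ltr_pdivrMr//.
exact: lt_le_trans b2 Hj.
Qed.

(** For f (Y_j) <= t < f (Y_(j+1)), the proportion of time outside A is at most c Y_(j+1)^g /
    Y_j^g', which vanishes by [scale_succ_powR_lt]; this interpolates between the scales. *)
Lemma occupation_fraction_cvg1 (R : realType) (f b : R -> R) (A : set R)
    (n : nat) (g g' c : R) :
  (forall s t, 0 <= s -> s < t -> f s < f t) -> pure_jump f -> f 0 = 0 ->
  {within `[0, +oo[, continuous b} -> measurable A ->
  (0 < n)%N -> 0 <= g < g' -> 0 <= c ->
  (exists J, forall j, (J <= j)%N -> scale R n j `^ g' <= f (scale R n j)) ->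
  (exists J, forall j, (J <= j)%N ->
     (jump_mass f b (scale R n j) (~` A) <= (c * scale R n j `^ g)%:E)%E) ->
  occupation_fraction (fun s => b (right_inverse f s)) A t @[t --> +oo] --> (1 : R).
Proof.
move=> finc pj f0 cb mA n0 gg' c0 [J1 HJ1] [J2 HJ2].
have Y0 j : 0 < scale R n j by apply: lt_le_trans (scale_ge1 _ _ _).
have g'0 : 0 < g' by case/andP: gg' => ? ?; lra.
have nb (t : R) : exists j, t < f (scale R n j).
  have e0 : 0 < n%:R * g' by rewrite mulr_gt0// ltr0n.
  have [j0 Hj0] := powR2_eventually_ge (@ltr01 R) e0.
  have := archi_boundP (normr_ge0 t); set k := Num.bound _ => tk.
  exists (maxn J1 (maxn j0 k)).
  apply: lt_le_trans (HJ1 _ (leq_maxl _ _)); rewrite scale_powR.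
  have := Hj0 (maxn J1 (maxn j0 k)); rewrite mul1r => h.
  apply: (le_lt_trans (ler_norm t)); apply: (lt_le_trans tk); apply: le_trans (h _); last first.
    by rewrite !leq_max leqnn orbT.
  by rewrite ler_nat !leq_max leqnn !orbT.
have funb (t : R) : exists y, 0 <= y /\ t < f y.
  by have [j tj] := nb t; exists (scale R n j); split => //; exact: ltW.
have fnd i j : (i <= j)%N -> f (scale R n i) <= f (scale R n j).
  move=> /(scale_le R n); rewrite le_eqVlt => /orP[/eqP ->//|ij].
  by apply/ltW/finc => //; exact: ltW.
apply/cvgrPdist_lt => e e0.
have [j0 Hj0] := scale_succ_powR_lt n0 gg' c0 e0.
pose j1 := maxn J1 (maxn J2 j0).
exists (f (scale R n j1)); split; first exact: num_real.
move=> t tj1.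
have [k tk kmin] := ex_minnP (nb t).
have jk : (j1 < k)%N.
  rewrite ltnNge; apply/negP => /fnd kj.
  by have := lt_trans tj1 (lt_le_trans tk kj); rewrite ltxx.
case: k tk kmin jk => // j tk kmin jk.
have ft : f (scale R n j) <= t.
  by rewrite leNgt; apply/negP => /kmin; rewrite ltnn.
move: (jk); rewrite ltnS !geq_max => /and3P[jJ1 jJ2 jj0].
have t0 : 0 < t.
  by apply: lt_le_trans ft; rewrite -f0; apply: finc.
have := occupation_fraction_ge finc pj funb f0 (ltW (Y0 j.+1)) cb mA t0 tk
  (HJ2 j.+1 (leqW jJ2)).
move=> /andP[h1 h2].
rewrite ger0_norm ?subr_ge0//.
apply: (@le_lt_trans _ _ (c * scale R n j.+1 `^ g / t)); first by rewrite lerBlDl -lerBlDr.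
rewrite ltr_pdivrMr//; apply: (lt_le_trans (Hj0 j jj0)).
rewrite ler_pM2l//; apply: le_trans ft; exact: HJ1.
Qed.

(** * Choice of exponents and conclusion *)

(** Four equally spaced points of ]u, v[ serve as u', 1/(2g'), 1/(2g), v'. The growth bound needs g'
    u' < 1/2, the jump mass bound 1/2 < g v', and the margins u' - u and v - v' allow alpha to be
    only close to its limits. *)
Lemma exponent_gap (R : realType) (u v : R) : 0 < u -> u < v ->
  exists g g' u' v' : R, [/\ u < u', v' < v, 0 < g < g', 2^-1 < g * v' & g' * u' < 2^-1].
Proof.
move=> u0 uv.
pose p (k : R) := u + k * (v - u) / 5.
exists (2 * p 3)^-1, (2 * p 2)^-1, (p 1), (p 4).
have [p1 p2 p3 p4] : [/\ 0 < p 1, p 1 < p 2, p 2 < p 3 & p 3 < p 4].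
  by rewrite /p; split; lra.
split.
- by rewrite /p; lra.
- by rewrite /p; lra.
- apply/andP; split; first by rewrite invr_gt0 mulr_gt0//; lra.
  by rewrite ltf_pV2 ?posrE; lra.
- by rewrite ltr_pdivlMl; lra.
- by rewrite ltr_pdivrMl; lra.
Qed.

(** The lower bound at time [scale (n + 6)] comes from windows starting at [scale n]. This loses a
    factor (n + 6) / n in the exponent, harmless for large n. *)
Lemma exists_large_scale (R : realType) (u v : R) : 0 < u -> u < v ->
  exists n : nat, (0 < n)%N /\ 0 < n%:R * v - (n + 6)%:R * u.
Proof.
move=> u0 uv.
exists (Num.bound (6 * u / (v - u))).+1; split => //.
have := archi_boundP (_ : 0 <= 6 * u / (v - u)).
rewrite divr_ge0 ?mulr_ge0 ?subr_ge0 ?(ltW u0) ?(ltW uv)// => /(_ isT).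
set k := Num.bound _; rewrite ltr_pdivrMr ?subr_gt0// => h.
by rewrite natrD -natr1; lra.
Qed.

Lemma scale_sqrt_eventually_ge (R : realType) (n : nat) (M : R) : (0 < n)%N ->
  exists j0, forall j, (j0 <= j)%N -> M <= Num.sqrt (scale R n j).
Proof.
move=> n0.
have e0 : 0 < n%:R * 2^-1 :> R by rewrite mulr_gt0// ltr0n.
have [j0 Hj0] := powR2_eventually_ge (@ltr01 R) e0.
exists (maxn j0 (Num.bound `|M|)) => j; rewrite geq_max => /andP[h1 h2].
apply: (le_trans (ler_norm M)); apply: (le_trans (ltW (archi_boundP (normr_ge0 M)))).
rewrite -powR12_sqrt ?scale_powR; last by apply: le_trans (scale_ge1 _ _ _).
by have := Hj0 j h1; rewrite mul1r; apply: le_trans; rewrite ler_nat.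
Qed.

(** The test set of measure Y^e is occupied for a time of order Y^(e + 1/2): e = 0 for a fixed set,
    e = 1/2 for intervals growing like sqrt Y. The last condition lets this occupation beat the
    factor H^(- a) of the Laplace exponent. *)
Lemma sigma_lower_power d (T : measurableType d) (R : realType)
  (P : probability T R) (B sigma : R -> {RV P >-> R}) (HB : brownian_motion B)
  (alpha : R -> R) (malpha : measurable_fun [set: R] alpha)
  (alpha0 : forall x, 0 < alpha x) (Hs : multistable_subordinator alpha B sigma)
  (n j0 : nat) (A : nat -> set R) (a0 M : nat -> R) (a g e c : R) :
  (forall j, (j0 <= j)%N -> [/\ measurable (A j),
     lebesgue_measure (A j) = (a0 j)%:E, c * scale R n j `^ e <= a0 j,
     0 <= M j <= Num.sqrt (scale R n j) &
     forall x, A j x -> `|x| <= M j /\ alpha x <= a]) ->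
  0 < c -> 0 <= g -> 0 < n%:R * (e + 2^-1) - (n + 6)%:R * (g * a) ->
  \forall om \ae P, exists J, forall j, (J <= j)%N ->
    scale R (n + 6) j `^ g <= sigma (scale R (n + 6) j) om.
Proof.
move=> HA c0 g0 e0.
have k0 : 0 < gauss_peak R / 16 * c by rewrite mulr_gt0// divr_gt0// gauss_peak_gt0.
have [j1 Hj1] := powR2_eventually_ge k0 e0.
apply: (@sigma_lower_as _ _ _ _ _ _ HB alpha malpha alpha0 Hs n (maxn j0 j1) A a0 M
  (fun j => scale R (n + 6) j `^ g) a).
  move=> j; rewrite geq_max => /andP[h1 h2]; have [? ? h _ ?] := HA j h1; split => //.
  by apply: lt_le_trans h; rewrite mulr_gt0// powR_gt0//; apply: lt_le_trans (scale_ge1 _ _ _).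
move=> j; rewrite geq_max => /andP[h1 h2].
have [_ _ h /andP[M0 M1] _] := HA j h1; split => //.
  by rewrite -(powRr0 (scale R (n + 6) j)); apply: ler_powR; rewrite ?scale_ge1.
apply: (le_trans (Hj1 j h2)).
have Y0 : 0 < scale R n j by apply: lt_le_trans (scale_ge1 _ _ _).
apply: (@le_trans _ _ ((scale R (n + 6) j `^ g) `^ (- a) * (gauss_peak R / 16 *
    (c * scale R n j `^ e * Num.sqrt (scale R n j))))); last first.
  apply: ler_wpM2l; first exact: powR_ge0.
  apply: ler_wpM2l; first by rewrite divr_ge0// ltW// gauss_peak_gt0.
  by apply: ler_wpM2r; first exact: sqrtr_ge0.
rewrite -powR12_sqrt ?(ltW Y0)// !scale_powR -powRrM.
rewrite le_eqVlt; apply/orP; left; apply/eqP.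
rewrite (_ : (_ - _) * _ = (n + 6)%:R * g * j%:R ^+ 2 * - a + (n%:R * e * j%:R ^+ 2 + n%:R * 2^-1 * j%:R ^+ 2)); last by ring.
rewrite !powRD; try (by apply/implyP => _; rewrite pnatr_eq0).
ring.
Qed.

Lemma lebesgue_measure_bounded (R : realType) (D : set R) (M : R) : measurable D ->
  (forall x, D x -> `|x| <= M) ->
  exists2 a : R, 0 <= a & lebesgue_measure D = a%:E.
Proof.
move=> mD DM.
have fD : lebesgue_measure D \is a fin_num.
  rewrite ge0_fin_numE//; apply: (@le_lt_trans _ _ (lebesgue_measure `[- M, M])).
    by apply: le_measure; rewrite ?mem_set// => x /DM /=; rewrite in_itv/= ler_norml.
  by rewrite lebesgue_measure_itv/=; case: ifP => _; rewrite -?EFinN -?EFinD ltry.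
exists (fine (lebesgue_measure D)); first exact: fine_ge0.
by rewrite fineK.
Qed.

Lemma jump_mass_upper_bounded d (T : measurableType d) (R : realType)
  (P : probability T R) (B sigma : R -> {RV P >-> R}) (HB : brownian_motion B)
  (alpha : R -> R) (malpha : measurable_fun [set: R] alpha)
  (alpha01 : forall x, 0 < alpha x < 1) (Hs : multistable_subordinator alpha B sigma)
  (n : nat) (amax a M g : R) (D : set R) :
  (forall x, alpha x <= amax) -> amax < 1 -> (forall x, D x -> a <= alpha x) ->
  measurable D -> (forall x, D x -> `|x| <= M) -> 0 <= g -> 2^-1 < g * a -> (0 < n)%N ->
  \forall om \ae P, exists J, forall j, (J <= j)%N ->
    (jump_mass (fun s => sigma s om) (fun w => B w om) (scale R n j) D <=
      (scale R n j `^ g)%:E)%E.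
Proof.
move=> Am am1 Da mD DM g0 ga n0.
have [a0 a00 Da0] := lebesgue_measure_bounded mD DM.
apply: (jump_mass_upper_as HB malpha alpha01 Hs Am am1 Da mD _ g0 ga n0) => [|y y1]; last first.
  by apply: (expected_occ_bounded HB mD Da0 a00); apply: lt_le_trans y1.
by rewrite !mulr_ge0// ltW// gauss_peak_gt0.
Qed.

Lemma jump_mass_setID (R : realType) (f b : R -> R) (y : R) (D E : set R) :
  (forall s t, 0 <= s -> s < t -> f s < f t) ->
  (jump_mass f b y D = jump_mass f b y (D `&` E) + jump_mass f b y (D `&` ~` E))%E.
Proof.
move=> finc; rewrite /jump_mass (esumID (b @^-1` E)); last first.
  by move=> w [/andP[w0 _] _]; rewrite lee_fin; exact: jump_ge0.
congr (_ + _)%E; congr esum; apply/seteqP; split => w /=; tauto.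
Qed.

Lemma measurable_low_set (R : realType) (alpha : R -> R) (astar beta : R) :
  measurable_fun [set: R] alpha -> measurable (low_set alpha astar beta).
Proof.
move=> ma; have [c1|c1] := boolP (astar + beta < 1); last first.
  rewrite (_ : low_set _ _ _ = set0)//; apply/seteqP; split => // x /= /andP[_].
  by rewrite (negbTE c1).
rewrite (_ : low_set _ _ _ = [set: R] `&` alpha @^-1` `]-oo, (astar + beta)[); last first.
  by apply/seteqP; split => x /=; rewrite /low_set /= in_itv/= c1 andbT// => -[].
exact: ma.
Qed.

Lemma time_changed_occupation_as d (T : measurableType d) (R : realType)
  (P : probability T R) (B sigma : R -> {RV P >-> R}) (HB : brownian_motion B)
  (alpha : R -> R) (Hs : multistable_subordinator alpha B sigma)
  (A : set R) (n : nat) (g g' c : R) :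
  measurable A -> (0 < n)%N -> 0 <= g < g' -> 0 <= c ->
  (\forall om \ae P, exists J, forall j, (J <= j)%N ->
    scale R n j `^ g' <= sigma (scale R n j) om) ->
  (\forall om \ae P, exists J, forall j, (J <= j)%N ->
    (jump_mass (fun s => sigma s om) (fun w => B w om) (scale R n j) (~` A) <=
      (c * scale R n j `^ g)%:E)%E) ->
  \forall om \ae P, occupation_fraction (fun s => time_changed B sigma s om) A t
    @[t --> +oo] --> (1 : R).
Proof.
move=> mA n0 gg' c0; apply: filterS2 => om HJ1 HJ2.
apply: (occupation_fraction_cvg1 _ _ _ _ mA n0 gg' c0 HJ1 HJ2).
- exact: (ms_increasing Hs).
- exact: (ms_pure_jump Hs).
- exact: (ms_start Hs).
- exact: (bm_continuous HB).
Qed.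

Lemma bounded_set_norm_le (R : realType) (A : set R) : bounded_set A ->
  exists M, forall x, A x -> `|x| <= M.
Proof.
by move=> [M [_ HM]]; exists (M + 1) => x Ax; apply: (HM (M + 1)) => //; rewrite ltrDl.
Qed.

Theorem theorem4p12 (d : measure_display) (T : measurableType d) (R : realType)
    (P : probability T R) (B sigma : R -> {RV P >-> R})
    (alpha : R -> R) (astar amax aI aJ beta0 : R)
    (alpha01 : forall x, 0 < alpha x < 1)
    (alpha_meas : measurable_fun [set: R] alpha)
    (astar_min : range alpha astar /\ lbound (range alpha) astar)
    (astar_gt0 : 0 < astar)
    (amax_max : range alpha amax /\ ubound (range alpha) amax)
    (amax_lt1 : amax < 1)
    (alpha_pinfty : alpha x @[x --> +oo] --> aI)
    (aI_bounds : astar < aI < 1)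
    (alpha_ninfty : alpha x @[x --> -oo] --> aJ)
    (aJ_bounds : astar < aJ < 1)
    (beta0_gt0 : 0 < beta0)
    (A_hyp : forall beta : R, 0 < beta <= beta0 ->
      let A := low_set alpha astar beta in
      [/\ bounded_set A,
          (0 < @lebesgue_measure R A < +oo)%E &
          @lebesgue_measure R (closure A `\` interior A) = 0%E])
    (HB : brownian_motion B)
    (Hsigma : multistable_subordinator alpha B sigma) :
  let X := time_changed B sigma in
  (2 * astar < Num.min aI aJ ->
     forall beta : R, 0 < beta <= beta0 ->
       {ae P, forall om,
         occupation_fraction (fun s => X s om) (low_set alpha astar beta) t
           @[t --> +oo] --> (1 : R)}) /\
  (Num.min aI aJ < 2 * astar ->
     forall beta K : R, 0 < beta <= beta0 -> 0 < K ->
       {ae P, forall om,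
         occupation_fraction (fun s => X s om)
           (~` low_set alpha astar beta `&` ~` `[- K, K]) t
           @[t --> +oo] --> (1 : R)}).
Proof.
move=> X.
have alpha0 x : 0 < alpha x by case/andP: (alpha01 x).
have Am x : alpha x <= amax by apply: (proj2 amax_max); exists x.
have am x : astar <= alpha x by apply: (proj2 astar_min); exists x.
have mlow b := @measurable_low_set R alpha astar b alpha_meas.
split=> [Hm beta Hb|Hm beta K Hb K0].
- have [_ /andP[lpos _] _] := A_hyp beta Hb.
  (* Otherwise the second inequality in [low_set] makes it empty, against its positive measure. *)
  have ab1 : astar + beta < 1.
    rewrite ltNge; apply/negP => h; move: lpos.
    rewrite (_ : low_set _ _ _ = set0) ?measure0 ?ltxx//.
    by apply/seteqP; split => // x /= /andP[_]; rewrite ltNge h.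
  move: Hm; rewrite lt_min => /andP[HI HJ].
  (* Off the low set, alpha >= astar + beta with occupation of order sqrt y on bounded parts, and
     alpha is near aI or aJ with occupation up to y beyond. Halving the limits turns 1 < g (2 v')
     into the common condition 1/2 < g v'. *)
  have uv : astar < Num.min (Num.min (aI / 2) (aJ / 2)) (astar + beta).
    by rewrite !lt_min; case/andP: Hb => ? ?; apply/and3P || apply/andP; split; rewrite ?ltr_pdivlMr//; lra.
  have [g [g' [u' [v' [uu' vv' gg' gv gu]]]]] := exponent_gap astar_gt0 uv.
  move: vv'; rewrite !lt_min => /andP[/andP[vI vJ] vb].
  have g0 : 0 < g by case/andP: gg'.
  have g'0 : 0 < g' by case/andP: gg' => ? ?; lra.
  have [MI [_ HMI]] : \forall x \near +oo, 2 * v' < alpha x by apply: (cvgr_gt aI) => //; lra.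
  have [MJ [_ HMJ]] : \forall x \near -oo, 2 * v' < alpha x by apply: (cvgr_gt aJ) => //; lra.
  pose M := Num.max `|MI| `|MJ| + 1.
  have HM x : ~ `|x| <= M -> 2 * v' <= alpha x.
    move=> /negP; rewrite -ltNge /M -ltrBrDr gt_max => /andP[h1 h2].
    have := ler_norm MI; have := ler_norm (- MJ); rewrite normrN => h3 h4.
    have [x0|x0] := lerP 0 x; apply: ltW.
      by apply: HMI; apply: (le_lt_trans h4); apply: (lt_trans h1); rewrite ger0_norm// gtrBl.
    by apply: HMJ; rewrite -[MJ]opprK ltrNr; apply: (le_lt_trans h3); apply: (lt_trans h2); rewrite ltr0_norm// gtrBl.
  (* Ensures alpha < u' on the test set, while eps <= beta0 makes its measure positive by
     [A_hyp]. *)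
  pose eps := Num.min (u' - astar) beta0.
  have epsb : 0 < eps <= beta0 by rewrite /eps lt_min ge_min lexx orbT andbT beta0_gt0 subr_gt0 uu'.
  have [bA /andP[Apos _] _] := A_hyp eps epsb.
  have [MA HMA] := bounded_set_norm_le bA.
  have [a0 a00 HA0] := lebesgue_measure_bounded (mlow eps) HMA.
  have a0pos : 0 < a0 by move: Apos; rewrite HA0 lte_fin.
  have gu0 : 0 < g' * u' by rewrite mulr_gt0//; lra.
  have [n [n0 Hn]] := exists_large_scale gu0 gu.
  have [j0 Hj0] := scale_sqrt_eventually_ge MA n0.
  have N0 : (0 < n + 6)%N by rewrite addn_gt0 n0.
  (* The complement is cut at |x| = M into two pieces, each carrying a jump mass of at most Y^g. *)
  have c2 : 0 <= 2 :> R by [].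
  have gg0 : 0 <= g < g' by case/andP: gg' => ? ?; apply/andP; split => //; exact: ltW.
  apply: (time_changed_occupation_as HB Hsigma (mlow beta) N0 gg0 c2).
    apply: (@sigma_lower_power _ _ _ _ _ _ HB alpha alpha_meas alpha0 Hsigma n j0
      (fun=> low_set alpha astar eps) (fun=> a0) (fun=> Num.max 0 MA) u' g' 0 a0) => //.
    + move=> j jj; split => //; first by rewrite powRr0 mulr1.
        by rewrite le_max lexx/= ge_max sqrtr_ge0/=; exact: Hj0.
      move=> x Ax; split; first by rewrite le_max HMA ?orbT.
      apply: ltW; case/andP: Ax => h _; apply: (lt_le_trans h).
      by rewrite -lerBrDl /eps ge_min lexx.
    + exact: ltW.
    + by rewrite add0r.
  have mI : measurable [set x : R | `|x| <= M].
    rewrite (_ : [set x | _] = `[- M, M]%classic)//.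
    by apply/seteqP; split => x /=; rewrite in_itv/= ler_norml.
  have D1 := @jump_mass_upper_bounded _ _ _ _ _ _ HB alpha alpha_meas alpha01 Hsigma
    (n + 6) amax v' M g (~` low_set alpha astar beta `&` [set x | `|x| <= M]) Am amax_lt1.
  have D2 := @jump_mass_upper_as _ _ _ _ _ _ HB alpha alpha_meas alpha01 Hsigma
    (n + 6) amax (2 * v') 1 1 g (~` low_set alpha astar beta `&` ~` [set x | `|x| <= M]) Am amax_lt1.
  have {}D1 := D1 _ _ _ (ltW g0) gv N0.
  have {}D2 := D2 _ _ ler01 (ltW g0) _ N0 _.
  apply: (filterS2 _ _ (D1 _ _ _) (D2 _ _ _ _)).
  + move=> om [J1 HJ1] [J2 HJ2]; exists (maxn J1 J2) => j; rewrite geq_max => /andP[h1 h2].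
    rewrite (jump_mass_setID _ _ _ [set x | `|x| <= M] (ms_increasing Hsigma om)).
    rewrite (_ : 2 * _ = scale R (n + 6) j `^ g + scale R (n + 6) j `^ g); last by ring.
    by rewrite EFinD; apply: leeD; [exact: HJ1|exact: HJ2].
  + move=> x [Ax _]; apply: ltW; apply: (lt_le_trans vb); rewrite leNgt; apply/negP => h.
    by apply: Ax; apply/andP.
  + by apply: measurableI => //; apply: measurableC.
  + by move=> x [].
  + by move=> x [_ /HM].
  + by apply: measurableI; apply: measurableC.
  + by lra.
  + by move=> y y1; apply: (expected_occ_le HB); [apply: measurableI; apply: measurableC|apply: lt_le_trans y1].
- have [bA _ _] := A_hyp beta Hb.
  have [MA HMA] := bounded_set_norm_le bA.
  (* The roles are exchanged: growth now comes from the far region, with occupation of order Y, and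
     the negligible set is bounded with alpha >= astar, with occupation of order sqrt Y. Hence m / 2
     is compared with astar. *)
  have uv : Num.min aI aJ / 2 < astar by rewrite ltr_pdivrMr// mulrC.
  have u0 : 0 < Num.min aI aJ / 2.
    by rewrite divr_gt0// lt_min; case/andP: aI_bounds => ? _; case/andP: aJ_bounds => ? _; apply/andP; split; lra.
  have [g [g' [u' [v' [uu' vv' gg' gv gu]]]]] := exponent_gap u0 uv.
  have g0 : 0 < g by case/andP: gg'.
  have g'0 : 0 < g' by case/andP: gg' => ? ?; lra.
  have gg0 : 0 <= g < g' by case/andP: gg' => ? ?; apply/andP; split => //; exact: ltW.
  have u'0 : 0 < u' by lra.
  pose A := ~` low_set alpha astar beta `&` ~` `[- K, K].
  have mA : measurable A by apply: measurableI; apply: measurableC.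
  have AC x : (~` A) x -> `|x| <= Num.max MA K.
    rewrite le_max => nA; apply/orP; have [h|h] := pselect (low_set alpha astar beta x).
      by left; exact: HMA.
    right; rewrite ler_norml; apply: contrapT => h'; apply: nA; split => //.
  have gu0 : 0 < g' * (2 * u') by rewrite !mulr_gt0.
  (* The right-hand side is e + 1/2 for e = 1/2, as required by [sigma_lower_power]. *)
  have gu1 : g' * (2 * u') < 2^-1 + 2^-1 by rewrite mulrCA; lra.
  have [n [n0 Hn]] := exists_large_scale gu0 gu1.
  have N0 : (0 < n + 6)%N by rewrite addn_gt0 n0.
  apply: (time_changed_occupation_as HB Hsigma mA N0 gg0 ler01); last first.
    under eq_near do under eq_exists do under eq_forall do rewrite mul1r.
    apply: (jump_mass_upper_bounded HB alpha_meas alpha01 Hsigma Am amax_lt1 _ _ AC (ltW g0) gv N0).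
    + by move=> x _; apply: ltW; apply: lt_le_trans vv' (am x).
    + exact: measurableC.
  (* [A' r] will be an interval of length r starting at distance K' from 0, on the side where alpha
     comes close to m. Requiring 2 K' <= sqrt Y keeps K' + sqrt Y / 4 below sqrt Y. *)
  have lower (K' : R) (A' : R -> set R) : 0 <= K' ->
      (forall r, 0 <= r -> [/\ measurable (A' r), lebesgue_measure (A' r) = r%:E &
        forall x, A' r x -> `|x| <= K' + r /\ alpha x <= 2 * u']) ->
      \forall om \ae P, exists J, forall j, (J <= j)%N ->
        scale R (n + 6) j `^ g' <= sigma (scale R (n + 6) j) om.
    move=> K'0 HA'; have [j0 Hj0] := scale_sqrt_eventually_ge (2 * K') n0.
    have r0 j : 0 <= 4^-1 * Num.sqrt (scale R n j) by rewrite mulr_ge0// sqrtr_ge0.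
    apply: (@sigma_lower_power _ _ _ _ _ _ HB alpha alpha_meas alpha0 Hsigma n j0
      (fun j => A' (4^-1 * Num.sqrt (scale R n j))) (fun j => 4^-1 * Num.sqrt (scale R n j))
      (fun j => K' + 4^-1 * Num.sqrt (scale R n j)) (2 * u') g' 2^-1 4^-1) => //; last exact: ltW.
    move=> j jj; have [mA' lA' A'M] := HA' _ (r0 j); split => //.
      by rewrite powR12_sqrt//; apply: le_trans (scale_ge1 _ _ _).
    have := Hj0 j jj; have := r0 j => h1 h2.
    by apply/andP; split; lra.
  have itvr (x r : R) : 0 <= r -> lebesgue_measure `[x, x + r] = r%:E.
    move=> r0; rewrite lebesgue_measure_itv/= lte_fin ltrDl -EFinB addrAC subrr add0r.
    by case: ltgtP r0 => // <-.
  have : Num.min aI aJ < 2 * u' by rewrite ltr_pdivrMr// mulrC in uu'.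
  rewrite gt_min => /orP[HI|HJ].
    have [MI [_ HMI]] : \forall x \near +oo, alpha x < 2 * u' by apply: (cvgr_lt aI).
    apply: (lower (`|MI| + 1) (fun r => `[`|MI| + 1, `|MI| + 1 + r]%classic)).
      by rewrite addr_ge0.
    move=> r r0; split; [exact: measurable_itv|exact: itvr|].
    have := ler_norm MI; have := normr_ge0 MI => h1 h2.
    move=> x; rewrite /= in_itv/= => /andP[h3 h4].
    rewrite ger0_norm; last lra.
    by split=> //; apply/ltW/HMI; lra.
  have [MJ [_ HMJ]] : \forall x \near -oo, alpha x < 2 * u' by apply: (cvgr_lt aJ).
  (* The right end - K' is written as the left end plus r, to match [itvr]. *)
  apply: (lower (`|MJ| + 1) (fun r => `[- (`|MJ| + 1 + r), - (`|MJ| + 1 + r) + r]%classic)).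
    by rewrite addr_ge0.
  move=> r r0; split; [exact: measurable_itv|exact: itvr|].
  have := ler_norm (- MJ); rewrite normrN; have := normr_ge0 MJ => h1 h2.
  move=> x; rewrite /= in_itv/= => /andP[h3 h4].
  rewrite ler0_norm; last lra.
  by split; [lra|apply/ltW/HMJ; lra].
Qed.
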